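(* Let $(X,d,\ll,\leq,\tau)$ be a Lorentzian pre-length space that satisfies future (respectively past) timelike $K$-monotonicity comparison from below for some $K\in\mathbb{R}$. Then for any $x\in X$ and any future (respectively past) directed timelike geodesics $\alpha,\beta\colon[0,B]\rightarrow X$ with $\alpha(0)=\beta(0)=x$ one has $$\measuredangle_x(\alpha,\beta)\geq \tilde\measuredangle_x^K(\alpha(s),\beta(t))$$ for all sufficiently small $s,t\in(0,B]$ (in particular such that timelike size bounds for $K$ are satisfied) for which $\alpha(s)$ and $\beta(t)$ are causally related. If instead $X$ satisfies future (respectively past) timelike $K$-monotonicity comparison from above, then under the same conditions on $\alpha,\beta,s,t$ one has $\measuredangle_x(\alpha,\beta)\leq \tilde\measuredangle_x^K(\alpha(s),\beta(t))$.
   Context: A causal space is a set $X$ with two transitive relations $\ll,\leq$ such that $\leq$ is reflexive and $p\ll q$ implies $p\leq q$. A Lorentzian pre-length space $(X,d,\ll,\leq,\tau)$ is a causal space with a metric $d$ and a map $\tau\colon X\times X\to[0,\infty]$ that is lower semicontinuous with respect to $d$, satisfies $\tau(p,r)\geq\tau(p,q)+\tau(q,r)$ for $p\leq q\leq r$, and $\tau(p,q)>0\Leftrightarrow p\ll q$. A non-constant locally Lipschitz curve $\gamma\colon I\to X$ is future directed causal (timelike) if $\gamma(t_1)\leq\gamma(t_2)$ ($\gamma(t_1)\ll\gamma(t_2)$) for all $t_1<t_2$; past directed with relations reversed. $L_\tau(\gamma)$ is the infimum of $\sum_i\tau(\gamma(t_i),\gamma(t_{i+1}))$ over partitions. A future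 directed causal $\gamma$ from $p$ to $q$ is a distance realizer (maximal) if $L_\tau(\gamma)=\tau(p,q)$ (past directed: after reversal). A causal curve is a geodesic if each parameter has a neighborhood $[a,b]$ in its domain on which it is a distance realizer. An open set $U$ is strictly timelike geodesically connected if for all $x\ll y$ in $U$ there is a future directed maximal geodesic in $U$ from $x$ to $y$, and any such maximal geodesic in $U$ is timelike. Model spaces: $\mathbb{R}^n_m$ is $\mathbb{R}^n$ with $b(v,w)=-\sum_{i\leq m}v_iw_i+\sum_{i>m}v_iw_i$. $\mathbb{L}^2(K)$ is the universal cover of $\{v\in\mathbb{R}^3_1:b(v,v)=1/K\}$ for $K>0$, of $\{v\in\mathbb{R}^3_2:b(v,v)=-1/|K|\}$ for $K<0$, and $\mathbb{R}^2_1$ for $K=0$. $D_K=\pi/\sqrt{-K}$ for $K<0$, $D_K=\infty$ for $K\geq0$. A triangle satisfies timelike size bounds for $K$ if its longest side-length is $<D_K$. A timelike geodesic triangle consists of $p_1\ll p_2\ll p_3$ with finite mutual time separations and distance realizers (sides) $[p_i,p_j]$ from $p_i$ to $p_j$, $i<j$. $K$-comparison angle: if $x,y,z$ are pairwise causally related with finite time separations satisfying timelike size bounds for $K$, and $y,z$ are timelike related to $x$ (in either direction), then $\tilde\measuredangle^K_x(y,z)=\operatorname{arcosh}|\langle u,v\rangle|$, where $u,v$ are the unit timelike initial velocities at $\bar x$ of the geodesics from $\bar x$ to $\bar y$ and $\bar z$ in a comparison triangle in $\mathbb{L}^2(K)$ (a triple of points with the same causal order and time separations). The (upper) angle is $\measuredangle_x(\alpha,\beta)=\limsup\tilde\measuredangle^0_x(\alpha(s),\beta(t))\in[0,\infty]$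 as $s,t\searrow0$ over those $s,t>0$ with $\alpha(s),\beta(t)$ causally related and the time separations between $x,\alpha(s),\beta(t)$ finite. $X$ satisfies future timelike $K$-monotonicity comparison from below (above) if every point has a neighborhood $U$ such that (i) $\tau|_{U\times U}$ is finite and continuous; (ii) $U$ is strictly timelike geodesically connected; (iii) whenever $x\ll y\ll z$ form a timelike geodesic triangle in $U$ whose side-lengths satisfy timelike size bounds for $K$, and $z'\in[x,z]$, $y'\in[x,y]$ with $y'\neq x\neq z'$ and $z'$ causally related to $y'$, then $\tilde\measuredangle_x^K(y',z')\geq\tilde\measuredangle_x^K(y,z)$ (respectively $\leq$). Past $K$-monotonicity comparison is defined analogously with $x'\in[x,z]$, $y'\in[y,z]$, $x'\neq z\neq y'$ causally related, and the inequality $\tilde\measuredangle_z^K(x',y')\geq\tilde\measuredangle_z^K(x,y)$ (respectively $\leq$). *)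

(* Defs.v *)
From HB Require Import structures.
From mathcomp Require Import all_boot all_order all_algebra.
From mathcomp Require Import all_classical all_reals all_analysis.
From mathcomp Require Import ring lra.

Set Implicit Arguments.
Unset Strict Implicit.
Unset Printing Implicit Defensive.

Import Order.TTheory GRing.Theory Num.Theory.
Import numFieldNormedType.Exports.

Local Open Scope classical_set_scope.
Local Open Scope ring_scope.

Section model_spaces.
Variable R : realType.
Implicit Types K : R.

Definition cosh (x : R) : R := (expR x + expR (- x)) / 2.
Definition sinh (x : R) : R := (expR x - expR (- x)) / 2.
(* the inverse of cosh on [1, +oo[ *)
Definition arcosh (x : R) : R := ln (x + Num.sqrt (x ^+ 2 - 1)).

(* the scalar product of R^n_m; indices start at 0 *)
Definition bform (m n : nat) (v w : 'rV[R]_n) : R :=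
  \sum_(i < n) (if (i < m)%N then - 1 else 1) * v 0 i * w 0 i.

(* L^2(K) lives over R^3_1 (K > 0), R^3_2 (K < 0), or is R^2_1 (K = 0) *)
Definition model_dim K : nat := if K == 0 then 2 else 3.
Definition model_index K : nat := if K < 0 then 2 else 1.
Definition mform K (v w : 'rV[R]_(model_dim K)) : R := bform (model_index K) v w.

(* L^2(K) is the plane R * R together with the universal covering map [cover K]
   onto the quadric (see cover_range), from which it gets its Lorentzian
   structure; the first coordinate of the plane is a time function. *)
Definition cover_coord K (p : R * R) : seq R :=
  let r := (Num.sqrt `|K|)^-1 in
  if K == 0 then [:: p.1; p.2]
  else if 0 < K then
    [:: r * sinh p.1; r * cosh p.1 * cos p.2; r * cosh p.1 * sin p.2]
  else [:: r * cosh p.2 * cos p.1; r * cosh p.2 * sin p.1; r * sinh p.2].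

Definition cover K (p : R * R) : 'rV[R]_(model_dim K) :=
  \row_i (cover_coord K p)`_i.

Definition C1_curve (s : R -> R * R) : Prop :=
  [/\ forall t, derivable (fst \o s) t 1, forall t, derivable (snd \o s) t 1,
      continuous (derive1 (fst \o s)) &
      continuous (derive1 (snd \o s))].

Definition velocity K (s : R -> R * R) : R -> 'rV[R]_(model_dim K) :=
  derive1 (cover K \o s).

(* Every C1 curve on `[0, 1] extends to a C1 curve on R; only its restriction
   to `[0, 1] matters here. *)
Definition future_causal_arc K (s : R -> R * R) : Prop :=
  C1_curve s /\ forall t : R, 0 <= t <= 1 ->
    0 < derive1 (fst \o s) t /\ mform (velocity K s t) (velocity K s t) <= 0.

Definition arc_length K (s : R -> R * R) : R :=
  \int[lebesgue_measure]_(t in `[0, 1])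
    Num.sqrt (- mform (velocity K s t) (velocity K s t)).

(* [causal_path K p q l]: some future directed causal, piecewise C1 (possibly
   constant) curve of L^2(K) from p to q has length l *)
Inductive causal_path K (p : R * R) : R * R -> R -> Prop :=
| causal_path_refl : causal_path K p p 0
| causal_path_snoc q l s : causal_path K p q l ->
    future_causal_arc K s -> s 0 = q ->
    causal_path K p (s 1) (l + arc_length K s).

Definition model_caus K (p q : R * R) : Prop := exists l, causal_path K p q l.

(* 0 is added so that the time separation of causally unrelated points is 0 *)
Definition model_tau K (p q : R * R) : \bar R :=
  ereal_sup [set l%:E | l in [set l | l = 0 \/ causal_path K p q l]].

Definition tangent K (c w : 'rV[R]_(model_dim K)) : Prop :=
  K != 0 -> mform w c = 0.

(* The covariant acceleration, i.e. the tangential part of the acceleration in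
   the ambient space, vanishes. L^2(K) is geodesically complete, so geodesics
   are taken to be defined on all of R. *)
Definition model_geodesic K (s : R -> R * R) : Prop :=
  C1_curve s /\ forall t : R, derivable (velocity K s) t 1 /\
    forall w, tangent (cover K (s t)) w -> mform (derive1 (velocity K s) t) w = 0.

Definition unit_initial_velocity K (p q : R * R) (u : 'rV[R]_(model_dim K)) :=
  mform u u = - 1 /\ exists s L,
    [/\ 0 < L, model_geodesic K s, s 0 = p, s L = q & u = velocity K s 0].

Definition model_diameter K : \bar R :=
  if K < 0 then (pi / Num.sqrt (- K))%:E else +oo%E.

Lemma cosh2_sinh2 (x : R) : cosh x ^+ 2 = 1 + sinh x ^+ 2.
Proof.
have e : expR x * expR (- x) = 1 by rewrite -expRD subrr expR0.
rewrite /cosh /sinh; move: (expR x) (expR (- x)) e => a b ab.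
have -> : b = a^-1.
  by rewrite -[RHS]mulr1 -ab mulKf//; apply/eqP => a0; move/eqP: ab;
    rewrite a0 mul0r eq_sym oner_eq0.
have a0 : a != 0.
  by apply/eqP => a0; move/eqP: ab; rewrite a0 mul0r eq_sym oner_eq0.
by field.
Qed.

Lemma cosh_gt0 (x : R) : 0 < cosh x.
Proof. by rewrite divr_gt0// addr_gt0// expR_gt0. Qed.

Lemma sinh_surj (y : R) : exists x, sinh x = y.
Proof.
have y0 : 0 < y + Num.sqrt (y ^+ 2 + 1).
  have : Num.sqrt (y ^+ 2) < Num.sqrt (y ^+ 2 + 1) by rewrite ltr_sqrt ?ltrDl// ltr_wpDl ?sqr_ge0.
  rewrite sqrtr_sqr => h; rewrite -ltrBlDl sub0r; apply: le_lt_trans h.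
  by rewrite -normrN ler_norm.
exists (ln (y + Num.sqrt (y ^+ 2 + 1))).
have := sqr_sqrtr (addr_ge0 (sqr_ge0 y) ler01).
rewrite /sinh expRN lnK ?posrE//; move: (Num.sqrt _) y0 => w y0 w2.
have yw : y + w != 0 by rewrite gt_eqF.
suff -> : (y + w)^-1 = w - y by field.
by apply: (mulfI yw); rewrite divff//; nra.
Qed.

Lemma polar_coordinates (a b c : R) : 0 < c -> a ^+ 2 + b ^+ 2 = c ^+ 2 ->
  exists x, a = c * cos x /\ b = c * sin x.
Proof.
move=> c0 abc.
have cN : c != 0 by rewrite gt_eqF.
have ac : -1 <= a / c <= 1.
  by rewrite ler_pdivlMr// ler_pdivrMr//; apply/andP; split; nra.
have sb : Num.sqrt (1 - (a / c) ^+ 2) = `|b| / c.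
  have -> : 1 - (a / c) ^+ 2 = (b / c) ^+ 2.
    have -> : (a / c) ^+ 2 = a ^+ 2 / c ^+ 2 by field.
    have -> : a ^+ 2 = c ^+ 2 - b ^+ 2 by lra.
    by field.
  by rewrite sqrtr_sqr normrM normfV (gtr0_norm c0).
have [b0|b0] := leP 0 b.
- exists (acos (a / c)); rewrite acosK// sin_acos// sb ger0_norm//.
  by split; field.
- exists (- acos (a / c)); rewrite cosN sinN acosK// sin_acos// sb ltr0_norm//.
  by split; field.
Qed.

Lemma cover_range K : K != 0 -> range (cover K) = [set v | mform v v = K^-1].
Proof.
move=> K0; have r0 : 0 < (Num.sqrt `|K|)^-1.
  by rewrite invr_gt0 sqrtr_gt0 normr_gt0.
have r2 : (Num.sqrt `|K|)^-1 ^+ 2 = `|K|^-1 by rewrite exprVn sqr_sqrtr.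
rewrite /cover /mform /model_dim /model_index /cover_coord (negbTE K0).
move: (Num.sqrt `|K|)^-1 r0 r2 => r r0 r2.
have rN : r != 0 by rewrite gt_eqF.
have [Kpos|Kneg|/eqP] := ltgtP 0 K; last by rewrite eq_sym (negbTE K0).
- move: r2; rewrite gtr0_norm// => r2.
  apply/seteqP; split => [v [p _ <-]|v] /=; rewrite /bform !big_ord_recl big_ord0 ?mxE/= -r2.
    have := cosh2_sinh2 p.1; have := cos2Dsin2 p.2.
    move: (cos _) (sin _) (cosh _) (sinh _) => a b c d ab cd.
    transitivity (r ^+ 2 * (c ^+ 2 * (a ^+ 2 + b ^+ 2) - d ^+ 2)); first by ring.
    by rewrite ab cd; ring.
  set i1 := lift _ _; set i2 := lift _ _ => h.
  have [t ht] := sinh_surj (v 0 ord0 / r).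
  have ct := cosh2_sinh2 t.
  have [||th [h1 h2]] := @polar_coordinates (v 0 i1) (v 0 i2) (r * cosh t).
  + by rewrite mulr_gt0 ?cosh_gt0.
  + have h0 : v 0 ord0 = r * sinh t by rewrite ht; field.
    by rewrite exprMn ct; rewrite h0 in h; lra.
  exists (t, th) => //; apply/rowP => i; rewrite mxE/=.
  have h0 : v 0 ord0 = r * sinh t by rewrite ht; field.
  have [->|->|->] : [\/ i = ord0, i = i1 | i = i2].
    by case: i => -[|[|[|]]]//= ?; [apply: Or31|apply: Or32|apply: Or33]; exact: val_inj.
  - by rewrite [RHS]h0.
  - by rewrite [RHS]h1.
  - by rewrite [RHS]h2.
- move: r2; rewrite ltr0_norm// => r2.
  have {}r2 : K^-1 = - r ^+ 2 by rewrite r2 invrN opprK.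
  apply/seteqP; split => [v [p _ <-]|v] /=; rewrite /bform !big_ord_recl big_ord0 ?mxE/= r2.
    have := cosh2_sinh2 p.2; have := cos2Dsin2 p.1.
    move: (cos _) (sin _) (cosh _) (sinh _) => a b c d ab cd.
    transitivity (r ^+ 2 * (d ^+ 2 - c ^+ 2 * (a ^+ 2 + b ^+ 2))); first by ring.
    by rewrite ab cd; ring.
  set i1 := lift _ _; set i2 := lift _ _ => h.
  have [x hx] := sinh_surj (v 0 i2 / r).
  have cx := cosh2_sinh2 x.
  have h0 : v 0 i2 = r * sinh x by rewrite hx; field.
  have [||t [h1 h2]] := @polar_coordinates (v 0 ord0) (v 0 i1) (r * cosh x).
  + by rewrite mulr_gt0 ?cosh_gt0.
  + by rewrite exprMn cx; rewrite h0 in h; lra.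
  exists (t, x) => //; apply/rowP => i; rewrite mxE/=.
  have [->|->|->] : [\/ i = ord0, i = i1 | i = i2].
    by case: i => -[|[|[|]]]//= ?; [apply: Or31|apply: Or32|apply: Or33]; exact: val_inj.
  all: by rewrite /= ?h0 ?h1 ?h2.
Qed.

End model_spaces.

Record lorentzPreLength (R : realType) := LorentzPreLength {
  carrier :> metricType R ;
  chron : carrier -> carrier -> Prop ;
  caus : carrier -> carrier -> Prop ;
  tau : carrier -> carrier -> \bar R ;
  chron_trans : forall p q r, chron p q -> chron q r -> chron p r ;
  caus_trans : forall p q r, caus p q -> caus q r -> caus p r ;
  caus_refl : forall p, caus p p ;
  chron_caus : forall p q, chron p q -> caus p q ;
  tau_ge0 : forall p q, (0 <= tau p q)%E ;
  tau_lsc : lower_semicontinuous (fun pq : carrier * carrier => tau pq.1 pq.2) ;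
  tau_reverse_triangle : forall p q r, caus p q -> caus q r ->
    (tau p q + tau q r <= tau p r)%E ;
  tau_gt0 : forall p q, (0 < tau p q)%E <-> chron p q }.

Variant time_dir := Future | Past.

Section lorentz.
Variables (R : realType) (X : lorentzPreLength R).
Implicit Types (p q x y z : X) (g : R -> X) (I : set R) (U S : set X) (K : R).

(* A curve on I is represented by a total function; only its values on I matter. *)
Definition locally_lipschitz I g : Prop :=
  forall t, I t -> exists2 V, nbhs t V & exists C : R, forall s s',
    (V `&` I) s -> (V `&` I) s' -> mdist (g s) (g s') <= C * `|s - s'|.

Definition nonconstant I g : Prop := exists s t, [/\ I s, I t & g s <> g t].

Definition directed_curve (r : X -> X -> Prop) I g : Prop :=
  [/\ locally_lipschitz I g, nonconstant I g &
      forall s t, I s -> I t -> s < t -> r (g s) (g t)].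

Definition along (d : time_dir) (r : X -> X -> Prop) : X -> X -> Prop :=
  match d with Future => r | Past => fun p q => r q p end.

Definition causal_curve d I g := directed_curve (along d (@caus R X)) I g.
Definition timelike_curve d I g := directed_curve (along d (@chron R X)) I g.

Definition tau_length (a b : R) g : \bar R :=
  ereal_inf [set (\sum_(i < size s)
      tau (g (nth b (a :: s) i)) (g (nth b (a :: s) i.+1)))%E
    | s in itv_partition a b].

Definition future_realizer (a b : R) g : Prop :=
  [/\ a < b, causal_curve Future `[a, b] g & tau_length a b g = tau (g a) (g b)].

Definition realizer d (a b : R) g : Prop :=
  match d with
  | Future => future_realizer a b g
  | Past => future_realizer a b (fun t => g (a + b - t))
  end.

Definition geodesic d (a b : R) g : Prop :=
  causal_curve d `[a, b] g /\
  forall t, `[a, b]%classic t -> exists c e, [/\ `[c, e] `<=` `[a, b],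
    \forall s \near t, `[a, b]%classic s -> `[c, e]%classic s & realizer d c e g].

Definition timelike_geodesic d (a b : R) g : Prop :=
  geodesic d a b g /\ timelike_curve d `[a, b] g.

Definition maximal_geodesic_in U x y (a b : R) g : Prop :=
  [/\ realizer Future a b g, geodesic Future a b g, g a = x, g b = y &
      g @` `[a, b] `<=` U].

(* Inserting a pause into a maximal geodesic gives a maximal geodesic that is
   causal but not timelike, so "any maximal geodesic is timelike" can only be
   asked of parametrizations without pauses. *)
Definition pause_free (a b : R) g : Prop :=
  forall c e, a <= c -> c < e -> e <= b -> nonconstant `[c, e] g.

Definition strictly_timelike_geodesically_connected U : Prop :=
  open U /\ forall x y, U x -> U y -> chron x y ->
    (exists a b g, maximal_geodesic_in U x y a b g) /\
    (forall a b g, maximal_geodesic_in U x y a b g -> pause_free a b g ->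
      timelike_curve Future `[a, b] g).

(* S is (the image of) a side [x, y] *)
Definition side x y S : Prop :=
  exists a b g, [/\ realizer Future a b g, g a = x, g b = y & S = g @` `[a, b]].

Definition timelike_triangle_in U x y z Sxy Syz Sxz : Prop :=
  [/\ chron x y /\ chron y z,
      [/\ (tau x y < +oo)%E, (tau y z < +oo)%E & (tau x z < +oo)%E],
      [/\ side x y Sxy, side y z Syz & side x z Sxz] &
      [/\ Sxy `<=` U, Syz `<=` U & Sxz `<=` U]].

Definition causally_related p q : Prop := caus p q \/ caus q p.
Definition timelike_related p q : Prop := chron p q \/ chron q p.

(* time separation in whichever order the points are related *)
Definition sep p q : \bar R := maxe (tau p q) (tau q p).

Definition size_bounds K x y z : Prop :=
  (maxe (sep x y) (maxe (sep y z) (sep x z)) < model_diameter K)%E.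

Definition pairwise_causal_finite x y z : Prop :=
  [/\ causally_related x y, causally_related y z & causally_related x z] /\
  [/\ (sep x y < +oo)%E, (sep y z < +oo)%E & (sep x z < +oo)%E].

Definition has_comparison_angle K x y z : Prop :=
  [/\ pairwise_causal_finite x y z, size_bounds K x y z,
      timelike_related x y & timelike_related x z].

(* Only implications are asked for the causal relations: if y <= z, y <> z,
   tau y z = 0 and tau x y = tau x z, then the comparison points of y and z
   necessarily coincide. *)
Definition same_relation K p q (p' q' : R * R) : Prop :=
  [/\ caus p q -> model_caus K p' q', caus q p -> model_caus K q' p',
      model_tau K p' q' = tau p q & model_tau K q' p' = tau q p].

Definition comparison_triangle K x y z (x' y' z' : R * R) : Prop :=
  [/\ same_relation K x y x' y', same_relation K y z y' z' &
      same_relation K x z x' z'].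

Definition is_comparison_angle K x y z (theta : R) : Prop :=
  exists (x' y' z' : R * R) (u v : 'rV[R]_(model_dim K)),
    [/\ comparison_triangle K x y z x' y' z', unit_initial_velocity x' y' u,
        unit_initial_velocity x' z' v & theta = arcosh `|mform u v|].

(* meaningful when [has_comparison_angle K x y z]; 0 if there is no such angle *)
Definition comparison_angle K x y z : R := xget 0 (is_comparison_angle K x y z).

(* Only for curves such that pairs (s, t) as below exist arbitrarily close to
   (0, 0); the limsup along the trivial filter would be -oo. *)
Definition upper_angle x (f g : R -> X) : \bar R :=
  limf_esup (fun st : R * R => (comparison_angle 0 x (f st.1) (g st.2))%:E)
    (within [set st | pairwise_causal_finite x (f st.1) (g st.2)]
      (filter_prod (0 : R)^'+ (0 : R)^'+)).

Definition monotonicity_condition d (r : rel R) K U : Prop :=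
  forall x y z Sxy Syz Sxz, timelike_triangle_in U x y z Sxy Syz Sxz ->
    size_bounds K x y z ->
    match d with
    | Future => forall y' z', Sxy y' -> Sxz z' -> y' <> x -> z' <> x ->
        causally_related z' y' ->
        r (comparison_angle K x y' z') (comparison_angle K x y z)
    | Past => forall x' y', Sxz x' -> Syz y' -> x' <> z -> y' <> z ->
        causally_related x' y' ->
        r (comparison_angle K z x' y') (comparison_angle K z x y)
    end.

Definition monotonicity_comparison d (r : rel R) K : Prop :=
  forall p, exists U, [/\ nbhs p U,
    (forall x y, U x -> U y -> (tau x y < +oo)%E) /\
      {within U `*` U, continuous (fun xy : X * X => tau xy.1 xy.2)},
    strictly_timelike_geodesically_connected U &
    monotonicity_condition d r K U].

End lorentz.

Definition monotonicity_from_below (R : realType) (X : lorentzPreLength R) d K :=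
  @monotonicity_comparison R X d (fun a b => b <= a) K.
Definition monotonicity_from_above (R : realType) (X : lorentzPreLength R) d K :=
  @monotonicity_comparison R X d (fun a b => a <= b) K.

(* Main.v *)
Require Import Defs.
From mathcomp Require Import all_boot all_order all_algebra.
From mathcomp Require Import all_classical all_reals all_analysis.
From mathcomp Require Import ring lra.

Set Implicit Arguments.
Unset Strict Implicit.
Unset Printing Implicit Defensive.

Import Order.TTheory GRing.Theory Num.Theory.
Import numFieldNormedType.Exports.

Local Open Scope classical_set_scope.
Local Open Scope ring_scope.
(* [cover] also names a definition of classical_sets. *)
Import Defs.

(** Let r be the order on angles which the monotonicity condition provides. Along
the two geodesics the K-comparison angle at x is then monotone: if s' <= s and
t' <= t, and both pairs of points are causally related, the angle for (s', t')
and the angle for (s, t) are compared by r ([angle_monotone]). Near x, the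
K-comparison angle and the 0-comparison angle of the same pair differ by
arbitrarily little ([comparison_angle_le]). Hence the limes superior of the
0-comparison angles, which is the upper angle, is bounded by the K-comparison
angle for (s, t): from above because all pairs close to (0, 0) obey the bound,
and from below because there are related pairs arbitrarily close to (0, 0)
([related_pairs]).

Comparison angles are defined by triangles in the universal covering of a
quadric, and both steps rest on the law of cosines there: a chain x << y <= z of
small time separations a, b, c has a comparison triangle, and all its comparison
triangles have the angle with hyperbolic cosine
[1 + 2 (sn^2 ((c - a) / 2) - sn^2 (b / 2)) / (sn a sn c)], where sn'' = K sn
([comparison_angleE]). This formula is continuous in b and c, and for small
arguments sn is almost linear, whatever K is.

For the law of cosines, geodesics are integrated in the ambient space, where
they solve a linear equation ([unit_geodesicE]), and the time separation of the
model plane has to be computed ([model_tau_chord]): for comparable points p and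
q at squared chord - 4 sn^2 (T / 2), it is T. A geodesic of length T from p to q
is found in the ambient space and lifted to the covering ([chord_path]). No
causal path is longer ([path_length_le]), since the signed distance to the
orthogonal bisector of p and q is a calibration: its gradient is a unit timelike
vector, so that it increases along a causal curve at least as fast as the
length. To keep control of the sheets of the covering, null coordinates
[pcoord], [vcoord] are used: they make the causal order of close points a
product order, and the squared chord factors in them ([chord2_null]).

In the space X, geodesics realize the time separation only locally. An initial
segment of a realizer is a realizer once the total time separation is finite
([realizer_initial]), and it is finite since finitely many neighbourhoods with
finite time separation cover the curve ([causal_curve_finite]). The monotonicity
condition concerns triangles with timelike sides, whereas the points of a pair
may be null related; in this case the later point is moved along its geodesic
and the law of cosines permits to pass to the limit
([angle_monotone_ordered]). *)

(** * Generalized trigonometric functions *)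

Section generalized_trigonometry.
Variable R : realType.
Implicit Types K x y : R.

Lemma is_derive_sinh x : is_derive x 1 (@sinh R) (cosh x).
Proof.
have -> : @sinh R = (fun x => (expR x - expR (- x)) * 2^-1) by [].
by apply: trigger_derive; rewrite /cosh /GRing.scale/= ?(mulr0, add0r); field.
Qed.

Lemma is_derive_cosh x : is_derive x 1 (@cosh R) (sinh x).
Proof.
have -> : @cosh R = (fun x => (expR x + expR (- x)) * 2^-1) by [].
by apply: trigger_derive; rewrite /sinh /GRing.scale/= ?(mulr0, add0r); field.
Qed.

Definition kappa K : R := Num.sqrt `|K|.

Lemma kappa_gt0 K : K != 0 -> 0 < kappa K.
Proof. by move=> K0; rewrite sqrtr_gt0 normr_gt0. Qed.

Lemma kappa2 K : kappa K ^+ 2 = `|K|.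
Proof. by rewrite sqr_sqrtr. Qed.

(** The solution of f'' = K f with f(0) = 0 and f'(0) = 1; [cs K] is its derivative. *)
Definition sn K x : R :=
  if K == 0 then x
  else if 0 < K then sinh (kappa K * x) / kappa K
  else sin (kappa K * x) / kappa K.

Definition cs K x : R :=
  if K == 0 then 1
  else if 0 < K then cosh (kappa K * x) else cos (kappa K * x).

Lemma is_derive_sn K x : is_derive x 1 (sn K) (cs K x).
Proof.
have [->|K0] := eqVneq K 0.
  rewrite /cs eqxx; have -> : sn 0 = id by apply/funext => y; rewrite /sn eqxx.
  exact: is_derive_id.
have k0 := kappa_gt0 K0; rewrite /cs (negbTE K0).
case: ifPn => Kp.
  have -> : sn K = (fun x => sinh (kappa K * x) * (kappa K)^-1).
    by apply/funext => y; rewrite /sn (negbTE K0) Kp.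
  have := is_derive_sinh (kappa K * x) => ?.
  apply: trigger_derive; rewrite /GRing.scale/= ; field.
  by rewrite gt_eqF.
have -> : sn K = (fun x => sin (kappa K * x) * (kappa K)^-1).
  by apply/funext => y; rewrite /sn (negbTE K0) (negbTE Kp).
apply: trigger_derive; rewrite /GRing.scale/= ; field.
by rewrite gt_eqF.
Qed.

Lemma is_derive_cs K x : is_derive x 1 (cs K) (K * sn K x).
Proof.
have [->|K0] := eqVneq K 0.
  rewrite mul0r; have -> : cs 0 = cst 1 by apply/funext => y; rewrite /cs eqxx.
  exact: is_derive_cst.
have k0 := kappa_gt0 K0; have k2 := kappa2 K; rewrite /sn (negbTE K0).
case: ifPn => Kp.
  have -> : cs K = (fun x => cosh (kappa K * x)).
    by apply/funext => y; rewrite /cs (negbTE K0) Kp.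
  have := is_derive_cosh (kappa K * x) => ?.
  apply: trigger_derive; rewrite /GRing.scale/=.
  rewrite -[X in _ = X * _](gtr0_norm Kp) -k2; field.
  by rewrite gt_eqF.
have -> : cs K = (fun x => cos (kappa K * x)).
  by apply/funext => y; rewrite /cs (negbTE K0) (negbTE Kp).
have Kn : K = - kappa K ^+ 2 by rewrite k2 ler0_norm ?opprK// leNgt.
apply: trigger_derive; rewrite /GRing.scale/=.
rewrite [X in _ = X * _]Kn; field.
by rewrite gt_eqF.
Qed.

Lemma sn0 K : sn K 0 = 0.
Proof.
rewrite /sn mulr0; case: ifP => // _; case: ifP => _; last by rewrite sin0 mul0r.
by rewrite /sinh oppr0 subrr !mul0r.
Qed.

Lemma cs0 K : cs K 0 = 1.
Proof.
rewrite /cs mulr0; case: ifP => // _; case: ifP => _; last by rewrite cos0.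
by rewrite /cosh oppr0 expR0; field.
Qed.

Lemma cs2_sn2 K x : cs K x ^+ 2 = 1 + K * sn K x ^+ 2.
Proof.
suff : cs K x ^+ 2 - K * sn K x ^+ 2 = 1 by move=> <-; ring.
transitivity (cs K 0 ^+ 2 - K * sn K 0 ^+ 2); last by rewrite sn0 cs0; ring.
apply: (@is_derive_0_is_cst _ (fun x => cs K x ^+ 2 - K * sn K x ^+ 2)) => y.
have := is_derive_sn K y; have := is_derive_cs K y => ? ?.
by apply: trigger_derive; rewrite /GRing.scale/=; ring.
Qed.

(** The quantities f cs - f' sn and f' cs - K f sn are constant, so that solutions of
f'' = K f are determined by their initial data. Both addition formulas and the
shape of geodesics are instances. *)
Lemma second_order_linear K (f f' : R -> R) :
  (forall t : R, is_derive t 1 f (f' t)) ->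
  (forall t : R, is_derive t 1 f' (K * f t)) ->
  forall t, f t = f 0 * cs K t + f' 0 * sn K t.
Proof.
move=> df df' t.
have e1 : f t * cs K t - f' t * sn K t = f 0.
  transitivity (f 0 * cs K 0 - f' 0 * sn K 0); last by rewrite sn0 cs0; ring.
  apply: (@is_derive_0_is_cst _ (fun t => f t * cs K t - f' t * sn K t)) => y.
  have := is_derive_sn K y; have := is_derive_cs K y => ? ?.
  have := df y; have := df' y => ? ?.
  by apply: trigger_derive; rewrite /GRing.scale/=; ring.
have e2 : f' t * cs K t - K * f t * sn K t = f' 0.
  transitivity (f' 0 * cs K 0 - K * f 0 * sn K 0); last by rewrite sn0 cs0; ring.
  apply: (@is_derive_0_is_cst _ (fun t => f' t * cs K t - K * f t * sn K t)) => y.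
  have := is_derive_sn K y; have := is_derive_cs K y => ? ?.
  have := df y; have := df' y => ? ?.
  by apply: trigger_derive; rewrite /GRing.scale/=; ring.
rewrite -e1 -e2; transitivity (f t * (cs K t ^+ 2 - K * sn K t ^+ 2)).
  by rewrite cs2_sn2; ring.
by ring.
Qed.

Lemma snD K x y : sn K (x + y) = sn K x * cs K y + cs K x * sn K y.
Proof.
have := @second_order_linear K (fun y => sn K (x + y)) (fun y => cs K (x + y)) _ _ y.
rewrite addr0; apply => t.
  have := is_derive_sn K (x + t) => ?.
  by apply: trigger_derive; rewrite /GRing.scale/=; ring.
have := is_derive_cs K (x + t) => ?.
by apply: trigger_derive; rewrite /GRing.scale/=; ring.
Qed.

Lemma csD K x y : cs K (x + y) = cs K x * cs K y + K * sn K x * sn K y.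
Proof.
have := @second_order_linear K (fun y => cs K (x + y))
  (fun y => K * sn K (x + y)) _ _ y.
rewrite addr0; apply => t.
  have := is_derive_cs K (x + t) => ?.
  by apply: trigger_derive; rewrite /GRing.scale/=; ring.
have := is_derive_sn K (x + t) => ?.
by apply: trigger_derive; rewrite /GRing.scale/=; ring.
Qed.

Lemma snN K x : sn K (- x) = - sn K x.
Proof.
rewrite /sn; case: ifP => // _; case: ifP => _.
  by rewrite /sinh mulrN opprK; ring.
by rewrite mulrN sinN mulNr.
Qed.

Lemma csN K x : cs K (- x) = cs K x.
Proof.
rewrite /cs; case: ifP => // _; case: ifP => _.
  by rewrite /cosh mulrN opprK addrC.
by rewrite mulrN cosN.
Qed.

Lemma sn_mul K x y : sn K (x + y) * sn K (x - y) = sn K x ^+ 2 - sn K y ^+ 2.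
Proof.
rewrite !snD snN csN.
transitivity (sn K x ^+ 2 * cs K y ^+ 2 - cs K x ^+ 2 * sn K y ^+ 2); first by ring.
by rewrite !cs2_sn2; ring.
Qed.

Lemma cs_half K x : cs K x = 1 + 2 * K * sn K (x / 2) ^+ 2.
Proof.
rewrite [in LHS](splitr x) csD -expr2 cs2_sn2; ring.
Qed.

Lemma sn_half K x : sn K x = 2 * (sn K (x / 2) * cs K (x / 2)).
Proof. rewrite [in LHS](splitr x) snD; ring. Qed.

(** Lengths below this bound are smaller than the diameter of the model space,
and [sn K] is increasing there. *)
Definition rho K : R := (1 + `|K|)^-1.

Lemma rho_gt0 K : 0 < rho K.
Proof. by rewrite invr_gt0 ltr_pwDl. Qed.

Lemma kappa_rho K x : `|x| <= rho K -> `|kappa K * x| <= 1 / 2.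
Proof.
move=> xr; rewrite normrM ger0_norm ?sqrtr_ge0//.
have k2 := kappa2 K; have k0 : 0 <= kappa K by rewrite sqrtr_ge0.
have : kappa K * `|x| <= kappa K * rho K by rewrite ler_wpM2l.
move=> /le_trans; apply; rewrite /rho -k2 ler_pdivrMr; last by nra.
by have := sqr_ge0 (kappa K - 1); nra.
Qed.

Lemma pihalf_ge1 : 1 <= pi / 2 :> R.
Proof. by rewrite ler_pdivlMr// mul1r pi_ge2. Qed.

Lemma cs_gt0 K x : `|x| <= rho K -> 0 < cs K x.
Proof.
move=> /kappa_rho kx; rewrite /cs; case: ifP => // _; case: ifP => _.
  exact: cosh_gt0.
have p1 := pihalf_ge1; apply: cos_gt0_pihalf.
by move: kx; rewrite ler_norml => /andP[? ?]; apply/andP; split; lra.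
Qed.

Lemma continuous_cs K : continuous (cs K).
Proof.
move=> x; apply: differentiable_continuous; apply/derivable1_diffP.
by have [] := is_derive_cs K x.
Qed.

Lemma continuous_sn K : continuous (sn K).
Proof.
move=> x; apply: differentiable_continuous; apply/derivable1_diffP.
by have [] := is_derive_sn K x.
Qed.

Lemma sn_lt K x y : - rho K <= x -> x < y -> y <= rho K -> sn K x < sn K y.
Proof.
move=> rx xy yr.
have [||c] := @MVT R (sn K) (cs K) x y xy.
- by move=> z _; exact: is_derive_sn.
- exact/continuous_subspaceT/continuous_sn.
rewrite in_itv/= => /andP[xc cy]; rewrite -subr_gt0 => ->.
rewrite mulr_gt0 ?subr_gt0// cs_gt0// ler_norml; apply/andP; split; lra.
Qed.

Lemma sn_le K x y : - rho K <= x -> x <= y -> y <= rho K -> sn K x <= sn K y.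
Proof.
move=> rx; rewrite le_eqVlt => /orP[/eqP->//|xy] yr.
by apply/ltW/sn_lt.
Qed.

Lemma sn_gt0 K x : 0 < x -> x <= rho K -> 0 < sn K x.
Proof.
by move=> x0 xr; rewrite -[X in X < _](sn0 K) sn_lt//; have := rho_gt0 K; lra.
Qed.

Lemma sn_ge0 K x : 0 <= x -> x <= rho K -> 0 <= sn K x.
Proof.
by move=> x0 xr; rewrite -[X in X <= _](sn0 K) sn_le//; have := rho_gt0 K; lra.
Qed.

(** The reason is cs(0) = 1. It makes the formulas of all model planes agree to
first order on small triangles. *)
Lemma sn_near K (e : R) : 0 < e -> exists2 d : R, 0 < d &
  forall x, 0 <= x -> x < d -> (1 - e) * x <= sn K x <= (1 + e) * x.
Proof.
move=> e0; have /cvgrPdist_lt/(_ e e0) := @continuous_cs K 0.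
rewrite cs0 => -[d /= d0 H]; exists d => // x x0 xd.
move: x0; rewrite le_eqVlt => /orP[/eqP <-|x0]; first by rewrite sn0 !mulr0 lexx.
have [||c] := @MVT R (sn K) (cs K) 0 x x0.
- by move=> z _; exact: is_derive_sn.
- exact/continuous_subspaceT/continuous_sn.
rewrite in_itv/= sn0 !subr0 => /andP[c0 cx] ->.
have : `|1 - cs K c| < e.
  by apply: H; rewrite /= sub0r normrN (gtr0_norm c0) (lt_trans cx).
rewrite ltr_norml => /andP[? ?].
by apply/andP; split; rewrite ler_wpM2r//; lra.
Qed.

Definition arcsinh y : R := ln (y + Num.sqrt (1 + y ^+ 2)).

Lemma sinhK : cancel (@sinh R) arcsinh.
Proof.
move=> x; rewrite /arcsinh -cosh2_sinh2 sqrtr_sqr gtr0_norm ?cosh_gt0//.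
by rewrite -[RHS]expRK; congr ln; rewrite /sinh /cosh; field.
Qed.

Lemma arcsinhK : cancel arcsinh (@sinh R).
Proof. by move=> y; have [x <-] := sinh_surj y; rewrite sinhK. Qed.

Lemma is_derive_arcsinh y :
  is_derive y 1 arcsinh (Num.sqrt (1 + y ^+ 2))^-1.
Proof.
have y0 : 0 < 1 + y ^+ 2 by rewrite ltr_wpDr ?sqr_ge0.
have w0 : 0 < Num.sqrt (1 + y ^+ 2) by rewrite sqrtr_gt0.
have yw : 0 < y + Num.sqrt (1 + y ^+ 2).
  have : Num.sqrt (y ^+ 2) < Num.sqrt (1 + y ^+ 2).
    by rewrite ltr_sqrt ?ltrDr// ltr_pwDl ?sqr_ge0.
  rewrite sqrtr_sqr => h; rewrite -ltrBlDl sub0r; apply: le_lt_trans h.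
  by rewrite -normrN ler_norm.
have -> : arcsinh = (fun y => ln (y + Num.sqrt (1 + y ^+ 2))) by [].
have := is_derive1_sqrt y0; have := is_derive1_ln yw => ? ?.
apply: trigger_derive; rewrite /GRing.scale/=.
by move: (Num.sqrt _) w0 yw => w w0 yw; field; rewrite !gt_eqF.
Qed.

(** The inverse of [sn K] on the interval of radius [rho K]. *)
Definition asn K y : R :=
  if K == 0 then y
  else if 0 < K then arcsinh (kappa K * y) / kappa K
  else asin (kappa K * y) / kappa K.

Lemma asn_sn K x : `|x| <= rho K -> asn K (sn K x) = x.
Proof.
move=> /kappa_rho; rewrite /asn /sn; have [//|K0] := eqVneq K 0.
have k0 := kappa_gt0 K0; have kN : kappa K != 0 by rewrite gt_eqF.
have e s : kappa K * (s / kappa K) = s by field.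
case: (ltP 0 K) => Kp kx; rewrite e.
  by rewrite sinhK mulrC mulKf.
rewrite sinK; first by rewrite mulrC mulKf.
have p1 := pihalf_ge1; rewrite in_itv/=.
by move: kx; rewrite ler_norml => /andP[? ?]; apply/andP; split; lra.
Qed.

Lemma is_derive_asn K y : 0 < 1 + K * y ^+ 2 ->
  is_derive y 1 (asn K) (Num.sqrt (1 + K * y ^+ 2))^-1.
Proof.
have [->|K0] := eqVneq K 0.
  rewrite mul0r addr0 sqrtr1 invr1 => _.
  have -> : asn 0 = id by apply/funext => z; rewrite /asn eqxx.
  exact: is_derive_id.
have k0 := kappa_gt0 K0; have k2 := kappa2 K.
have kN : kappa K != 0 by rewrite gt_eqF.
have [Kp|Kn] := boolP (0 < K).
  have -> : K * y ^+ 2 = (kappa K * y) ^+ 2 by rewrite exprMn k2 gtr0_norm.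
  move=> h.
  have -> : asn K = (fun y => (kappa K)^-1 * arcsinh (kappa K * y)).
    by apply/funext => z; rewrite /asn (negbTE K0) Kp mulrC.
  have := is_derive_arcsinh (kappa K * y) => ?.
  apply: trigger_derive; rewrite /GRing.scale/=.
  have w0 : 0 < Num.sqrt (1 + (kappa K * y) ^+ 2) by rewrite sqrtr_gt0.
  by move: (Num.sqrt _) w0 => w w0; field; rewrite !gt_eqF.
have Kk : K = - kappa K ^+ 2 by rewrite k2 ler0_norm ?opprK// leNgt.
have -> : 1 + K * y ^+ 2 = 1 - (kappa K * y) ^+ 2 by rewrite {1}Kk; ring.
move=> h.
have -> : asn K = (fun y => (kappa K)^-1 * asin (kappa K * y)).
  by apply/funext => z; rewrite /asn (negbTE K0) (negbTE Kn) mulrC.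
have ky : -1 < kappa K * y < 1.
  by apply/andP; split; nra.
have := is_derive1_asin ky => ?.
apply: trigger_derive; rewrite /GRing.scale/=.
have w0 : 0 < Num.sqrt (1 - (kappa K * y) ^+ 2) by rewrite sqrtr_gt0.
move: (Num.sqrt _) w0 => w w0.
by field; rewrite !gt_eqF.
Qed.

End generalized_trigonometry.

(** * Calculus on the real line *)

Section calculus.
Variable R : realType.
Implicit Types f g : R -> R.

Lemma continuous_is_derive f f' : (forall x : R, is_derive x 1 f (f' x)) ->
  continuous f.
Proof.
move=> df x; apply: differentiable_continuous; apply/derivable1_diffP.
by have [] := df x.
Qed.

Lemma derive_ge0_le f f' (a b : R) : a <= b ->
  (forall x : R, a <= x <= b -> is_derive x 1 f (f' x)) ->
  (forall x, a < x < b -> 0 <= f' x) -> f a <= f b.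
Proof.
rewrite le_eqVlt => /orP[/eqP->//|ab] df f'0.
have [||c] := @MVT R f f' a b ab.
- move=> z; rewrite in_itv/= => /andP[? ?]; apply: df; apply/andP; split; exact: ltW.
- apply: derivable_within_continuous => z; rewrite in_itv/= => /df[]//.
rewrite in_itv/= => /f'0 c0 e; rewrite -subr_ge0 e mulr_ge0// subr_ge0; exact: ltW.
Qed.

Lemma derive_gt0_lt f f' (a b : R) : a < b ->
  (forall x : R, a <= x <= b -> is_derive x 1 f (f' x)) ->
  (forall x, a < x < b -> 0 < f' x) -> f a < f b.
Proof.
move=> ab df f'0.
have [||c] := @MVT R f f' a b ab.
- move=> z; rewrite in_itv/= => /andP[? ?]; apply: df; apply/andP; split; exact: ltW.
- apply: derivable_within_continuous => z; rewrite in_itv/= => /df[]//.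
rewrite in_itv/= => /f'0 c0 e; rewrite -subr_gt0 e mulr_gt0// subr_gt0; exact: ab.
Qed.

Lemma integrable_continuous g (a b : R) : continuous g ->
  (@lebesgue_measure R).-integrable `[a, b] (EFin \o g).
Proof.
move=> cg; apply: continuous_compact_integrable; first exact: segment_compact.
exact: continuous_subspaceT.
Qed.

(** The integral from a fixed base point is an antiderivative only beyond that
point; the base point therefore has to move with the argument, to the left of
both the argument and 0. *)
Lemma antiderivative g : continuous g ->
  exists G : R -> R, forall x : R, is_derive x 1 G (g x).
Proof.
move=> cg.
pose F (a x : R) := (\int[lebesgue_measure]_(t in `[a, x]) g t)%R.
have dF (a x : R) : a < x -> is_derive x 1 (F a) (g x).
  move=> ax; have x1 : x < x + 1 by rewrite ltrDl.
  have [d e] := @continuous_FTC1_closed R g a x (x + 1) x1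
    (integrable_continuous a (x + 1) cg) ax (cg x).
  by rewrite -e derive1E; exact: derivableP.
have FF (a b x y : R) : a < x -> b < x -> x <= y ->
    F a y - F a x = F b y - F b x.
  move=> ax bx xy.
  pose h z := F a z - F b z.
  have dh z : x <= z <= y -> is_derive z 1 h 0.
    move=> /andP[xz _]; have := dF a z (lt_le_trans ax xz).
    have := dF b z (lt_le_trans bx xz) => ? ?.
    by rewrite -(subrr (g z)); exact: is_deriveB.
  have h1 := @derive_ge0_le h (cst 0) x y xy dh (fun _ _ => lexx _).
  have h2 := @derive_ge0_le (- h) (cst 0) x y xy _ (fun _ _ => lexx _).
  have : h x = h y.
    apply/eqP; rewrite eq_le h1/= -lerN2; apply: h2 => z /dh ?.
    by rewrite -[cst 0 z]oppr0; exact: is_deriveN.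
  by rewrite /h => ?; lra.
pose N (x : R) : R := - `|x| - 1.
exists (fun x => F (N x) x - F (N x) 0) => x.
pose a : R := - `|x| - 2.
apply: (@near_eq_is_derive _ _ _ (fun y => F a y - F a 0)).
- near=> y.
  have : `|x - y| < 1 by near: y; exact: cvgr_dist_lt.
  move=> xy.
  have := ler_norm y; have := ler_norm (- y); rewrite normrN => y1 y2.
  have := ler_normD (y - x) x; rewrite subrK => yx.
  rewrite distrC in xy; rewrite /N.
  have nx := normr_ge0 x; have ny := normr_ge0 y.
  have [y0|y0] := leP 0 y.
  + by apply: FF; rewrite ?/a; lra.
  + suff : F a 0 - F a y = F (- `|y| - 1) 0 - F (- `|y| - 1) y by lra.
    by apply: FF; rewrite ?/a; lra.
- have ax : a < x by rewrite /a; have := ler_norm (- x); rewrite normrN; lra.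
  have := dF a x ax => ?.
  by rewrite -(subr0 (g x)); exact: is_deriveB.
Unshelve. all: by end_near.
Qed.

Lemma Rintegral_antiderivative g G : continuous g ->
  (forall x : R, is_derive x 1 G (g x)) ->
  (\int[lebesgue_measure]_(t in `[(0:R), 1]) g t)%R = G 1 - G 0.
Proof.
move=> cg dG; have cG := continuous_is_derive dG.
rewrite /Rintegral (@continuous_FTC2 R g G 0 1)//.
- exact: continuous_subspaceT.
- split.
  + by move=> x _; have [] := dG x.
  + exact/cvg_at_right_filter/cG.
  + exact/cvg_at_left_filter/cG.
- by move=> x _; rewrite derive1E; have [] := dG x.
Qed.

Lemma nonvanishing_gt0 f (a b : R) : {within `[a, b], continuous f} ->
  (forall t, a <= t <= b -> f t != 0) -> 0 < f a ->
  forall t, a <= t <= b -> 0 < f t.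
Proof.
move=> cf f0 fa t /andP[at_ tb]; rewrite ltNge; apply/negP => ft.
have [||c] := @IVT R f a t 0 at_.
- apply: continuous_subspaceW cf => z /=; rewrite !in_itv/= => /andP[-> zt].
  exact: le_trans tb.
- by rewrite ge_min ft orbT le_max (ltW fa).
rewrite in_itv/= => /andP[ac ct] /eqP; apply/negP/f0; rewrite ac.
exact: le_trans tb.
Qed.

(** Polar angles can be chosen continuously along a C1 curve which avoids the
origin: the angle is an antiderivative of the angular velocity. *)
Lemma angle_lift (a b a' b' : R -> R) (t0 : R) :
  (forall x : R, is_derive x 1 a (a' x)) ->
  (forall x : R, is_derive x 1 b (b' x)) ->
  continuous a' -> continuous b' ->
  (forall x, 0 < a x ^+ 2 + b x ^+ 2) ->
  a 0 = Num.sqrt (a 0 ^+ 2 + b 0 ^+ 2) * cos t0 ->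
  b 0 = Num.sqrt (a 0 ^+ 2 + b 0 ^+ 2) * sin t0 ->
  exists t t' : R -> R, [/\ forall x : R, is_derive x 1 t (t' x), continuous t',
    t 0 = t0 & forall x,
      a x = Num.sqrt (a x ^+ 2 + b x ^+ 2) * cos (t x) /\
      b x = Num.sqrt (a x ^+ 2 + b x ^+ 2) * sin (t x)].
Proof.
move=> da db ca' cb' ab0 ha hb.
have ca := continuous_is_derive da; have cb := continuous_is_derive db.
pose r2 x := a x ^+ 2 + b x ^+ 2.
pose g x := (a x * b' x - b x * a' x) * (r2 x)^-1.
have dr2 (x : R) : is_derive x 1 r2 (2 * (a x * a' x + b x * b' x)).
  by have := da x; have := db x => ? ?; apply: trigger_derive; rewrite /GRing.scale/=; ring.
have cg : continuous g.
  move=> x; apply: cvgM; last first.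
    apply: cvgV; first by rewrite gt_eqF// ab0.
    exact: (continuous_is_derive dr2).
  by apply: cvgB; apply: cvgM; [exact: ca|exact: cb'|exact: cb|exact: ca'].
have [G dG] := antiderivative cg.
pose t x := G x - G 0 + t0.
have dt (x : R) : is_derive x 1 t (g x).
  have := dG x => ?.
  by apply: trigger_derive; ring.
exists t, g; split => //.
  by rewrite /t subrr add0r.
pose rinv x := (Num.sqrt (r2 x))^-1.
have r0 x : 0 < Num.sqrt (r2 x) by rewrite sqrtr_gt0 ab0.
have drinv (x : R) : is_derive x 1 rinv (- (a x * a' x + b x * b' x) / (Num.sqrt (r2 x)) ^+ 3).
  have := is_derive1_sqrt (ab0 x); rewrite -/(r2 x) => ?.
  have := da x; have := db x => ? ?.
  have := dr2 x => ?.
  have ds : is_derive x 1 (fun x => Num.sqrt (r2 x))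
      ((a x * a' x + b x * b' x) / Num.sqrt (r2 x)).
    by apply: trigger_derive; field; rewrite gt_eqF.
  have rN : Num.sqrt (r2 x) != 0 by rewrite gt_eqF.
  have := @is_deriveV _ _ x _ 1 rN ds => h.
  apply: is_derive_eq.
  by rewrite /GRing.scale/=; field; rewrite gt_eqF.
have const x : (a x * cos (t x) + b x * sin (t x)) * rinv x = 1.
  transitivity ((a 0 * cos (t 0) + b 0 * sin (t 0)) * rinv 0); last first.
    rewrite /t subrr add0r /rinv; move: ha hb (r0 0); rewrite -/(r2 0).
    move: (Num.sqrt _) => s -> -> s0.
    transitivity (cos t0 ^+ 2 + sin t0 ^+ 2); last exact: cos2Dsin2.
    by field; rewrite gt_eqF.
  apply: (@is_derive_0_is_cst _ (fun x => (a x * cos (t x) + b x * sin (t x)) * rinv x)) => y.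
  have := da y; have := db y; have := dt y; have := drinv y => ? ? ? ?.
  apply: trigger_derive; rewrite /GRing.scale/= /g /rinv.
  have s2 : r2 y = Num.sqrt (r2 y) ^+ 2 by rewrite sqr_sqrtr// ltW// ab0.
  have := r0 y; move: (Num.sqrt (r2 y)) s2 => s s2 s0; rewrite s2.
  have s2' : a y ^+ 2 + b y ^+ 2 = s ^+ 2 by [].
  apply: (@mulIf _ (s ^+ 3)); first by rewrite expf_neq0// gt_eqF.
  rewrite mul0r.
  transitivity ((a' y * cos (t y) + b' y * sin (t y)) * (s ^+ 2 - (a y ^+ 2 + b y ^+ 2))).
    by field; rewrite gt_eqF.
  by rewrite s2' subrr mulr0.
move=> x; have := const x; have := cos2Dsin2 (t x); rewrite /rinv -/(r2 x).
have s2 : r2 x = Num.sqrt (r2 x) ^+ 2 by rewrite sqr_sqrtr// ltW// ab0.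
have s2' : a x ^+ 2 + b x ^+ 2 = Num.sqrt (r2 x) ^+ 2 by [].
have := r0 x; move: (Num.sqrt (r2 x)) s2 s2' => s _ s2 s0.
move: (cos _) (sin _) => c d cd.
have sN : s != 0 by rewrite gt_eqF.
move=> /(congr1 (fun z => z * s)); rewrite divfK// mul1r => e.
have : (a x - s * c) ^+ 2 + (b x - s * d) ^+ 2 = 0.
  transitivity ((a x ^+ 2 + b x ^+ 2) - 2 * s * (a x * c + b x * d)
    + s ^+ 2 * (c ^+ 2 + d ^+ 2)); first by ring.
  by rewrite s2 e cd; ring.
move/eqP; rewrite paddr_eq0 ?sqr_ge0// !sqrf_eq0 !subr_eq0 => /andP[/eqP ? /eqP ?].
by split.
Qed.

End calculus.

(** * The inverse hyperbolic cosine *)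

Section arcosh.
Variable R : realType.
Implicit Types x y : R.

Lemma arcosh_le x y : 1 <= x -> x <= y -> arcosh x <= arcosh y.
Proof.
move=> x1 xy; rewrite /arcosh ler_ln ?posrE.
- by rewrite lerD// ler_wsqrtr// lerB// lerXn2r// nnegrE; lra.
- by rewrite ltr_pwDl ?sqrtr_ge0//; lra.
- by rewrite ltr_pwDl ?sqrtr_ge0//; lra.
Qed.

(** This is cosh u * cosh v <= cosh (u + v) in terms of the inverse. *)
Lemma arcoshM x y : 1 <= x -> 1 <= y -> arcosh (x * y) <= arcosh x + arcosh y.
Proof.
move=> x1 y1; rewrite /arcosh.
have sx := sqrtr_ge0 (x ^+ 2 - 1); have sy := sqrtr_ge0 (y ^+ 2 - 1).
have sxy := sqrtr_ge0 ((x * y) ^+ 2 - 1).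
rewrite -lnM ?posrE; try by rewrite ltr_pwDl//; lra.
rewrite ler_ln ?posrE; try by rewrite ?mulr_gt0// ltr_pwDl//; nra.
have sx2 : Num.sqrt (x ^+ 2 - 1) ^+ 2 = x ^+ 2 - 1 by rewrite sqr_sqrtr//; nra.
have sy2 : Num.sqrt (y ^+ 2 - 1) ^+ 2 = y ^+ 2 - 1 by rewrite sqr_sqrtr//; nra.
have sxy2 : Num.sqrt ((x * y) ^+ 2 - 1) ^+ 2 = (x * y) ^+ 2 - 1.
  by rewrite sqr_sqrtr//; nra.
move: (Num.sqrt _) (Num.sqrt _) (Num.sqrt _) sx sy sxy sx2 sy2 sxy2.
move=> c b a a0 b0 c0 a2 b2 c2.
have h : c ^+ 2 <= (x * b + a * y) ^+ 2.
  have : 0 <= 2 * x * b * a * y by rewrite !mulr_ge0//; lra.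
  rewrite c2 sqrrD !exprMn b2 a2.
  have : 0 <= (x ^+ 2 - 1) * (y ^+ 2 - 1) by rewrite mulr_ge0//; nra.
  by lra.
have {}h : c <= x * b + a * y.
  move: h; rewrite ler_sqr ?nnegrE//.
  by rewrite addr_ge0// mulr_ge0//; lra.
have : 0 <= a * b by rewrite mulr_ge0.
by lra.
Qed.

Lemma arcosh_small (e : R) : 0 < e -> exists2 h : R, 0 < h & arcosh (1 + h) <= e.
Proof.
move=> e0; have c1 : 1 < cosh e.
  have e1 : 1 < expR e by rewrite -expR0 ltr_expR.
  have s0 : 0 < sinh e by rewrite divr_gt0// subr_gt0 ltr_expR; lra.
  have := cosh2_sinh2 e; have := cosh_gt0 e => c0 c2.
  rewrite ltNge; apply/negP => c1; nra.
exists (cosh e - 1); first by lra.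
rewrite addrC subrK /arcosh cosh2_sinh2 addrAC subrr add0r sqrtr_sqr.
have s0 : 0 < sinh e by rewrite divr_gt0// subr_gt0 ltr_expR; lra.
rewrite gtr0_norm//.
have -> : cosh e + sinh e = expR e by rewrite /sinh /cosh; field.
by rewrite expRK.
Qed.

End arcosh.

(** * Coordinates of the ambient space and of the model plane *)

Section entries.
Variable R : realType.

(** The dimension of the ambient space depends on K. Entries with indices in nat,
and default value 0, make it possible to compute without case distinction. *)
Definition entry n (v : 'rV[R]_n) (i : nat) : R :=
  if insub i is Some j then v 0 j else 0.

Lemma entry_ord n (v : 'rV[R]_n) (j : 'I_n) : entry v j = v 0 j.
Proof. by rewrite /entry valK. Qed.

Lemma entry_default n (v : 'rV[R]_n) i : (n <= i)%N -> entry v i = 0.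
Proof. by move=> ni; rewrite /entry insubF// ltnNge ni. Qed.

Lemma entryD n (u v : 'rV[R]_n) i : entry (u + v) i = entry u i + entry v i.
Proof. by rewrite /entry; case: insub => [j|]; rewrite ?mxE ?addr0. Qed.

Lemma entryZ n a (v : 'rV[R]_n) i : entry (a *: v) i = a * entry v i.
Proof. by rewrite /entry; case: insub => [j|]; rewrite ?mxE ?mulr0. Qed.

Lemma entry_row n (f : nat -> R) i : (i < n)%N ->
  entry (\row_(j < n) f j) i = f i.
Proof. by move=> ni; rewrite (entry_ord (\row_(j < n) f j) (Ordinal ni)) mxE. Qed.

Lemma eq_entry n (u v : 'rV[R]_n) : (forall i, (i < n)%N -> entry u i = entry v i) -> u = v.
Proof. by move=> uv; apply/rowP => j; rewrite -!entry_ord uv. Qed.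

Lemma bform_entry m n (u v : 'rV[R]_n) : bform m u v =
  \sum_(0 <= i < n) (if (i < m)%N then - 1 else 1) * entry u i * entry v i.
Proof. by rewrite /bform big_mkord; apply: eq_bigr => i _; rewrite !entry_ord. Qed.

End entries.

Section model_plane.
Variables (R : realType) (K : R).
Notation V3 := 'rV[R]_(model_dim K).
Implicit Types (p q : R * R) (u v w : V3).

(** Components of ambient vectors, permuted such that the last one has the sign
opposite to the other two. *)
Definition component (j : nat) v : R :=
  entry v (if K < 0 then j else nth 0%N [:: 1; 2; 0]%N j).

(** The sign of the scalar product on the span of the first two components. It is
the sign of K, except for K = 0. *)
Definition eps : R := if K < 0 then -1 else 1.

Lemma eps2 : eps * eps = 1.
Proof. by rewrite /eps; case: ifP => _; ring. Qed.

Lemma epsK : eps * K = `|K|.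
Proof.
rewrite /eps; case: ltP => K0; first by rewrite ltr0_norm// mulN1r.
by rewrite ger0_norm// mul1r.
Qed.

Lemma compD j u v : component j (u + v) = component j u + component j v.
Proof. exact: entryD. Qed.

Lemma compZ j a v : component j (a *: v) = a * component j v.
Proof. exact: entryZ. Qed.

Lemma compN j v : component j (- v) = - component j v.
Proof. by rewrite -scaleN1r compZ mulN1r. Qed.

Definition compE := (compD, compN, compZ).

Lemma mformE u v :
  mform u v = eps * (component 0 u * component 0 v + component 1 u * component 1 v - component 2 u * component 2 v).
Proof.
rewrite /mform bform_entry /component /eps /model_index; move: u v.
rewrite /model_dim; have [->|K0] := eqVneq K 0 => u v.
  rewrite ltxx !big_nat_recr//= big_geq//=.
  by rewrite (@entry_default _ 2 u 2)// (@entry_default _ 2 v 2)//; ring.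
rewrite -[X in \sum_(0 <= _ < X) _]/3%N !big_nat_recr//= big_geq//=.
by case: (ltP K 0) => _ /=; ring.
Qed.

Lemma comp_ext u v : (forall j, (j < 3)%N -> component j u = component j v) -> u = v.
Proof.
move=> uv; apply: eq_entry => i i3.
have {}i3 : (i < 3)%N by apply: leq_trans i3 _; rewrite /model_dim; case: ifP.
move: (uv 0%N isT) (uv 1%N isT) (uv 2%N isT); rewrite /component.
by case: ifP => _; move: i i3 => [|[|[|]]].
Qed.

(** The vector with given components; in the flat case, of dimension 2, the
component of index 1 is zero. *)
Definition vec (x y z : R) : V3 :=
  \row_j (if K < 0 then nth 0 [:: x; y; z] j else nth 0 [:: z; x; y] j).

Lemma comp0_vec x y z : component 0 (vec x y z) = x.
Proof.
rewrite /component /vec; have [K0|K0] := ltP K 0; rewrite entry_row//.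
all: by rewrite /model_dim; case: ifP.
Qed.

Lemma comp2_vec x y z : component 2 (vec x y z) = z.
Proof.
rewrite /component /vec; have [K0|K0] := ltP K 0; rewrite entry_row//.
all: rewrite /model_dim; case: ifP => // /eqP K1.
by move: K0; rewrite K1 ltxx.
Qed.

Lemma comp1_vec x y z : component 1 (vec x y z) = if K == 0 then 0 else y.
Proof.
rewrite /component /vec; have [K0|K0] := ltP K 0.
  by rewrite lt_eqF// entry_row// /model_dim lt_eqF.
case: ifP => K1; last by rewrite entry_row// /model_dim K1.
by rewrite entry_default// /model_dim K1.
Qed.

Lemma comp1_flat u : K = 0 -> component 1 u = 0.
Proof. move=> K0; rewrite /component; have -> : (K < 0) = false by rewrite K0 ltxx.
by rewrite entry_default// /model_dim K0 eqxx. Qed.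

(** The radius of the quadric; 1 is a convention for the plane. *)
Definition radius : R := if K == 0 then 1 else (kappa K)^-1.

Lemma radius_gt0 : 0 < radius.
Proof.
by rewrite /radius; case: ifPn => [//|K0]; rewrite invr_gt0; exact: kappa_gt0.
Qed.

Lemma radius2 : K != 0 -> `|K| * radius ^+ 2 = 1.
Proof.
move=> K0; rewrite /radius (negbTE K0) exprVn kappa2 mulfV// normr_eq0//.
Qed.

(** Conformal coordinates. [ang] and [hyp] are the coordinates of the plane,
swapped such that [ang] is the polar angle in the quadric; [theta] is the
Gudermannian of [hyp]. The metric is conformal to that of the
([ang], [theta])-plane, up to the sign [eps]. *)
Definition ang p : R := if K < 0 then p.1 else p.2.
Definition hyp p : R := if K < 0 then p.2 else p.1.
Definition gd (h : R) : R := if K == 0 then h else atan (sinh h).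
Definition chyp (h : R) : R := if K == 0 then 1 else cosh h.
Definition theta p : R := gd (hyp p).

Lemma chyp_gt0 h : 0 < chyp h.
Proof. by rewrite /chyp; case: ifP => // _; exact: cosh_gt0. Qed.

Lemma cos_gd h : K != 0 -> cos (gd h) = (cosh h)^-1.
Proof.
move=> K0; rewrite /gd (negbTE K0) cos_atan -cosh2_sinh2 sqrtr_sqr gtr0_norm//.
exact: cosh_gt0.
Qed.

Lemma gd_bound h : K != 0 -> `|gd h| < pi / 2.
Proof.
move=> K0; rewrite /gd (negbTE K0) ltr_norml atan_ltpi2 andbT.
exact: atan_gtNpi2.
Qed.

Lemma sin_gd h : K != 0 -> sin (gd h) = sinh h / cosh h.
Proof.
move=> K0; have := gd_bound h K0; rewrite ltr_norml => hb.
have := atanK (sinh h); rewrite /tan.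
have -> : atan (sinh h) = gd h by rewrite /gd (negbTE K0).
rewrite cos_gd// invrK => <-; rewrite mulfK// gt_eqF//; exact: cosh_gt0.
Qed.

Lemma is_derive_gd (h : R) : is_derive h 1 gd (chyp h)^-1.
Proof.
have [K0|K0] := eqVneq K 0.
  have -> : gd = id by apply/funext => x; rewrite /gd K0 eqxx.
  by rewrite /chyp K0 eqxx invr1; exact: is_derive_id.
have -> : gd = (fun h => atan (sinh h)).
  by apply/funext => x; rewrite /gd (negbTE K0).
have := is_derive_sinh h => ?.
apply: trigger_derive; rewrite -cosh2_sinh2 /chyp (negbTE K0); field.
by rewrite gt_eqF// cosh_gt0.
Qed.

Lemma cover_comp2 p : component 2 (cover K p) = if K == 0 then hyp p else radius * sinh (hyp p).
Proof.
rewrite /component /cover /cover_coord /hyp /radius /kappa; case: (ltgtP K 0) => K0.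
- by rewrite entry_row// /model_dim lt_eqF.
- by rewrite entry_row//= /model_dim gt_eqF.
- by rewrite entry_row//= /model_dim K0 eqxx.
Qed.

Lemma cover_comp0 p :
  component 0 (cover K p) = if K == 0 then ang p else radius * cosh (hyp p) * cos (ang p).
Proof.
rewrite /component /cover /cover_coord /hyp /ang /radius /kappa; case: (ltgtP K 0) => K0.
- by rewrite entry_row// /model_dim lt_eqF.
- by rewrite entry_row//= /model_dim gt_eqF.
- by rewrite entry_row//= /model_dim K0 eqxx.
Qed.

Lemma cover_comp1 p :
  component 1 (cover K p) = if K == 0 then 0 else radius * cosh (hyp p) * sin (ang p).
Proof.
have [/eqP|K0] := eqVneq K 0; first by move/eqP => K0; exact: comp1_flat.
move: K0; rewrite /component /cover /cover_coord /hyp /ang /radius /kappa.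
case: (ltgtP K 0) => K0 // _.
- by rewrite entry_row// /model_dim lt_eqF.
- by rewrite entry_row//= /model_dim gt_eqF.
Qed.

Lemma mform_cover p : K != 0 -> mform (cover K p) (cover K p) = K^-1.
Proof.
by move=> K0; have [H _] := (seteqP _ _).1 (cover_range K0); apply: H; exists p.
Qed.

Lemma mformC u v : mform u v = mform v u.
Proof. by rewrite !mformE; ring. Qed.

Lemma mformDl u v w : mform (u + v) w = mform u w + mform v w.
Proof. by rewrite !mformE !compE; ring. Qed.

Lemma mformDr u v w : mform w (u + v) = mform w u + mform w v.
Proof. by rewrite !mformE !compE; ring. Qed.

Lemma mformZl a u v : mform (a *: u) v = a * mform u v.
Proof. by rewrite !mformE !compE; ring. Qed.

Lemma mformZr a u v : mform v (a *: u) = a * mform v u.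
Proof. by rewrite !mformE !compE; ring. Qed.

Lemma mformNl u v : mform (- u) v = - mform u v.
Proof. by rewrite !mformE !compE; ring. Qed.

Lemma mformNr u v : mform v (- u) = - mform v u.
Proof. by rewrite !mformE !compE; ring. Qed.

Definition mform_lin := (mformDl, mformDr, mformNl, mformNr, mformZl, mformZr).

Definition chord2 p q : R := mform (cover K q - cover K p) (cover K q - cover K p).

Lemma chord2C p q : chord2 p q = chord2 q p.
Proof. by rewrite /chord2 !mform_lin; ring. Qed.

Lemma chord2pp p : chord2 p p = 0.
Proof. by rewrite /chord2 subrr mformE -(scale0r (0 : V3)) !compE; ring. Qed.

Lemma mform_chord2 p q : K != 0 ->
  mform (cover K p) (cover K q) = K^-1 - chord2 p q / 2.
Proof.
move=> K0; rewrite /chord2 !mform_lin !mform_cover// (mformC (cover K q)); field.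
exact: K0.
Qed.

(** In the flat case, the linearization; it permits to treat all K alike. *)
Definition half_sin (x : R) : R := if K == 0 then x / 2 else sin (x / 2).

Definition conformal_factor p : R := radius * chyp (hyp p).

Lemma conformal_factor_gt0 p : 0 < conformal_factor p.
Proof. by rewrite mulr_gt0 ?radius_gt0 ?chyp_gt0. Qed.

Definition ucoord p : R := ang p - theta p.
Definition vcoord p : R := ang p + theta p.

Lemma cosB_prod (x y : R) : cos x - cos y = 2 * (sin ((y + x) / 2) * sin ((y - x) / 2)).
Proof.
transitivity (cos ((y + x) / 2 - (y - x) / 2) - cos ((y + x) / 2 + (y - x) / 2)).
  by congr (cos _ - cos _); field.
rewrite cosB cosD; ring.
Qed.

(** For K = 0 this is the factorization of a quadratic form of signature (1, 1). On
the quadric, the identity for the difference of two cosines plays this role. *)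
Lemma chord2E p q : chord2 p q = 4 * eps * conformal_factor p * conformal_factor q *
  (half_sin (ucoord q - ucoord p) * half_sin (vcoord q - vcoord p)).
Proof.
have [K0|K0] := eqVneq K 0.
  rewrite /chord2 mformE !compE !comp1_flat// !cover_comp0 !cover_comp2 /conformal_factor.
  by rewrite /radius /chyp /half_sin /ucoord /vcoord /theta /gd K0 eqxx; field.
rewrite /chord2 mformE !compE !cover_comp0 !cover_comp1 !cover_comp2 (negbTE K0).
have -> : half_sin (ucoord q - ucoord p) * half_sin (vcoord q - vcoord p) =
    (cos (theta q - theta p) - cos (ang q - ang p)) / 2.
  rewrite cosB_prod /half_sin /ucoord /vcoord (negbTE K0) mulrAC divff ?mul1r//.
  by rewrite mulrC; congr (sin (_ / 2) * sin (_ / 2)); ring.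
rewrite !cosB /theta !cos_gd// !sin_gd// /conformal_factor /chyp (negbTE K0).
have := cosh2_sinh2 (hyp p); have := cosh2_sinh2 (hyp q).
have := cos2Dsin2 (ang p); have := cos2Dsin2 (ang q).
have := cosh_gt0 (hyp p); have := cosh_gt0 (hyp q).
move: (cosh (hyp p)) (cosh (hyp q)) (sinh (hyp p)) (sinh (hyp q)).
move: (cos (ang p)) (cos (ang q)) (sin (ang p)) (sin (ang q)) radius.
move=> a b x y r c d s t d0 c0 by1 ax1 d2 c2.
transitivity (eps * r ^+ 2 * (d ^+ 2 * (b ^+ 2 + y ^+ 2) + c ^+ 2 * (a ^+ 2 + x ^+ 2)
   - s ^+ 2 - t ^+ 2 + 2 * s * t - 2 * c * d * (a * b + x * y))); first by ring.
rewrite ax1 by1 d2 c2; field.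
by rewrite !gt_eqF.
Qed.

(** * Null coordinates *)

Implicit Types (s : R -> R * R).

(** The null coordinates are [pcoord] and [vcoord]. The sign is chosen such that
both are nondecreasing along future causal curves. *)
Definition pcoord p : R := - eps * ucoord p.

Definition null_le p q : Prop := pcoord p <= pcoord q /\ vcoord p <= vcoord q.

(** The corners of the coordinate rectangle spanned by p and q lie in the strip
which is the image of the conformal chart. For points of anti-de Sitter space
with [null_le p q] this says that the causal diamond of p and q is compact. *)
Definition in_strip p q : Prop := K != 0 ->
  `|vcoord q - ucoord p| < pi /\ `|ucoord q - vcoord p| < pi.

Lemma theta_bound p : K != 0 -> `|theta p| < pi / 2.
Proof. exact: gd_bound. Qed.

Lemma null_le_trans p q x : null_le p q -> null_le q x -> null_le p x.
Proof. by move=> [a b] [c d]; split; [exact: le_trans c|exact: le_trans d]. Qed.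

Lemma null_le_refl p : null_le p p.
Proof. by split. Qed.

Lemma in_strip_sym p q : in_strip p q -> in_strip q p.
Proof.
move=> + K0 => /(_ K0) [h1 h2].
by rewrite distrC; split => //; rewrite distrC.
Qed.

Lemma in_strip_refl p : in_strip p p.
Proof.
move=> K0; have := theta_bound p K0.
rewrite /vcoord /ucoord !ltr_norml => /andP[? ?].
by split; apply/andP; split; lra.
Qed.

Lemma in_strip_sub x y z : null_le x y -> null_le y z -> in_strip x z -> in_strip x y /\ in_strip y z.
Proof.
move=> [p1 v1] [p2 v2] n; split => K0; have [] := n K0; move: p1 v1 p2 v2;
  have := theta_bound x K0; have := theta_bound y K0; have := theta_bound z K0;
  rewrite /pcoord /vcoord /ucoord /eps !ltr_norml;
  case: ifP => _ /andP[? ?] /andP[? ?] /andP[? ?] ? ? ? ? /andP[? ?] /andP[? ?];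
  by split; apply/andP; split; lra.
Qed.

Lemma half_sinN a : half_sin (- a) = - half_sin a.
Proof. by rewrite /half_sin mulNr sinN; case: ifP. Qed.

Lemma half_sin_eps a : half_sin (- eps * a) = - eps * half_sin a.
Proof.
by rewrite /eps; case: ifP => _; rewrite ?opprK ?mulN1r ?mul1r ?half_sinN.
Qed.

Lemma half_sin_gt0 a : 0 < a -> (K != 0 -> a < 2 * pi) -> 0 < half_sin a.
Proof.
move=> a0 ap; rewrite /half_sin; case: ifPn => [_|/ap {}ap]; first by rewrite divr_gt0.
by apply: sin_gt0_pi; apply/andP; split; lra.
Qed.

Lemma half_sin0 : half_sin 0 = 0.
Proof. by rewrite /half_sin mul0r sin0 if_same. Qed.

Lemma half_sin_ge0 a : 0 <= a -> (K != 0 -> a < 2 * pi) -> 0 <= half_sin a.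
Proof.
rewrite le_eqVlt => /orP[/eqP <-|a0 ap]; first by rewrite half_sin0.
exact/ltW/half_sin_gt0.
Qed.

Lemma chord2_null p q : chord2 p q = - (4 * conformal_factor p * conformal_factor q *
  (half_sin (pcoord q - pcoord p) * half_sin (vcoord q - vcoord p))).
Proof.
by rewrite chord2E /pcoord -mulrBr half_sin_eps; ring.
Qed.

Lemma in_strip_lt p q : in_strip p q -> K != 0 ->
  `|pcoord q - pcoord p| < 2 * pi /\ `|vcoord q - vcoord p| < 2 * pi.
Proof.
move=> n K0; have [] := n K0; have := theta_bound p K0; have := theta_bound q K0.
rewrite /pcoord /vcoord /ucoord /eps !ltr_norml.
by case: ifP => _ /andP[? ?] /andP[? ?] /andP[? ?] /andP[? ?];
  split; apply/andP; split; lra.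
Qed.

Lemma conformal_factors_gt0 p q : 0 < 4 * conformal_factor p * conformal_factor q.
Proof. by apply: (mulr_gt0 (mulr_gt0 _ (conformal_factor_gt0 p)) (conformal_factor_gt0 q)). Qed.

Lemma chord2_le0 p q : null_le p q -> in_strip p q -> chord2 p q <= 0.
Proof.
move=> [op ov] n; rewrite chord2_null oppr_le0; apply: mulr_ge0.
  exact/ltW/conformal_factors_gt0.
apply: mulr_ge0; apply: half_sin_ge0; rewrite ?subr_ge0// => K0;
  have [/ltr_normlW h1 /ltr_normlW h2] := in_strip_lt n K0; [exact: h1|exact: h2].
Qed.

(** Within the stated range the half sines have the signs of the coordinate
differences, which therefore cannot be opposite. *)
Lemma chord2_le0_null_le p q : (K != 0 ->
    `|pcoord q - pcoord p| < 2 * pi /\ `|vcoord q - vcoord p| < 2 * pi) ->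
  chord2 p q <= 0 -> null_le p q \/ null_le q p.
Proof.
move=> n; have cc := conformal_factors_gt0 p q.
rewrite chord2_null oppr_le0 pmulr_rge0// => h.
have np : K != 0 -> `|pcoord q - pcoord p| < 2 * pi by move=> /n[].
have nv : K != 0 -> `|vcoord q - vcoord p| < 2 * pi by move=> /n[].
have pos a : (K != 0 -> `|a| < 2 * pi) -> 0 < a -> 0 < half_sin a.
  by move=> na a0; apply: half_sin_gt0 => // /na /ltr_normlW.
have neg a : (K != 0 -> `|a| < 2 * pi) -> a < 0 -> half_sin a < 0.
  move=> na a0; rewrite -oppr_gt0 -half_sinN; apply: pos; last by rewrite oppr_gt0.
  by rewrite normrN.
have [p0|p0|p0] := ltgtP (pcoord p) (pcoord q); last first.
- have [v0|v0] := leP (vcoord p) (vcoord q); [left|right]; split => //.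
  + by rewrite p0.
  + by rewrite p0.
  + exact: ltW.
- right; split; first exact: ltW.
  rewrite leNgt; apply/negP => v0; move: h; rewrite leNgt => /negP; apply.
  rewrite nmulr_rlt0 ?neg ?subr_lt0//; apply: pos => //; by rewrite subr_gt0.
- left; split; first exact: ltW.
  rewrite leNgt; apply/negP => v0; move: h; rewrite leNgt => /negP; apply.
  rewrite pmulr_rlt0 ?pos ?subr_gt0//; apply: neg => //; by rewrite subr_lt0.
Qed.

Definition half_cos (a : R) : R := if K == 0 then 1 else cos (a / 2).

Lemma half_cos_gt0 a : (K != 0 -> `|a| < pi) -> 0 < half_cos a.
Proof.
move=> ap; rewrite /half_cos; case: ifPn => // /ap; rewrite ltr_norml => /andP[? ?].
by apply: cos_gt0_pihalf; apply/andP; split; lra.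
Qed.

Lemma sinD_prod (a b : R) : sin a + sin b = 2 * (sin ((a + b) / 2) * cos ((a - b) / 2)).
Proof.
transitivity (sin ((a + b) / 2 + (a - b) / 2) + sin ((a + b) / 2 - (a - b) / 2)).
  by congr (sin _ + sin _); field.
rewrite sinB sinD; ring.
Qed.

Lemma cosD_prod (a b : R) : cos a + cos b = 2 * (cos ((a + b) / 2) * cos ((a - b) / 2)).
Proof.
transitivity (cos ((a + b) / 2 + (a - b) / 2) + cos ((a + b) / 2 - (a - b) / 2)).
  by congr (cos _ + cos _); field.
rewrite cosB cosD; ring.
Qed.

(** The two cosines vanish on the boundary of the strip; the left-hand side depends
on the points of the quadric only. *)
Lemma in_strip_factor p q : K != 0 -> 1 - K * chord2 p q / 4 = `|K| * conformal_factor p * conformal_factor q *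
  (half_cos (vcoord q - ucoord p) * half_cos (ucoord q - vcoord p)).
Proof.
move=> K0; rewrite chord2E /half_cos /half_sin (negbTE K0).
have -> : sin ((ucoord q - ucoord p) / 2) * sin ((vcoord q - vcoord p) / 2) =
    (cos (theta q - theta p) - cos (ang q - ang p)) / 2.
  rewrite cosB_prod /vcoord /ucoord mulrAC divff ?mul1r//.
  by rewrite mulrC; congr (sin (_ / 2) * sin (_ / 2)); ring.
have -> : cos ((vcoord q - ucoord p) / 2) * cos ((ucoord q - vcoord p) / 2) =
    (cos (theta q + theta p) + cos (ang q - ang p)) / 2.
  rewrite [cos (theta q + _) + _]addrC cosD_prod /vcoord /ucoord.
  rewrite [RHS]mulrAC divff ?mul1r//.
  by congr (cos (_ / 2) * cos (_ / 2)); ring.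
rewrite (cosB (theta q)) (cosD (theta q)) /theta !cos_gd// /conformal_factor /chyp (negbTE K0) -epsK.
have kr : eps * K * radius ^+ 2 = 1 by rewrite epsK radius2.
have := cosh_gt0 (hyp p); have := cosh_gt0 (hyp q).
move: (cosh _) (cosh _) (cos (ang q - ang p)) (sin _ * sin _) => c d e f d0 c0.
transitivity (1 - eps * K * radius ^+ 2 * c * d * ((c^-1 * d^-1 + f) - e) / 2).
  by field; rewrite !gt_eqF.
rewrite kr; transitivity (eps * K * radius ^+ 2 * c * d * ((c^-1 * d^-1 - f) + e) / 2);
  last by field; rewrite !gt_eqF.
by rewrite kr; field; rewrite !gt_eqF.
Qed.

(** By [in_strip_factor] the curve cannot leave the strip as long as the factor does
not vanish. *)
Lemma in_strip_continuous p s (T : R) : {within `[0, T], continuous (ang \o s)} ->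
  {within `[0, T], continuous (theta \o s)} -> in_strip p (s 0) ->
  (forall t, 0 <= t <= T -> 0 < 1 - K * chord2 p (s t) / 4) ->
  forall t, 0 <= t <= T -> in_strip p (s t).
Proof.
move=> ca ct n0 h t tT K0.
pose m t := `|ang (s t) - ang p| + `|theta (s t) + theta p|.
pose f t := pi - m t.
have mE x : in_strip p x <-> (K != 0 -> `|ang x - ang p| + `|theta x + theta p| < pi).
  rewrite /in_strip /vcoord /ucoord; split => H /H{H}.
    rewrite !ltr_norml => -[/andP[? ?] /andP[? ?]].
    case: (ger0P (ang x - _)) => ?; case: (ger0P (theta x + _)) => ?; lra.
  move=> H; rewrite !ltr_norml; move: H.
  by case: (ger0P (ang x - _)) => ?; case: (ger0P (theta x + _)) => ?; 
    split; apply/andP; split; lra.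
have f0 : 0 < f 0 by rewrite subr_gt0; apply: (mE (s 0)).1.
suff : 0 < f t by rewrite subr_gt0 => ft; apply: (mE (s t)).2.
apply: (@nonvanishing_gt0 R f 0 T) => //.
  move=> z; apply: cvgB; first exact: cvg_cst.
  apply: cvgD; apply: cvg_norm.
    by apply: cvgB; [exact: ca|exact: cvg_cst].
  by apply: cvgD; [exact: ct|exact: cvg_cst].
move=> z zT; apply/negP => /eqP fz; have := h z zT.
rewrite in_strip_factor// => /lt0r_neq0; apply/negP; rewrite negbK !mulf_eq0.
apply/orP; right; rewrite /half_cos (negbTE K0).
have : cos (pi / 2 : R) = 0 by exact: cos_pihalf.
move: fz; rewrite /f /m /vcoord /ucoord.
have half a b c : a = b \/ a = - b -> b = pi -> c = a -> cos (c / 2) = 0.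
  move=> [] -> -> -> ; first exact: cos_pihalf.
  by rewrite mulNr cosN; exact: cos_pihalf.
case: (ger0P (ang _ - _)) => ?; case: (ger0P (theta _ + _)) => ? /eqP; 
  rewrite subr_eq0 => /eqP e _; apply/orP.
- left; apply/eqP; apply: half (esym e) _; [by left|ring].
- right; apply/eqP; apply: half (esym e) _; [by left|ring].
- right; apply/eqP; apply: half (esym e) _; [by right|ring].
- left; apply/eqP; apply: half (esym e) _; [by right|ring].
Qed.

(** The Gram determinant of v, u and the normal vector at p is a square up to sign.
For tangent u this is the reverse Cauchy-Schwarz inequality; in general, u is
replaced by its tangential part. *)
Lemma gram p u v : (K != 0 -> mform v (cover K p) = 0) ->
  mform v v * (mform u u - K * mform (cover K p) u ^+ 2) <= mform v u ^+ 2.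
Proof.
have [K0 _|K0 /(_ isT)] := eqVneq K 0.
  have Ka a : K * a = 0 by rewrite K0 mul0r.
  have e1 : eps = 1 by rewrite /eps K0 ltxx.
  rewrite Ka subr0 !mformE !comp1_flat// e1 -subr_ge0 !mul1r.
  apply: (@le_trans _ _ ((component 0 v * component 2 u - component 2 v * component 0 u) ^+ 2)).
    exact: sqr_ge0.
  by rewrite le_eqVlt; apply/orP; left; apply/eqP; ring.
have := mform_cover p K0; rewrite !mformE.
move: (component 0 (cover K p)) (component 1 (cover K p)) (component 2 (cover K p)) => a b c.
move: (component 0 u) (component 1 u) (component 2 u) (component 0 v) (component 1 v) (component 2 v).
move=> u0 u1 u2 v0 v1 v2 xx vx.
pose X := eps * (a * a + b * b - c * c).
pose VX := eps * (v0 * a + v1 * b - v2 * c).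
pose det := a * (v1 * u2 - v2 * u1) - b * (v0 * u2 - v2 * u0) + c * (v0 * u1 - v1 * u0).
have XK : K * X = 1 by rewrite /X xx divff.
rewrite -subr_ge0; apply: (@le_trans _ _ (`|K| * det ^+ 2)).
  by rewrite mulr_ge0// sqr_ge0.
rewrite le_eqVlt; apply/orP; left; apply/eqP; rewrite -epsK.
set vv := eps * (_ + _ - v2 * v2); set uu := eps * (_ + _ - u2 * u2).
set vu := eps * (_ + _ - v2 * u2); set xu := eps * (_ + _ - c * u2).
transitivity (K * X * vu ^+ 2 - K * X * vv * uu + K * vv * xu ^+ 2
  - K * (2 * VX * vu * xu - uu * VX ^+ 2)).
  rewrite /X /VX /det /vv /uu /vu /xu /eps; case: ifP => _; ring.
by rewrite XK /VX vx; ring.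
Qed.

(** * Velocities of curves in the model plane *)

Implicit Types (t : R).

Lemma is_derive_comp (c : R -> V3) (t : R) (d : V3) :
  is_derive t 1 c d <->
  forall j, (j < 3)%N -> is_derive t 1 (fun t => component j (c t)) (component j d).
Proof.
split=> [[dc <-] j j3|H].
  rewrite derive_mx// /component /entry; set i := if _ then _ else _.
  case: insubP => [k _ _|_]; last exact: is_derive_cst.
  by rewrite mxE; apply: derivableP; exact: (derivable_mxP _ _ _).1.
have H1 i : is_derive t 1 (fun x => entry (c x) i) (entry d i).
  have [i3|i3] := ltnP i 3; last first.
    have di : (model_dim K <= i)%N.
      by apply: leq_trans i3; rewrite /model_dim; case: ifP.
    rewrite entry_default//; have -> : (fun x => entry (c x) i) = cst 0.
      by apply/funext => x; rewrite entry_default.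
    exact: is_derive_cst.
  move: (H 0%N isT) (H 1%N isT) (H 2%N isT); rewrite /component.
  by case: ifP => _; move: i i3 => [|[|[|]]].
have dc : derivable c t 1.
  apply/derivable_mxP => i j; rewrite ord1.
  have [+ _] := H1 j.
  by rewrite (_ : (fun x => entry (c x) j) = (fun x => c x 0 j))//;
    apply/funext => x; rewrite entry_ord.
split => //; rewrite derive_mx//; apply/rowP => j; rewrite mxE.
rewrite -(entry_ord d j); have [_ <-] := H1 j.
rewrite (_ : (fun x => entry (c x) j) = (fun x => c x 0 j))//.
by apply/funext => x; rewrite entry_ord.
Qed.

Lemma is_derive_mform (c : R -> V3) (t : R) (d w : V3) : is_derive t 1 c d ->
  is_derive t 1 (fun t => mform (c t) w) (mform d w).
Proof.
move=> /is_derive_comp H; move: (H 0%N isT) (H 1%N isT) (H 2%N isT) => ? ? ?.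
have -> : (fun t => mform (c t) w) = (fun t => eps * (component 0 (c t) * component 0 w +
    component 1 (c t) * component 1 w - component 2 (c t) * component 2 w)).
  by apply/funext => x; rewrite mformE.
by apply: trigger_derive; rewrite /GRing.scale/= mformE; ring.
Qed.

Lemma is_derive_mform2 (c c' : R -> V3) (t : R) (d d' : V3) : is_derive t 1 c d ->
  is_derive t 1 c' d' ->
  is_derive t 1 (fun t => mform (c t) (c' t)) (mform d (c' t) + mform (c t) d').
Proof.
move=> /is_derive_comp H; move: (H 0%N isT) (H 1%N isT) (H 2%N isT) => ? ? ?.
move=> /is_derive_comp H'; move: (H' 0%N isT) (H' 1%N isT) (H' 2%N isT) => ? ? ?.
have -> : (fun t => mform (c t) (c' t)) = (fun t => eps * (component 0 (c t) * component 0 (c' t) +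
    component 1 (c t) * component 1 (c' t) - component 2 (c t) * component 2 (c' t))).
  by apply/funext => x; rewrite mformE.
by apply: trigger_derive; rewrite /GRing.scale/= !mformE; ring.
Qed.

Definition dang s : R -> R :=
  if K < 0 then derive1 (fst \o s) else derive1 (snd \o s).
Definition dhyp s : R -> R :=
  if K < 0 then derive1 (snd \o s) else derive1 (fst \o s).
Definition dtheta s (t : R) : R := dhyp s t / chyp (hyp (s t)).
Definition dvcoord s (t : R) : R := dang s t + dtheta s t.
Definition dpcoord s (t : R) : R := - eps * (dang s t - dtheta s t).

Section C1.
Variables (s : R -> R * R) (s1 : C1_curve s).

Lemma is_derive_ang t : is_derive t 1 (ang \o s) (dang s t).
Proof.
case: s1 => d1 d2 _ _; rewrite /dang /ang; case: ifP => K0.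
  by rewrite derive1E; apply: derivableP; exact: d1.
by rewrite derive1E; apply: derivableP; exact: d2.
Qed.

Lemma is_derive_hyp t : is_derive t 1 (hyp \o s) (dhyp s t).
Proof.
case: s1 => d1 d2 _ _; rewrite /dhyp /hyp; case: ifP => K0.
  by rewrite derive1E; apply: derivableP; exact: d2.
by rewrite derive1E; apply: derivableP; exact: d1.
Qed.

Lemma continuous_dang : continuous (dang s).
Proof. by case: s1 => _ _ d1 d2; rewrite /dang; case: ifP. Qed.

Lemma continuous_dhyp : continuous (dhyp s).
Proof. by case: s1 => _ _ d1 d2; rewrite /dhyp; case: ifP. Qed.

Lemma is_derive_theta t : is_derive t 1 (theta \o s) (dtheta s t).
Proof.
have := is_derive_hyp t => dh.
have dg := is_derive_gd (hyp (s t)).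
have := is_derive1_comp dg dh.
by rewrite /dtheta mulrC.
Qed.

Lemma is_derive_vcoord t : is_derive t 1 (vcoord \o s) (dvcoord s t).
Proof.
have := is_derive_ang t; have := is_derive_theta t => ? ?.
exact: is_deriveD.
Qed.

Lemma is_derive_pcoord t : is_derive t 1 (pcoord \o s) (dpcoord s t).
Proof.
have := is_derive_ang t; have := is_derive_theta t => ? ?.
have -> : pcoord \o s = (fun t => - eps * ((ang \o s) t - (theta \o s) t)) by [].
by apply: trigger_derive; rewrite /GRing.scale/= /dpcoord; ring.
Qed.

Definition velocity_vec t : V3 := vec (if K == 0 then dang s t else
    radius * (sinh (hyp (s t)) * dhyp s t * cos (ang (s t))
      - cosh (hyp (s t)) * sin (ang (s t)) * dang s t))
  (radius * (sinh (hyp (s t)) * dhyp s t * sin (ang (s t))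
      + cosh (hyp (s t)) * cos (ang (s t)) * dang s t))
  (if K == 0 then dhyp s t else radius * cosh (hyp (s t)) * dhyp s t).

Lemma is_derive_cover_vec t : is_derive t 1 (cover K \o s) (velocity_vec t).
Proof.
have := is_derive_ang t; have := is_derive_hyp t => dh da.
have := is_derive_sinh (hyp (s t)); have := is_derive_cosh (hyp (s t)) => dc ds.
have := is_derive1_comp ds dh; have := is_derive1_comp dc dh => dch dsh.
have := is_derive1_comp (is_derive_cos (ang (s t))) da => dcos.
have := is_derive1_comp (is_derive_sin (ang (s t))) da => dsin.
apply/is_derive_comp => -[|[|[|]]]// _; rewrite ?comp0_vec ?comp1_vec ?comp2_vec.
- under eq_fun do rewrite cover_comp0; case: ifP => K0 //.
  have -> : (fun x => radius * cosh (hyp (s x)) * cos (ang (s x))) =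
     (fun x => radius * ((@cosh R) \o (hyp \o s)) x * (cos \o (ang \o s)) x) by [].
  by apply: trigger_derive; rewrite /GRing.scale/=; ring.
- under eq_fun do rewrite cover_comp1; case: ifP => K0; first exact: is_derive_cst.
  have -> : (fun x => radius * cosh (hyp (s x)) * sin (ang (s x))) =
     (fun x => radius * ((@cosh R) \o (hyp \o s)) x * (sin \o (ang \o s)) x) by [].
  by apply: trigger_derive; rewrite /GRing.scale/=; ring.
- under eq_fun do rewrite cover_comp2; case: ifP => K0 //.
  have -> : (fun x => radius * sinh (hyp (s x))) =
     (fun x => radius * ((@sinh R) \o (hyp \o s)) x) by [].
  by apply: trigger_derive; rewrite /GRing.scale/=; ring.
Qed.

Lemma velocityE t : velocity K s t = velocity_vec t.
Proof. by rewrite /velocity derive1E; have [_ ->] := is_derive_cover_vec t. Qed.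

Lemma is_derive_cover t : is_derive t 1 (cover K \o s) (velocity K s t).
Proof. by rewrite velocityE; exact: is_derive_cover_vec. Qed.

Lemma velocity_tangent t : K != 0 -> mform (velocity K s t) (cover K (s t)) = 0.
Proof.
move=> K0; have := is_derive_mform2 (is_derive_cover t) (is_derive_cover t).
have -> : (fun t => mform ((cover K \o s) t) ((cover K \o s) t)) = cst K^-1.
  by apply/funext => x; rewrite /= mform_cover.
rewrite /= mformC => -[_]; rewrite derive_cst => /esym.
by rewrite [mform (cover K _) _]mformC -mulr2n => /eqP; rewrite mulrn_eq0 => /eqP.
Qed.

(** So the sum of the null velocities detects the time orientation. *)
Lemma dchart_sum t : exists2 k : R, 0 < k &
  dpcoord s t + dvcoord s t = k * derive1 (fst \o s) t.
Proof.
rewrite /dpcoord /dvcoord /dtheta /dang /dhyp /eps; case: ifP => K0.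
  set a := _ t; set b := _ / _.
  by exists 2 => //; ring.
have c0 := chyp_gt0 (hyp (s t)).
move: ((fst \o s)^`()%classic t) ((snd \o s)^`()%classic t) => b a.
by exists (2 / chyp (hyp (s t))); [rewrite divr_gt0|ring].
Qed.

End C1.

(** The metric is conformal to the product of the differentials of the null
coordinates. *)
Lemma mform_velocity s s' t t' : C1_curve s -> C1_curve s' -> s t = s' t' ->
  mform (velocity K s t) (velocity K s' t') =
  - (conformal_factor (s t) ^+ 2 / 2 *
      (dpcoord s t * dvcoord s' t' + dvcoord s t * dpcoord s' t')).
Proof.
move=> c c' st; rewrite !velocityE// /velocity_vec mformE !comp0_vec !comp1_vec !comp2_vec.
rewrite /dpcoord /dvcoord /dtheta -st /conformal_factor /radius /chyp.
have [K0|K0] := ifPn; first by field.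
rewrite !(negbTE K0).
have := cosh2_sinh2 (hyp (s t)); have := cosh_gt0 (hyp (s t)).
have := cos2Dsin2 (ang (s t)).
move: (cosh _) (sinh _) (cos _) (sin _) (dang s t) (dang s' t') (dhyp s t) (dhyp s' t').
move=> c0 s0 co si a a' h h' cs c00 c2.
have kN : kappa K != 0 by rewrite gt_eqF// kappa_gt0.
transitivity (eps * (kappa K)^-1 ^+ 2 * ((co ^+ 2 + si ^+ 2) * (s0 ^+ 2 * h * h' + c0 ^+ 2 * a * a')
  - c0 ^+ 2 * h * h')); first by ring.
have -> : s0 ^+ 2 = c0 ^+ 2 - 1 by rewrite c2; ring.
rewrite cs; field; rewrite kN/= gt_eqF//.
Qed.

(** The half sines and half cosines come out with definite signs if q is
comparable with the point of the curve, which gives the sign of the left-hand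
side on causal vectors. *)
Lemma mform_velocity_chord s t q : C1_curve s ->
  mform (velocity K s t) (cover K q - cover K (s t)) =
  - (conformal_factor (s t) ^+ 2 * conformal_factor q / radius *
     (dvcoord s t * (half_sin (pcoord q - pcoord (s t)) * half_cos (vcoord q - ucoord (s t)))
    + dpcoord s t * (half_sin (vcoord q - vcoord (s t)) * half_cos (ucoord q - vcoord (s t))))).
Proof.
move=> c; rewrite mformDr mformNr.
rewrite /pcoord -mulrBr half_sin_eps.
have [K0|K0] := eqVneq K 0.
  have e1 : eps = 1 by rewrite /eps K0 ltxx.
  rewrite velocityE// /velocity_vec !mformE !comp1_flat// !comp0_vec !comp2_vec.
  rewrite !cover_comp0 !cover_comp2 /dvcoord /dpcoord /dtheta /conformal_factor /radius.
  rewrite /half_sin /half_cos /chyp /vcoord /ucoord /theta /gd e1 K0 eqxx.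
  by field.
rewrite velocity_tangent// subr0.
rewrite velocityE// /velocity_vec mformE comp0_vec comp1_vec comp2_vec.
rewrite cover_comp0 cover_comp1 cover_comp2 (negbTE K0).
rewrite /half_sin /half_cos (negbTE K0).
set D := ang q - ang (s t); rewrite -[- eps * _ * _]mulrA.
have -> : sin ((ucoord q - ucoord (s t)) / 2) * cos ((vcoord q - ucoord (s t)) / 2) =
    (sin (D + theta (s t)) - sin (theta q)) / 2.
  rewrite -sinN sinD_prod /vcoord /ucoord mulrAC divff ?mul1r//.
  by congr (sin (_ / 2) * cos (_ / 2)); rewrite /D; ring.
have -> : sin ((vcoord q - vcoord (s t)) / 2) * cos ((ucoord q - vcoord (s t)) / 2) =
    (sin (D - theta (s t)) + sin (theta q)) / 2.
  rewrite sinD_prod /vcoord /ucoord mulrAC divff ?mul1r//.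
  by congr (sin (_ / 2) * cos (_ / 2)); rewrite /D; ring.
rewrite (sinD D) (sinB D) /dvcoord /dpcoord /dtheta /D /theta !cos_gd// !sin_gd//.
rewrite (cosB (ang q)) (sinB (ang q)) /conformal_factor /chyp (negbTE K0).
have := cosh_gt0 (hyp (s t)); have := cosh_gt0 (hyp q); have := radius_gt0.
move: (cosh (hyp (s t))) (sinh (hyp (s t))) (cosh (hyp q)) (sinh (hyp q)).
move: (cos (ang (s t))) (sin (ang (s t))) (cos (ang q)) (sin (ang q)) radius.
move: (dang s t) (dhyp s t) => a' h' co si co' si' r ch sh ch' sh' r0 ch'0 ch0.
by field; rewrite !gt_eqF.
Qed.

Lemma continuous_dtheta s : C1_curve s -> continuous (dtheta s).
Proof.
move=> c x; apply: cvgM; first exact: continuous_dhyp.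
have ch : {for x, continuous (hyp \o s)} by exact: (continuous_is_derive (is_derive_hyp c)).
apply: cvgV; first by rewrite gt_eqF// chyp_gt0.
rewrite /chyp; case: ifP => K0; first exact: cvg_cst.
apply: (@continuous_comp _ _ _ (hyp \o s) (@cosh R)); first exact: ch.
exact: (continuous_is_derive (@is_derive_cosh R)).
Qed.

Lemma continuous_dvcoord s : C1_curve s -> continuous (dvcoord s).
Proof.
by move=> c x; apply: cvgD; [exact: continuous_dang|exact: continuous_dtheta].
Qed.

Lemma continuous_dpcoord s : C1_curve s -> continuous (dpcoord s).
Proof.
move=> c x; apply: cvgM; first exact: cvg_cst.
by apply: cvgB; [exact: continuous_dang|exact: continuous_dtheta].
Qed.

Lemma continuous_conformal_factor s : C1_curve s -> continuous (conformal_factor \o s).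
Proof.
move=> c x; apply: cvgM; first exact: cvg_cst.
rewrite /chyp; case: ifP => K0; first exact: cvg_cst.
apply: (@continuous_comp _ _ _ (hyp \o s) (@cosh R)).
  exact: (continuous_is_derive (is_derive_hyp c)).
exact: (continuous_is_derive (@is_derive_cosh R)).
Qed.

Lemma mform_velocity_self s t : C1_curve s ->
  - mform (velocity K s t) (velocity K s t) =
  conformal_factor (s t) ^+ 2 * (dpcoord s t * dvcoord s t).
Proof. by move=> c; rewrite mform_velocity//; field. Qed.

Lemma continuous_speed s : C1_curve s ->
  continuous (fun t => Num.sqrt (- mform (velocity K s t) (velocity K s t))).
Proof.
move=> c; under eq_fun do rewrite mform_velocity_self//.
move=> x; apply: (@continuous_comp _ _ _
  (fun t => conformal_factor (s t) ^+ 2 * (dpcoord s t * dvcoord s t)) (@Num.sqrt R));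
  last exact: sqrt_continuous.
apply: cvgM; last by apply: cvgM; [exact: continuous_dpcoord|exact: continuous_dvcoord].
by apply: cvgM; exact: (continuous_conformal_factor c).
Qed.

(** Different lifts of one point of the quadric differ by full turns, but the
strip around p is too narrow for a full turn. *)
Lemma cover_inj_in_strip p q q' : in_strip p q -> in_strip p q' -> cover K q = cover K q' -> q = q'.
Proof.
move=> n n' e; suff [ea eh] : ang q = ang q' /\ hyp q = hyp q'.
  move: ea eh; rewrite /ang /hyp; case: ifP => _.
    by case: q {n e} => a b; case: q' {n'} => a' b' /= -> ->.
  by case: q {n e} => a b; case: q' {n'} => a' b' /= -> ->.
have [K0|K0] := eqVneq K 0.
  have := cover_comp0 q; have := cover_comp2 q.
  by rewrite e cover_comp0 cover_comp2 K0 eqxx => -> ->.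
have r0 := radius_gt0.
have eh : hyp q = hyp q'.
  have := cover_comp2 q; rewrite e cover_comp2 (negbTE K0).
  move=> /(mulfI (lt0r_neq0 r0)).
  have mono x y : x < y -> sinh x < sinh y :> R.
    by move=> xy; rewrite ltr_pM2r// ltrB ?ltr_expR// ltrN2.
  by case: (ltgtP (hyp q) (hyp q')) => // /mono + e'; rewrite e' ltxx.
split => //.
have rc : radius * cosh (hyp q') != 0 by rewrite gt_eqF// mulr_gt0// cosh_gt0.
have ec : cos (ang q) = cos (ang q').
  have := cover_comp0 q; rewrite e cover_comp0 (negbTE K0) eh.
  by move=> /(mulfI rc).
have es : sin (ang q) = sin (ang q').
  have := cover_comp1 q; rewrite e cover_comp1 (negbTE K0) eh.
  by move=> /(mulfI rc).
have [h1 h2] := n K0; have [h3 h4] := n' K0.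
have c1 : cos (ang q - ang q') = 1 by rewrite cosB ec es -!expr2 cos2Dsin2.
have s0 : sin ((ang q - ang q') / 2) = 0.
  have := cosB_prod 0 (ang q - ang q'); rewrite cos0 c1 subrr addr0 subr0.
  move/esym/eqP; rewrite mulf_eq0 pnatr_eq0/= -expr2 sqrf_eq0 => /eqP//.
move: h1 h2 h3 h4; rewrite /vcoord /ucoord !ltr_norml.
move=> /andP[? ?] /andP[? ?] /andP[? ?] /andP[? ?].
have [a0|a0|a0] := ltgtP (ang q) (ang q'); last by [].
- have : 0 < sin ((ang q' - ang q) / 2) by apply: sin_gt0_pi; apply/andP; split; lra.
  by rewrite -opprB mulNr sinN s0 oppr0 ltxx.
- have : 0 < sin ((ang q - ang q') / 2) by apply: sin_gt0_pi; apply/andP; split; lra.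
  by rewrite s0 ltxx.
Qed.

(** * Upper bound for the lengths of causal paths *)

Implicit Types (l : R).

Lemma causal_dnull s t : future_causal_arc K s -> 0 <= t <= 1 ->
  0 <= dpcoord s t /\ 0 <= dvcoord s t.
Proof.
move=> [c H] /H; have [k k0 e] := dchart_sum s t.
rewrite -(pmulr_rgt0 _ k0) -e -oppr_ge0 mform_velocity_self// => -[h1].
rewrite pmulr_rge0 ?exprn_gt0 ?conformal_factor_gt0// => h2; split; nra.
Qed.

Lemma arc_null_le s t t' : future_causal_arc K s -> 0 <= t -> t <= t' -> t' <= 1 ->
  null_le (s t) (s t').
Proof.
move=> c t0 tt' t1; have [C1 _] := c; split.
  apply: (@derive_ge0_le R (pcoord \o s) (dpcoord s)) => // x.
    by move=> _; exact: is_derive_pcoord.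
  move=> /andP[? ?]; have [] := @causal_dnull s x c => //.
  by apply/andP; split; lra.
apply: (@derive_ge0_le R (vcoord \o s) (dvcoord s)) => // x.
  by move=> _; exact: is_derive_vcoord.
move=> /andP[? ?]; have [] := @causal_dnull s x c => //.
by apply/andP; split; lra.
Qed.

Lemma path_null_le p q l : causal_path K p q l -> null_le p q.
Proof.
elim=> [|q' l' s _ o a e]; first exact: null_le_refl.
by apply: (null_le_trans o); rewrite -e; apply: arc_null_le.
Qed.

(** The first coordinate of the plane is a time function; this excludes closed
causal paths. *)
Lemma path_time p q l : causal_path K p q l -> p = q \/ p.1 < q.1.
Proof.
elim=> [|q' l' s _ o a e]; first by left.
right; have [[d1 _ _ _] H] := a.
have h : (s 0).1 < (s 1).1.
  apply: (@derive_gt0_lt R (fst \o s) (derive1 (fst \o s)) 0 1) => // x.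
    by move=> _; rewrite derive1E; apply: derivableP; exact: d1.
  by move=> /andP[x0 x1]; have [] := H x; rewrite ?(ltW x0) ?(ltW x1).
case: o => [->|o]; first by rewrite -e.
by apply: lt_trans o _; rewrite -e.
Qed.

Lemma path_trans p q x l l' : causal_path K p q l -> causal_path K q x l' ->
  causal_path K p x (l + l').
Proof.
move=> pq; elim=> [|q' l1 s _ IH a e]; first by rewrite addr0.
by rewrite addrA; apply: causal_path_snoc a e.
Qed.

Lemma arc_lengthE s : C1_curve s -> exists2 G : R -> R,
  forall t, is_derive t 1 G (Num.sqrt (- mform (velocity K s t) (velocity K s t))) &
  arc_length K s = G 1 - G 0.
Proof.
move=> c; have cs := @continuous_speed s c; have [G dG] := antiderivative cs.
exists G => //; exact: Rintegral_antiderivative.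
Qed.

Lemma derive_const_itv (f : R -> R) (t d : R) : 0 < t < 1 ->
  (forall x : R, 0 <= x <= 1 -> f x = f 0) -> is_derive t 1 f d -> d = 0.
Proof.
move=> /andP[t0 t1] fc [_ <-].
suff : is_derive t 1 f 0 by move=> [_ ->].
apply: (@near_eq_is_derive _ _ _ (cst (f 0))) => //.
near=> x; rewrite /= [RHS]fc//; apply/andP; split; apply: ltW.
  by near: x; exact: lt_nbhsr.
by near: x; exact: lt_nbhsl.
Unshelve. all: by end_near.
Qed.

(** A null coordinate which agrees at the end points of a causal arc is constant
along the arc, which makes the arc null. *)
Lemma null_arc s : future_causal_arc K s ->
  pcoord (s 0) = pcoord (s 1) \/ vcoord (s 0) = vcoord (s 1) -> arc_length K s = 0.
Proof.
move=> a e; have [c H] := a; have [G dG ->] := arc_lengthE c.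
suff G0 : forall t, 0 < t < 1 -> is_derive t 1 G 0.
  have d0 (z : R) : z \in `]0, 1[%R -> is_derive z 1 G (cst 0 z).
    by rewrite in_itv/=; exact: G0.
  have [|z _ ->] := @MVT R G (cst 0) 0 1 ltr01 d0; last by rewrite mul0r.
  exact/continuous_subspaceT/(continuous_is_derive dG).
move=> t t01; suff <- : Num.sqrt (- mform (velocity K s t) (velocity K s t)) = 0 by [].
rewrite mform_velocity_self//.
suff : dpcoord s t = 0 \/ dvcoord s t = 0.
  by case=> ->; rewrite !(mul0r, mulr0) sqrtr0.
case: e => e; [left|right].
  apply: (@derive_const_itv (pcoord \o s) t _ t01); last exact: is_derive_pcoord.
  move=> x /andP[x0 x1]; apply/eqP; rewrite eq_le /=.
  by rewrite (arc_null_le a (lexx 0) x0 x1).1 e (arc_null_le a x0 x1 (lexx 1)).1.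
apply: (@derive_const_itv (vcoord \o s) t _ t01); last exact: is_derive_vcoord.
move=> x /andP[x0 x1]; apply/eqP; rewrite eq_le /=.
by rewrite (arc_null_le a (lexx 0) x0 x1).2 e (arc_null_le a x0 x1 (lexx 1)).2.
Qed.

Lemma null_path p q l : causal_path K p q l ->
  pcoord p = pcoord q \/ vcoord p = vcoord q -> l = 0.
Proof.
elim=> [//|q' l' s pq IH a e h].
have := path_null_le pq; have := arc_null_le a (lexx 0) ler01 (lexx 1); rewrite e => -[oa ob] [oc od].
have {}h : (pcoord p = pcoord q' /\ pcoord q' = pcoord (s 1)) \/
    (vcoord p = vcoord q' /\ vcoord q' = vcoord (s 1)).
  case: h => h; [left|right].
    have h' : pcoord p = pcoord q' by apply/eqP; rewrite eq_le oc h oa.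
    by split => //; rewrite -h' h.
  have h' : vcoord p = vcoord q' by apply/eqP; rewrite eq_le od h ob.
  by split => //; rewrite -h' h.
rewrite IH; last by case: h => -[]; [left|right].
rewrite (null_arc a) ?addr0//.
by rewrite e; case: h => -[]; [left|right].
Qed.

Lemma velocity_future s t q : C1_curve s -> 0 <= dpcoord s t -> 0 <= dvcoord s t ->
  null_le (s t) q -> in_strip (s t) q ->
  mform (velocity K s t) (cover K q - cover K (s t)) <= 0.
Proof.
move=> c dp0 dv0 [op ov] n; rewrite mform_velocity_chord// oppr_le0.
apply: mulr_ge0.
  exact: divr_ge0 (mulr_ge0 (sqr_ge0 _) (ltW (conformal_factor_gt0 q))) (ltW (radius_gt0)).
apply: addr_ge0; apply: mulr_ge0 => //; apply: mulr_ge0.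
- apply: half_sin_ge0; rewrite ?subr_ge0// => K0.
  by have [/ltr_normlW] := in_strip_lt n K0.
- by apply/ltW/half_cos_gt0 => /n[].
- apply: half_sin_ge0; rewrite ?subr_ge0// => K0.
  by have [_ /ltr_normlW] := in_strip_lt n K0.
- by apply/ltW/half_cos_gt0 => /n[].
Qed.

Lemma velocity_past s t q : C1_curve s -> 0 <= dpcoord s t -> 0 <= dvcoord s t ->
  null_le q (s t) -> in_strip q (s t) ->
  0 <= mform (velocity K s t) (cover K q - cover K (s t)).
Proof.
move=> c dp0 dv0 [op ov] n; rewrite mform_velocity_chord//.
rewrite -[pcoord q - _]opprB -[vcoord q - vcoord _]opprB !half_sinN !mulNr !mulrN -opprD mulrN opprK.
apply: mulr_ge0.
  exact: divr_ge0 (mulr_ge0 (sqr_ge0 _) (ltW (conformal_factor_gt0 q))) (ltW (radius_gt0)).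
apply: addr_ge0; apply: mulr_ge0 => //; apply: mulr_ge0.
- apply: half_sin_ge0; rewrite ?subr_ge0// => K0.
  by have [/ltr_normlW] := in_strip_lt n K0.
- by apply/ltW/half_cos_gt0 => /(in_strip_sym n)[].
- apply: half_sin_ge0; rewrite ?subr_ge0// => K0.
  by have [_ /ltr_normlW] := in_strip_lt n K0.
- by apply/ltW/half_cos_gt0 => /(in_strip_sym n)[].
Qed.

Section calibration.
Variables (p q : R * R) (T : R).
Hypotheses (npq : in_strip p q) (T0 : 0 < T) (TK : T <= rho K).
Hypothesis chordT : chord2 p q = - (4 * sn K (T / 2) ^+ 2).

Let w := cover K q - cover K p.
Let m := 2 * sn K (T / 2).

(** An affine function of the ambient space along the chord; its quotient by the
length of the chord is [sn K] of the signed distance to the orthogonal bisector,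
whose gradient is a unit timelike vector field. *)
Definition chord_height x : R :=
  (- mform (cover K x) w + (mform (cover K p) w + mform (cover K q) w) / 2) / m.

Let m0 : 0 < m.
Proof. by move: T0 TK => ? ?; rewrite mulr_gt0// sn_gt0//; lra. Qed.

Let mww : mform w w = - m ^+ 2.
Proof. by transitivity (chord2 p q) => //; rewrite chordT /m; ring. Qed.

Lemma chord_height_p : chord_height p = - sn K (T / 2).
Proof.
rewrite /chord_height; apply: (@mulIf _ m); first by rewrite gt_eqF ?m0.
rewrite divfK ?gt_eqF ?m0//.
transitivity (mform w w / 2); first by rewrite {2}/w mformDl mformNl; field.
by rewrite mww /m; field.
Qed.

Lemma chord_height_q : chord_height q = sn K (T / 2).
Proof.
rewrite /chord_height; apply: (@mulIf _ m); first by rewrite gt_eqF ?m0.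
rewrite divfK ?gt_eqF ?m0//.
transitivity (- (mform w w / 2)); first by rewrite {3}/w mformDl mformNl; field.
by rewrite mww /m; field.
Qed.

Lemma height_gram x : - (mform w w - K * mform (cover K x) w ^+ 2) =
  m ^+ 2 * (1 + K * chord_height x ^+ 2).
Proof.
have mN : m != 0 by rewrite gt_eqF ?m0.
rewrite mww /chord_height; have [K0|K0] := eqVneq K 0.
  have Ka a : K * a = 0 by rewrite K0 mul0r.
  by rewrite !Ka; ring.
have -> : mform (cover K p) w + mform (cover K q) w = 0.
  by rewrite /w !mform_lin !mform_cover// (mformC (cover K q)); ring.
by field.
Qed.

Lemma height_pos x : chord_height p <= chord_height x <= chord_height q ->
  0 < 1 + K * chord_height x ^+ 2.
Proof.
rewrite chord_height_p chord_height_q => /andP[h1 h2].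
have r0 := rho_gt0 K; move: T0 TK => ? ?.
have c0 : 0 < cs K (T / 2) ^+ 2 by rewrite exprn_gt0// cs_gt0// ger0_norm; lra.
have [K0|K0] := leP 0 K; first by rewrite ltr_pwDl// mulr_ge0// sqr_ge0.
apply: lt_le_trans c0 _; rewrite cs2_sn2 lerD2l ler_nM2l//.
by rewrite -subr_ge0 subr_sqr mulr_ge0//; lra.
Qed.

Lemma velocity_chord s t : C1_curve s -> 0 <= dpcoord s t -> 0 <= dvcoord s t ->
  null_le p (s t) -> null_le (s t) q -> 0 <= - mform (velocity K s t) w.
Proof.
move=> c dp0 dv0 oa ob.
have [n1 n2] := in_strip_sub oa ob npq.
have -> : - mform (velocity K s t) w =
   - mform (velocity K s t) (cover K q - cover K (s t))
   + mform (velocity K s t) (cover K p - cover K (s t)).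
  by rewrite /w !mform_lin; ring.
by rewrite addr_ge0 ?oppr_ge0 ?velocity_future ?velocity_past//; exact: in_strip_sym.
Qed.

Lemma is_derive_height s t : C1_curve s ->
  is_derive t 1 (chord_height \o s) (- mform (velocity K s t) w / m).
Proof.
move=> c; have dm := is_derive_mform w (is_derive_cover c t).
have -> : chord_height \o s = (fun t => (- mform ((cover K \o s) t) w +
    (mform (cover K p) w + mform (cover K q) w) / 2) * m^-1) by [].
by apply: trigger_derive; rewrite /GRing.scale/=; ring.
Qed.

Lemma height_arc s t t' : future_causal_arc K s -> null_le p (s 0) -> null_le (s 1) q ->
  0 <= t -> t <= t' -> t' <= 1 -> chord_height (s t) <= chord_height (s t').
Proof.
move=> a oa ob t0 tt' t1; have [c _] := a.
apply: (@derive_ge0_le R (chord_height \o s)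
  (fun t => - mform (velocity K s t) w / m)) => //.
  by move=> x _; exact: is_derive_height.
move=> x /andP[tx xt']; have x0 : 0 <= x by lra.
have x1 : x <= 1 by lra.
have [|dp0 dv0] := @causal_dnull s x a; first by rewrite x0.
rewrite divr_ge0 ?(ltW m0)//; apply: velocity_chord => //.
  exact: (null_le_trans oa (arc_null_le a (lexx 0) x0 x1)).
exact: (null_le_trans (arc_null_le a x0 x1 (lexx 1)) ob).
Qed.

(** On tangent vectors, the Gram inequality says that the gradient of the
distance to the bisector is a unit vector, hence that this distance grows at
least as fast as the length. *)
Lemma calibrated_arc s : future_causal_arc K s -> null_le p (s 0) -> null_le (s 1) q ->
  chord_height p <= chord_height (s 0) -> chord_height (s 1) <= chord_height q ->
  arc_length K s <= asn K (chord_height (s 1)) - asn K (chord_height (s 0)).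
Proof.
move=> a oa ob h0 h1; have [c _] := a; have [G dG ->] := arc_lengthE c.
have pos t : 0 <= t <= 1 -> 0 < 1 + K * chord_height (s t) ^+ 2.
  move=> /andP[t0 t1]; apply: height_pos; apply/andP; split.
    by apply: le_trans h0 _; exact: height_arc.
  by apply: le_trans h1; exact: height_arc.
have dF t : 0 <= t <= 1 -> is_derive t 1
    (fun t => asn K ((chord_height \o s) t) - G t)
    ((- mform (velocity K s t) w / m) / Num.sqrt (1 + K * chord_height (s t) ^+ 2)
     - Num.sqrt (- mform (velocity K s t) (velocity K s t))).
  move=> /pos /is_derive_asn dg; have := dG t => ?.
  have dh := is_derive_height t c.
  have := @is_derive1_comp R (asn K) (chord_height \o s) t _ _ dg dh => ?.
  by rewrite [X in X - _]mulrC; exact: is_deriveB.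
have : asn K (chord_height (s 0)) - G 0 <= asn K (chord_height (s 1)) - G 1.
  apply: (@derive_ge0_le R _ _ 0 1 ler01 dF) => t /andP[/ltW t0 /ltW t1].
  have t01 : 0 <= t <= 1 by rewrite t0.
  have /pos := t01; rewrite -sqrtr_gt0 => h.
  rewrite subr_ge0 ler_pdivlMr// ler_pdivlMr//.
  have [dp0 dv0] := causal_dnull a t01.
  rewrite -ler_sqr ?nnegrE; last first.
  - apply: velocity_chord => //.
      exact: (null_le_trans oa (arc_null_le a (lexx 0) t0 t1)).
    exact: (null_le_trans (arc_null_le a t0 t1 (lexx 1)) ob).
  - by rewrite mulr_ge0 ?(ltW m0)// mulr_ge0 ?sqrtr_ge0.
  have b2 := sqr_sqrtr (ltW (pos t t01)).
  have a2 : Num.sqrt (- mform (velocity K s t) (velocity K s t)) ^+ 2 =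
      - mform (velocity K s t) (velocity K s t).
    by rewrite sqr_sqrtr// mform_velocity_self// mulr_ge0 ?sqr_ge0// mulr_ge0.
  have e := height_gram (s t); rewrite -b2 in e; move: e; move: (Num.sqrt _) a2 => A a2.
  move: (Num.sqrt _) => B e.
  have -> : (A * B * m) ^+ 2 = A ^+ 2 * (m ^+ 2 * B ^+ 2) by ring.
  rewrite -e a2 mulrNN sqrrN.
  by apply: gram => K0; exact: velocity_tangent.
lra.
Qed.

(** Induction on the path. That its end point lies below q keeps all arcs in the
region where the height is monotone along causal curves. *)
Lemma calibrated_path x l : causal_path K p x l -> null_le x q ->
  chord_height p <= chord_height x /\
  (chord_height x <= chord_height q ->
   l <= asn K (chord_height x) - asn K (chord_height p)).
Proof.
elim=> [|y l' s py IH a e] o; first by split=> // _; rewrite subrr.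
have oyq : null_le y q by apply: null_le_trans o; rewrite -e; exact: arc_null_le.
have opy := path_null_le py.
have [h1 h2] := IH oyq.
have h3 : chord_height y <= chord_height (s 1).
  by rewrite -e; apply: height_arc => //; rewrite e.
split=> [|h4]; first exact: le_trans h3.
have := h2 (le_trans h3 h4).
have : arc_length K s <= asn K (chord_height (s 1)) - asn K (chord_height y).
  by rewrite -e; apply: calibrated_arc => //; rewrite e.
lra.
Qed.

Lemma path_length_le_chord l : causal_path K p q l -> l <= T.
Proof.
move=> pq; have [_ /(_ (lexx _))] := calibrated_path pq (null_le_refl q).
have r0 := rho_gt0 K; move: T0 TK => ? ?.
rewrite chord_height_p chord_height_q -snN !asn_sn ?normrN ?ger0_norm; lra.
Qed.

End calibration.

(** For T = 0 the two points lie on a common null line, and the calibration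
degenerates; there, all causal paths are null. *)
Lemma path_length_le p q l T : in_strip p q -> 0 <= T -> T <= rho K ->
  chord2 p q = - (4 * sn K (T / 2) ^+ 2) -> causal_path K p q l -> l <= T.
Proof.
move=> n; rewrite le_eqVlt => /orP[/eqP <- _|T0 TK chordT pq]; last first.
  exact: (path_length_le_chord n T0 TK chordT pq).
rewrite mul0r sn0 expr0n/= mulr0 oppr0 chord2_null => e pq.
have [oa ob] := path_null_le pq; have cc := conformal_factors_gt0 p q.
rewrite (null_path pq)//.
have [e1|/eqP e1] := eqVneq (pcoord p) (pcoord q); [by left|right].
have {}e1 : 0 < pcoord q - pcoord p by rewrite subr_gt0 lt_neqAle oa andbT; apply/eqP.
apply/eqP; rewrite eq_le ob /= leNgt; apply/negP; rewrite -subr_gt0 => e2.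
move/eqP: e; rewrite oppr_eq0 gt_eqF// mulr_gt0// mulr_gt0//; apply: half_sin_gt0 => //.
  by move=> K0; have [/ltr_normlW] := in_strip_lt n K0.
by move=> K0; have [_ /ltr_normlW] := in_strip_lt n K0.
Qed.

(** * Geodesics of the model plane *)

Implicit Types (T : R).

Lemma mform_nondegenerate u v : (forall w, mform u w = mform v w) -> u = v.
Proof.
move=> uv; have e0 : eps != 0.
  by rewrite /eps; case: ifP => _; rewrite ?oppr_eq0 oner_eq0.
apply: comp_ext => -[|[|[|]]]// _; apply: (mulfI e0).
- have := uv (vec 1 0 0); rewrite !mformE comp0_vec comp1_vec comp2_vec if_same.
  by rewrite !mulr0 !mulr1 !addr0 !subr0.
- have [K0|K0] := eqVneq K 0; first by rewrite !comp1_flat.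
  have := uv (vec 0 1 0); rewrite !mformE comp0_vec comp1_vec comp2_vec (negbTE K0).
  by rewrite !mulr0 !mulr1 !add0r !subr0.
- have := uv (vec 0 0 1); rewrite !mformE comp0_vec comp1_vec comp2_vec if_same.
  rewrite !mulr0 !mulr1 !add0r !mulrN => /oppr_inj//.
Qed.

Lemma unit_speed s : model_geodesic K s ->
  mform (velocity K s 0) (velocity K s 0) = - 1 ->
  forall t, mform (velocity K s t) (velocity K s t) = - 1.
Proof.
move=> [c H] n0 t.
pose acc t := derive1 (velocity K s) t.
have da (x : R) : is_derive x 1 (velocity K s) (acc x).
  by rewrite /acc derive1E; apply: derivableP; have [] := H x.
rewrite -n0; apply: (@is_derive_0_is_cst _
  (fun t => mform (velocity K s t) (velocity K s t))) => x.
have := is_derive_mform2 (da x) (da x).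
suff -> : mform (acc x) (velocity K s x) + mform (velocity K s x) (acc x) = 0 by [].
have [_ av] := H x.
rewrite (mformC (velocity K s x)) -mulr2n av ?mul0rn// => K0; exact: velocity_tangent.
Qed.

(** The geodesic equation says that the ambient acceleration is normal; along a
unit timelike geodesic, its size is determined by the curvature, so that the
geodesic solves a linear equation with constant coefficients. *)
Lemma unit_geodesicE s : model_geodesic K s ->
  mform (velocity K s 0) (velocity K s 0) = - 1 ->
  forall t, cover K (s t) =
    cs K t *: cover K (s 0) + sn K t *: velocity K s 0.
Proof.
move=> [c H] n0.
pose acc t := derive1 (velocity K s) t.
have da t : is_derive t 1 (velocity K s) (acc t).
  by rewrite /acc derive1E; apply: derivableP; have [] := H t.
have tan t w : tangent (cover K (s t)) w -> mform (acc t) w = 0 by have [_] := H t; exact.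
have norm := unit_speed (conj c H) n0.
have accE t : acc t = K *: cover K (s t).
  apply: mform_nondegenerate => w; rewrite mformZl.
  have [K0|K0] := eqVneq K 0.
    have Ka a : K * a = 0 by rewrite K0 mul0r.
    by rewrite Ka; apply: tan => /eqP /(_ K0).
  have ac : mform (acc t) (cover K (s t)) = 1.
    have := is_derive_mform2 (da t) (is_derive_cover c t).
    have -> : (fun t => mform (velocity K s t) ((cover K \o s) t)) = cst 0.
      by apply/funext => x; exact: velocity_tangent.
    by rewrite norm => -[_]; rewrite derive_cst /= => /esym/eqP; rewrite subr_eq0 => /eqP.
  have := tan t (w - (K * mform (cover K (s t)) w) *: cover K (s t)).
  rewrite mformDr mformNr mformZr ac mulr1 => h.
  apply/eqP; rewrite -subr_eq0; apply/eqP/h => _.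
  by rewrite mformDl mformNl mformZl mform_cover// mformC mulrC mulrA mulVf ?mul1r ?subrr.
move=> t; apply: comp_ext => j j3; rewrite compD !compZ.
have d1 (x : R) := (is_derive_comp _ _ _).1 (is_derive_cover c x) j j3.
have d2 (x : R) : is_derive x 1 (fun t => component j (velocity K s t)) (K * component j (cover K (s x))).
  by have := (is_derive_comp _ _ _).1 (da x) j j3; rewrite accE compZ.
by rewrite (second_order_linear d1 d2 t) /= mulrC [_ * sn _ _]mulrC.
Qed.

(** The two null velocities have the same sign on a causal vector, so that their
sum vanishes on no nonzero one and keeps its sign along the curve. *)
Lemma causal_direction s (L : R) : C1_curve s ->
  (forall t, 0 <= t <= L -> mform (velocity K s t) (velocity K s t) <= 0 /\
     velocity K s t <> 0) ->
  (forall t, 0 <= t <= L -> 0 < dpcoord s t + dvcoord s t) \/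
  (forall t, 0 <= t <= L -> dpcoord s t + dvcoord s t < 0).
Proof.
move=> c H.
have cd : {within `[0, L], continuous (fun t => dpcoord s t + dvcoord s t)}.
  apply: continuous_subspaceT => x.
  by apply: cvgD; [exact: continuous_dpcoord|exact: continuous_dvcoord].
have nz t : 0 <= t <= L -> dpcoord s t + dvcoord s t != 0.
  move=> /H[]; rewrite -oppr_ge0 mform_velocity_self// pmulr_rge0 ?exprn_gt0 ?conformal_factor_gt0//.
  move=> h v0; apply/eqP => e; apply: v0.
  have p0 : dpcoord s t = 0 by nra.
  have v0 : dvcoord s t = 0 by nra.
  have hc := chyp_gt0 (hyp (s t)).
  have [a0 h0] : dang s t = 0 /\ dhyp s t = 0.
    move: p0 v0; rewrite /dpcoord /dvcoord /dtheta.
    have [e1|e1] : eps = -1 \/ eps = 1 by rewrite /eps; case: ifP => _; [left|right].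
      rewrite e1 => p0 v0; have th : dhyp s t / chyp (hyp (s t)) = 0 by lra.
      split; first by lra.
      by move/eqP: th; rewrite mulf_eq0 invr_eq0 (gt_eqF hc) orbF => /eqP.
    rewrite e1 => p0 v0; have th : dhyp s t / chyp (hyp (s t)) = 0 by lra.
    split; first by lra.
    by move/eqP: th; rewrite mulf_eq0 invr_eq0 (gt_eqF hc) orbF => /eqP.
  rewrite velocityE// /velocity_vec a0 h0; apply: comp_ext => j j3.
  rewrite -(scale0r (0 : V3)) compZ mul0r.
  move: j j3 => [|[|[|]]]// _; rewrite ?comp0_vec ?comp1_vec ?comp2_vec.
  1-3: by rewrite !(mulr0, mul0r, addr0, subr0) if_same.
have [L0|L0] := ltP L 0.
  by left => t /andP[t0 tL]; have := le_trans t0 tL; rewrite leNgt L0.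
have z : 0 <= (0 : R) <= L by rewrite lexx.
have [h|h|h] := ltgtP 0 (dpcoord s 0 + dvcoord s 0).
- by left; exact: (nonvanishing_gt0 cd nz h).
- right=> t tL; rewrite -oppr_gt0.
  apply: (@nonvanishing_gt0 R (fun t => - (dpcoord s t + dvcoord s t)) 0 L) => //.
  + by move=> x; apply: cvgN; exact: cd.
  + by move=> x /nz; rewrite oppr_eq0.
  + by rewrite oppr_gt0.
- by have := nz 0 z; rewrite -h eqxx.
Qed.

Lemma is_derive_affine s (a b t : R) : C1_curve s ->
  is_derive t 1 (fun t => (s (a + b * t)).1) (b * derive1 (fst \o s) (a + b * t)) /\
  is_derive t 1 (fun t => (s (a + b * t)).2) (b * derive1 (snd \o s) (a + b * t)).
Proof.
move=> [d1 d2 _ _].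
have df : is_derive t 1 (fun t => a + b * t) b.
  by apply: trigger_derive; rewrite /GRing.scale/=; ring.
have e1 : is_derive (a + b * t) 1 (fst \o s) (derive1 (fst \o s) (a + b * t)).
  by rewrite derive1E; apply: derivableP; exact: d1.
have e2 : is_derive (a + b * t) 1 (snd \o s) (derive1 (snd \o s) (a + b * t)).
  by rewrite derive1E; apply: derivableP; exact: d2.
split.
  by have := @is_derive1_comp R (fst \o s) (fun t => a + b * t) t _ _ e1 df; rewrite mulrC.
by have := @is_derive1_comp R (snd \o s) (fun t => a + b * t) t _ _ e2 df; rewrite mulrC.
Qed.

Lemma C1_affine s (a b : R) : C1_curve s -> C1_curve (fun t => s (a + b * t)).
Proof.
move=> c; have [d1 d2 c1 c2] := c.
have d t := is_derive_affine a b t c.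
have ca : continuous (fun t : R => a + b * t).
  move=> x; apply: cvgD; first exact: cvg_cst.
  by apply: cvgM; [exact: cvg_cst|exact: cvg_id].
split.
- by move=> t; have [[]] := d t.
- by move=> t; have [_ []] := d t.
- have -> : derive1 (fst \o (fun t => s (a + b * t))) =
      (fun t => b * derive1 (fst \o s) (a + b * t)).
    by apply/funext => t; rewrite derive1E; have [[_ ->]] := d t.
  move=> x; apply: cvgM; first exact: cvg_cst.
  exact: (@continuous_comp _ _ _ (fun t => a + b * t) (derive1 (fst \o s)) x (ca x) (c1 _)).
- have -> : derive1 (snd \o (fun t => s (a + b * t))) =
      (fun t => b * derive1 (snd \o s) (a + b * t)).
    by apply/funext => t; rewrite derive1E; have [_ [_ ->]] := d t.
  move=> x; apply: cvgM; first exact: cvg_cst.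
  exact: (@continuous_comp _ _ _ (fun t => a + b * t) (derive1 (snd \o s)) x (ca x) (c2 _)).
Qed.

Lemma velocity_affine s (a b t : R) : C1_curve s ->
  velocity K (fun t => s (a + b * t)) t = b *: velocity K s (a + b * t).
Proof.
move=> c; have df : is_derive t 1 (fun t => a + b * t) b.
  by apply: trigger_derive; rewrite /GRing.scale/=; ring.
suff h : is_derive t 1 (cover K \o (fun t => s (a + b * t)))
    (b *: velocity K s (a + b * t)) by rewrite [LHS]derive1E; have [_ ->] := h.
apply/is_derive_comp => j j3; rewrite compZ.
have e1 := (is_derive_comp _ _ _).1 (is_derive_cover c (a + b * t)) j j3.
by have := @is_derive1_comp R _ (fun t => a + b * t) t _ _ e1 df; rewrite mulrC.
Qed.

(** Causal paths are parametrized on the unit interval; a negative b reverses a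
past directed curve. *)
Lemma segment_path s (a b k : R) : C1_curve s -> 0 <= k ->
  (forall t, 0 <= t <= 1 -> 0 < b * (dpcoord s (a + b * t) + dvcoord s (a + b * t)) /\
     mform (velocity K s (a + b * t)) (velocity K s (a + b * t)) = - k) ->
  causal_path K (s a) (s (a + b)) (`|b| * Num.sqrt k).
Proof.
move=> c k0 H; pose s' t := s (a + b * t).
have e0 : s' 0 = s a by rewrite /s' mulr0 addr0.
have e1 : s' 1 = s (a + b) by rewrite /s' mulr1.
have c' : C1_curve s' by exact: C1_affine.
have v2 t : 0 <= t <= 1 ->
    mform (velocity K s' t) (velocity K s' t) = - (b ^+ 2 * k).
  by move=> /H[_ e]; rewrite /s' velocity_affine// !mform_lin e; ring.
have arc : future_causal_arc K s'.
  split=> // t t01; have [h _] := H t t01; split; last first.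
    by rewrite v2// oppr_le0 mulr_ge0// sqr_ge0.
  have [[_ d1] _] := is_derive_affine a b t c.
  have [q q0 e] := dchart_sum s (a + b * t).
  by rewrite derive1E d1 -(pmulr_rgt0 _ q0) mulrCA -e.
have len : arc_length K s' = `|b| * Num.sqrt k.
  have [G dG ->] := @arc_lengthE s' c'.
  have d0 (z : R) : z \in `]0, 1[%R -> is_derive z 1 G (cst (`|b| * Num.sqrt k) z).
    rewrite in_itv/= => /andP[/ltW z0 /ltW z1]; have := dG z.
    by rewrite v2 ?z0// opprK sqrtrM ?sqr_ge0// sqrtr_sqr.
  have [|z _ ->] := @MVT R G (cst (`|b| * Num.sqrt k)) 0 1 ltr01 d0.
    exact/continuous_subspaceT/(continuous_is_derive dG).
  by rewrite subr0 mulr1.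
rewrite -len -e1 -[arc_length _ _]add0r.
exact: (causal_path_snoc (causal_path_refl K (s a)) arc e0).
Qed.

Lemma C1_curveI (a b a' b' : R -> R) s : fst \o s = a -> snd \o s = b ->
  (forall t, is_derive t 1 a (a' t)) -> (forall t, is_derive t 1 b (b' t)) ->
  continuous a' -> continuous b' -> C1_curve s.
Proof.
move=> ea eb da db ca cb; rewrite /C1_curve ea eb.
have ea' : derive1 a = a' by apply/funext => t; rewrite derive1E; have [_] := da t.
have eb' : derive1 b = b' by apply/funext => t; rewrite derive1E; have [_] := db t.
split; rewrite ?ea' ?eb'.
- by move=> t; have [] := da t.
- by move=> t; have [] := db t.
- exact: ca.
- exact: cb.
Qed.

(** On the quadric, one component determines the hyperbolic coordinate and the
other two avoid the origin, so that their polar angle can be lifted. *)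
Lemma curve_lift (c c' : R -> V3) p : (forall t, is_derive t 1 c (c' t)) ->
  (forall j, continuous (fun t => component j (c' t))) ->
  (K != 0 -> forall t, mform (c t) (c t) = K^-1) -> c 0 = cover K p ->
  exists s, [/\ C1_curve s, s 0 = p & forall t, cover K (s t) = c t].
Proof.
move=> dc cc' quad c0.
have d j t : (j < 3)%N -> is_derive t 1 (fun t => component j (c t)) (component j (c' t)).
  by move=> j3; exact: (is_derive_comp _ _ _).1.
pose mk (a h : R -> R) t := if K < 0 then (a t, h t) else (h t, a t).
have mkC1 a h a' h' : (forall t, is_derive t 1 a (a' t)) -> (forall t, is_derive t 1 h (h' t)) ->
    continuous a' -> continuous h' -> C1_curve (mk a h).
  move=> da dh ca ch.
  have e1 : fst \o mk a h = if K < 0 then a else h.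
    by rewrite /mk; apply/funext => t /=; case: ifP.
  have e2 : snd \o mk a h = if K < 0 then h else a.
    by rewrite /mk; apply/funext => t /=; case: ifP.
  move: e1 e2; case: (K < 0) => e1 e2.
    exact: (C1_curveI e1 e2 da dh ca ch).
  exact: (C1_curveI e1 e2 dh da ch ca).
have mkang a h t : ang (mk a h t) = a t by rewrite /ang /mk; case: (K < 0).
have mkhyp a h t : hyp (mk a h t) = h t by rewrite /hyp /mk; case: (K < 0).
have mkp a h t : a t = ang p -> h t = hyp p -> mk a h t = p.
  by rewrite /ang /hyp /mk; case: p {c0} => x y; case: (K < 0) => /= -> ->.
have [K0|K0] := eqVneq K 0.
  exists (mk (fun t => component 0 (c t)) (fun t => component 2 (c t))); split.
  - by apply: mkC1 => [t|t|//|//]; exact: d.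
  - by apply: mkp; rewrite c0 ?cover_comp0 ?cover_comp2 K0 eqxx.
  - move=> t; apply: comp_ext => -[|[|[|]]]// _.
    + by rewrite cover_comp0 (introT eqP K0) mkang.
    + by rewrite !comp1_flat.
    + by rewrite cover_comp2 (introT eqP K0) mkhyp.
pose r := radius; have r0 : 0 < r by exact: radius_gt0.
have rN : r != 0 by rewrite gt_eqF.
have ab t : component 0 (c t) ^+ 2 + component 1 (c t) ^+ 2 = component 2 (c t) ^+ 2 + r ^+ 2.
  have := quad K0 t; rewrite mformE => e.
  have er : eps * K^-1 = r ^+ 2.
    have kr := radius2 K0; rewrite -/r in kr.
    apply: (mulfI K0); rewrite mulrCA mulfV// mulr1.
    apply: (mulfI (_ : eps != 0)); first by rewrite /eps; case: ifP => _; rewrite ?oppr_eq0 oner_eq0.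
    by rewrite eps2 mulrA epsK.
  rewrite -er -e mulrA eps2; ring.
pose h t := arcsinh (component 2 (c t) / r).
have dh t : is_derive t 1 h ((Num.sqrt (1 + (component 2 (c t) / r) ^+ 2))^-1 * (component 2 (c' t) / r)).
  have d2 : is_derive t 1 (fun t => component 2 (c t) / r) (component 2 (c' t) / r).
    by have := d 2%N t isT => ?; apply: trigger_derive; rewrite /GRing.scale/=; ring.
  exact: (@is_derive1_comp R _ _ t _ _ (is_derive_arcsinh _) d2).
have ch t : Num.sqrt (component 0 (c t) ^+ 2 + component 1 (c t) ^+ 2) = r * cosh (h t).
  have cc : r * cosh (h t) = Num.sqrt ((r * cosh (h t)) ^+ 2).
    by rewrite sqrtr_sqr gtr0_norm// mulr_gt0// cosh_gt0.
  rewrite cc ab exprMn cosh2_sinh2 /h arcsinhK; congr Num.sqrt; field.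
  exact: rN.
have h0 : h 0 = hyp p.
  by rewrite /h c0 cover_comp2 (negbTE K0) -/r mulrAC mulfV// mul1r sinhK.
have [|||a [a' [da ca' a0 aE]]] := @angle_lift R (fun t => component 0 (c t)) (fun t => component 1 (c t))
    (fun t => component 0 (c' t)) (fun t => component 1 (c' t)) (ang p)
    (fun t => d 0%N t isT) (fun t => d 1%N t isT) (cc' 0%N) (cc' 1%N).
- by move=> t; rewrite ab ltr_wpDl ?sqr_ge0// exprn_gt0.
- by rewrite ch h0 c0 cover_comp0 (negbTE K0).
- by rewrite ch h0 c0 cover_comp1 (negbTE K0).
exists (mk a h); split.
- apply: (mkC1 _ _ _ _ da dh ca') => x; apply: cvgM; last first.
    by apply: cvgM; [exact: cc'|exact: cvg_cst].
  apply: cvgV; first by rewrite gt_eqF// sqrtr_gt0 ltr_wpDr ?sqr_ge0.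
  apply: (@continuous_comp _ _ _ (fun t => 1 + (component 2 (c t) / r) ^+ 2) (@Num.sqrt R));
    last exact: sqrt_continuous.
  have d2 t : is_derive t 1 (fun t => 1 + (component 2 (c t) / r) ^+ 2)
      (2 * (component 2 (c t) / r) * (component 2 (c' t) / r)).
    by have := d 2%N t isT => ?; apply: trigger_derive; rewrite /GRing.scale/=; ring.
  exact: (continuous_is_derive d2).
- exact: mkp.
- move=> t; have [e0 e1] := aE t; apply: comp_ext => -[|[|[|]]]// _.
  + by rewrite cover_comp0 (negbTE K0) mkang mkhyp -/r -ch -e0.
  + by rewrite cover_comp1 (negbTE K0) mkang mkhyp -/r -ch -e1.
  + by rewrite cover_comp2 (negbTE K0) mkhyp -/r /h arcsinhK mulrCA mulfV// mulr1.
Qed.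

Lemma lift_velocity s c c' : (forall t, cover K (s t) = c t) ->
  (forall t, is_derive t 1 c (c' t)) -> velocity K s = c'.
Proof.
move=> sc dc; have e : cover K \o s = c by apply/funext.
by apply/funext => t; rewrite /velocity e derive1E; have [_] := dc t.
Qed.

Lemma is_derive_cs_sn u v t :
  is_derive t 1 (fun t => cs K t *: u + sn K t *: v)
    ((K * sn K t) *: u + cs K t *: v).
Proof.
apply/is_derive_comp => j j3; under eq_fun do rewrite compD !compZ.
rewrite compD !compZ; have := is_derive_sn K t; have := is_derive_cs K t => ? ?.
by apply: trigger_derive; rewrite /GRing.scale/=; ring.
Qed.

Lemma mform_line u v t :
  mform (u + t *: v) (u + t *: v) = mform u u + 2 * t * mform u v + t ^+ 2 * mform v v.
Proof. by rewrite !mform_lin (mformC v u); ring. Qed.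

(** The ambient solution lies on the quadric and can therefore be lifted. *)
Lemma unit_geodesic_exists p u : tangent (cover K p) u -> mform u u = - 1 ->
  exists s, [/\ model_geodesic K s, s 0 = p, velocity K s 0 = u &
    forall t, cover K (s t) = cs K t *: cover K p + sn K t *: u].
Proof.
move=> tu u1.
pose c t := cs K t *: cover K p + sn K t *: u.
pose c' t := (K * sn K t) *: cover K p + cs K t *: u.
have dc t : is_derive t 1 c (c' t) by exact: is_derive_cs_sn.
have cc' j : continuous (fun t => component j (c' t)).
  have d t : is_derive t 1 (fun t => component j (c' t))
      (K * cs K t * component j (cover K p) + K * sn K t * component j u).
    rewrite /c'; under eq_fun do rewrite compD !compZ.
    have := is_derive_sn K t; have := is_derive_cs K t => ? ?.
    by apply: trigger_derive; rewrite /GRing.scale/=; ring.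
  exact: (continuous_is_derive d).
have [||s [sC1 s0 sc]] := curve_lift dc cc' _ (_ : c 0 = cover K p).
- move=> K0 t; rewrite /c !mform_lin mform_cover// (mformC _ u) tu// u1.
  transitivity ((cs K t ^+ 2 - K * sn K t ^+ 2) / K); last by rewrite cs2_sn2; field; exact: K0.
  by field; exact: K0.
- by rewrite /c cs0 sn0 scale1r scale0r addr0.
have vE := lift_velocity sc dc.
exists s; split => //; last by rewrite vE /c' sn0 cs0 mulr0 scale0r add0r scale1r.
split => // t; rewrite vE.
have dc' : is_derive t 1 c' (K *: c t).
  apply/is_derive_comp => j j3; rewrite /c' /c; under eq_fun do rewrite compD !compZ.
  rewrite compZ compD !compZ; have := is_derive_sn K t; have := is_derive_cs K t => ? ?.
  by apply: trigger_derive; rewrite /GRing.scale/=; ring.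
have [d e] := dc'; split=> // w tw; rewrite derive1E e mformZl.
have [K0|K0] := eqVneq K 0; first by rewrite [X in X * _]K0 mul0r.
by rewrite -sc mformC tw// mulr0.
Qed.

Lemma chord2_cs_sn p q (u : V3) t : tangent (cover K p) u -> mform u u = - 1 ->
  cover K q = cs K t *: cover K p + sn K t *: u ->
  chord2 p q = - (4 * sn K (t / 2) ^+ 2).
Proof.
move=> tu u1 e; rewrite /chord2 e !mform_lin (mformC _ u) u1.
have h2 : sn K t ^+ 2 = 4 * (sn K (t / 2) ^+ 2 * (1 + K * sn K (t / 2) ^+ 2)).
  by rewrite -cs2_sn2 sn_half; ring.
have [K0|K0] := eqVneq K 0.
  have c1 : cs K t = 1 by rewrite /cs K0 eqxx.
  have Ka a : K * a = 0 by rewrite K0 mul0r.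
  rewrite Ka in h2; rewrite c1; lra.
rewrite tu// mform_cover//.
transitivity ((cs K t - 1) ^+ 2 / K - sn K t ^+ 2); first by field; exact: K0.
by rewrite h2 cs_half; field; exact: K0.
Qed.

(** Along the geodesic, the factor of [in_strip_factor] is a square of cs, which has
no zero on this range. *)
Lemma unit_geodesic_in_strip s T : model_geodesic K s ->
  mform (velocity K s 0) (velocity K s 0) = - 1 -> 0 <= T -> T <= rho K ->
  chord2 (s 0) (s T) = - (4 * sn K (T / 2) ^+ 2) /\ in_strip (s 0) (s T).
Proof.
move=> gs v1 T0 TK; have c := gs.1.
have tv : tangent (cover K (s 0)) (velocity K s 0) by move=> K0; exact: velocity_tangent.
have ch t := chord2_cs_sn tv v1 (unit_geodesicE gs v1 t).
split; first exact: ch.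
have TT : 0 <= T <= T by rewrite T0 lexx.
apply: (@in_strip_continuous (s 0) s T _ _ (in_strip_refl (s 0)) _ T TT).
- exact/continuous_subspaceT/(continuous_is_derive (is_derive_ang c)).
- exact/continuous_subspaceT/(continuous_is_derive (is_derive_theta c)).
move=> t /andP[t0 tT]; rewrite ch.
have -> : 1 - K * - (4 * sn K (t / 2) ^+ 2) / 4 = cs K (t / 2) ^+ 2.
  by rewrite cs2_sn2; field.
by rewrite exprn_gt0// cs_gt0// ger0_norm; lra.
Qed.

(** The curve moves strictly down in the sum of the null coordinates, while its end
points are ordered upwards. *)
Lemma dirsum_le s (L : R) : C1_curve s -> 0 <= L ->
  (forall t, 0 <= t <= L -> dpcoord s t + dvcoord s t < 0) ->
  null_le (s 0) (s L) -> L = 0.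
Proof.
move=> c; rewrite le_eqVlt => /orP[/eqP <-//|L0] H [op ov].
have : (fun t => - (pcoord (s t) + vcoord (s t))) 0 < (fun t => - (pcoord (s t) + vcoord (s t))) L.
  apply: (@derive_gt0_lt R (fun t => - (pcoord (s t) + vcoord (s t)))
    (fun t => - (dpcoord s t + dvcoord s t)) 0 L L0).
    move=> x _; have := is_derive_pcoord c x; have := is_derive_vcoord c x => ? ?.
    have -> : (fun t => - (pcoord (s t) + vcoord (s t))) =
       (fun t => - ((pcoord \o s) t + (vcoord \o s) t)) by [].
    by apply: trigger_derive; ring.
  by move=> x /andP[/ltW x0 /ltW xL]; rewrite oppr_gt0 H// x0.
by rewrite ltrN2; lra.
Qed.

(** By [causal_direction] the geodesic is future or past directed, and its parameter
is the arc length. *)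
Lemma unit_geodesic_path s T : model_geodesic K s ->
  mform (velocity K s 0) (velocity K s 0) = - 1 -> 0 <= T ->
  (causal_path K (s 0) (s T) T /\
    forall t, 0 <= t <= T -> 0 < dpcoord s t + dvcoord s t) \/
  (causal_path K (s T) (s 0) T /\
    forall t, 0 <= t <= T -> dpcoord s t + dvcoord s t < 0).
Proof.
move=> gs v1 T0; have vv := unit_speed gs v1.
have H t : 0 <= t <= T -> mform (velocity K s t) (velocity K s t) <= 0 /\
    velocity K s t <> 0.
  move=> _; rewrite vv; split; first by rewrite oppr_le0.
  move=> e; have := vv t; rewrite e -(scale0r (0 : V3)) mformZl mul0r => /eqP.
  by rewrite eq_sym oppr_eq0 oner_eq0.
have [T00|T00] := eqVneq T 0.
  have z : 0 <= (0 : R) <= T by rewrite lexx.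
  have [h|h] := causal_direction gs.1 H; [left|right]; split => //; rewrite T00.
    exact: causal_path_refl.
  exact: causal_path_refl.
have {}T0 : 0 < T by rewrite lt_neqAle eq_sym T00.
have [h|h] := causal_direction gs.1 H; [left|right]; split => //.
  have := @segment_path s 0 T 1 gs.1 ler01.
  rewrite sqrtr1 mulr1 add0r gtr0_norm//; apply => t /andP[t0 t1].
  rewrite vv add0r pmulr_rgt0//; split=> //; apply: h; apply/andP; split; nra.
have := @segment_path s T (- T) 1 gs.1 ler01.
rewrite sqrtr1 mulr1 subrr normrN gtr0_norm//; apply => t /andP[t0 t1].
rewrite vv nmulr_rgt0 ?oppr_lt0//; split=> //; apply: h; apply/andP; split; nra.
Qed.

(** The curve is found in the ambient space. Its lift ends at q, and not at another
point above the same point of the quadric, because both are [in_strip] p. For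
T = 0 it is a straight null line, which lies in the quadric. *)
Lemma chord_path p q T : null_le p q -> in_strip p q -> 0 <= T -> T <= rho K ->
  chord2 p q = - (4 * sn K (T / 2) ^+ 2) -> causal_path K p q T.
Proof.
move=> o n; rewrite le_eqVlt => /orP[/eqP <- _|T0 TK] ch.
  have {}ch : chord2 p q = 0 by rewrite ch mul0r sn0 expr0n/= mulr0 oppr0.
  have [->|/eqP pq] := eqVneq p q; first exact: causal_path_refl.
  pose w := cover K q - cover K p.
  have w0 : w <> 0.
    move=> /eqP; rewrite subr_eq0 => /eqP/esym e.
    exact: pq (cover_inj_in_strip (in_strip_refl p) n e).
  have ww : mform w w = 0 by exact: ch.
  pose c (t : R) := cover K p + t *: w.
  have dc t : is_derive t 1 c w.
    apply/is_derive_comp => j j3; rewrite /c; under eq_fun do rewrite compD !compZ.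
    by apply: trigger_derive; rewrite /GRing.scale/=; ring.
  have pw : K != 0 -> mform (cover K p) w = 0.
    by move=> K0; rewrite /w mformDr mformNr mform_chord2// mform_cover// ch; ring.
  have quad : K != 0 -> forall t, mform (c t) (c t) = K^-1.
    by move=> K0 t; rewrite /c mform_line pw// ww mform_cover//; ring.
  have [||s [sC1 s0 sc]] := curve_lift dc (fun j => _) quad (_ : c 0 = cover K p).
  - by move=> j x; exact: cvg_cst.
  - by rewrite /c scale0r addr0.
  have vE := lift_velocity sc dc.
  have nn t : 0 <= t <= 1 -> in_strip p (s t).
    apply: (@in_strip_continuous p s 1) => //; last 1 first.
    - move=> x _; rewrite /chord2 sc /c [_ + x *: w]addrC addrK mformZl mformZr ww.
      by rewrite !mulr0 mul0r subr0.
    - exact/continuous_subspaceT/(continuous_is_derive (is_derive_ang sC1)).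
    - exact/continuous_subspaceT/(continuous_is_derive (is_derive_theta sC1)).
    - by rewrite s0; exact: in_strip_refl.
  have s1 : s 1 = q.
    apply: (cover_inj_in_strip (nn 1 _) n); first by rewrite ler01 lexx.
    by rewrite sc /c scale1r /w addrC subrK.
  have := @causal_direction s 1 sC1 (fun t _ => _).
  rewrite vE ww => /(_ (fun _ => conj (lexx 0) w0)) [H|H]; last first.
    have o' : null_le (s 0) (s 1) by rewrite s0 s1.
    by have /eqP := dirsum_le sC1 ler01 H o'; rewrite oner_eq0.
  have := @segment_path s 0 1 0 sC1 (lexx 0).
  rewrite sqrtr0 mulr0 add0r s0 s1; apply => t t01; rewrite vE ww oppr0; split=> //.
  by rewrite !mul1r add0r; exact: H.
have rN := rho_gt0 K.
have s0 : 0 < sn K T by rewrite sn_gt0.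
have sN : sn K T != 0 by rewrite gt_eqF.
pose u := (sn K T)^-1 *: (cover K q - cs K T *: cover K p).
have qE : cover K q = cs K T *: cover K p + sn K T *: u.
  by rewrite /u scalerA mulfV// scale1r addrC subrK.
have pq : K != 0 -> mform (cover K p) (cover K q) = cs K T / K.
  by move=> K0; rewrite mform_chord2// ch cs_half; field; exact: K0.
have tu : tangent (cover K p) u.
  move=> K0; rewrite /u !mform_lin mform_cover// (mformC (cover K q)) pq//.
  by rewrite subrr mulr0.
have u1 : mform u u = - 1.
  have h2 : sn K T ^+ 2 = 4 * (sn K (T / 2) ^+ 2 * (1 + K * sn K (T / 2) ^+ 2)).
    by rewrite -cs2_sn2 sn_half; ring.
  apply: (@mulfI _ (sn K T ^+ 2)); first by rewrite expf_neq0.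
  rewrite /u mformZl mformZr.
  transitivity (mform (cover K q - cs K T *: cover K p) (cover K q - cs K T *: cover K p)).
    by field; exact: sN.
  have [K0|K0] := eqVneq K 0.
    have c1 : cs K T = 1 by rewrite /cs K0 eqxx.
    have Ka a : K * a = 0 by rewrite K0 mul0r.
    by rewrite c1 scale1r h2 Ka -[LHS]/(chord2 p q) ch; ring.
  rewrite !mform_lin (mformC (cover K q) (cover K p)) pq// !mform_cover//.
  transitivity ((1 - cs K T ^+ 2) / K); first by field; exact: K0.
  by rewrite cs2_sn2; field; exact: K0.
have [s [gs sp v0 sc]] := unit_geodesic_exists tu u1.
have v1 : mform (velocity K s 0) (velocity K s 0) = - 1 by rewrite v0.
have sT : s T = q.
  have [_ n'] := unit_geodesic_in_strip gs v1 (ltW T0) TK; rewrite sp in n'.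
  by apply: (cover_inj_in_strip n' n); rewrite sc qE.
have := unit_geodesic_path gs v1 (ltW T0).
rewrite sp sT => -[[]|[_ o']] //.
by have := dirsum_le gs.1 (ltW T0) o'; rewrite sp sT => /(_ o) e; rewrite e ltxx in T0.
Qed.

(** * Time separation and angles in the model plane *)

Implicit Types (x y z : R * R) (a b c : R) (d : time_dir).

Lemma model_tau_ge0 p q : (0%:E <= model_tau K p q)%E.
Proof. by apply: ereal_sup_ubound; exists 0 => //; left. Qed.

Lemma path_le_tau p q l : causal_path K p q l -> (l%:E <= model_tau K p q)%E.
Proof. by move=> h; apply: ereal_sup_ubound; exists l => //; right. Qed.

(** The two bounds are [path_length_le] and [chord_path]; in the reverse direction,
the first coordinate is an obstruction to causal paths. *)
Lemma model_tau_chord p q T : null_le p q -> in_strip p q -> 0 <= T -> T <= rho K ->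
  chord2 p q = - (4 * sn K (T / 2) ^+ 2) ->
  [/\ model_caus K p q, model_tau K p q = T%:E & model_tau K q p = 0%E].
Proof.
move=> o n T0 TK ch; have pq := chord_path o n T0 TK ch.
split; first by exists T.
- apply/eqP; rewrite eq_le path_le_tau// andbT; apply: ge_ereal_sup.
  move=> _ [l [->|h] <-]; rewrite lee_fin//.
  exact: (path_length_le n T0 TK ch h).
- apply/eqP; rewrite eq_le model_tau_ge0 andbT; apply: ge_ereal_sup.
  move=> _ [l [->|h] <-]; rewrite lee_fin//.
  case: (path_time h) => [e|qp].
    rewrite e in h; apply: (path_length_le (in_strip_refl p) (lexx 0)) h.
      exact/ltW/rho_gt0.
    by rewrite chord2pp mul0r sn0 expr0n/= mulr0 oppr0.
  case: (path_time pq) => [e|]; first by rewrite e ltxx in qp.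
  by rewrite ltNge (ltW qp).
Qed.

Lemma path_of_tau_gt0 p q : (0 < model_tau K p q)%E ->
  exists2 l, 0 < l & causal_path K p q l.
Proof.
move=> /ereal_sup_gt[_ [l [->|h] <-]]; first by rewrite ltxx.
by exists l.
Qed.

Lemma tau_gt0_time p q : (0 < model_tau K p q)%E -> p.1 < q.1.
Proof.
move=> /path_of_tau_gt0[l l0 h]; case: (path_time h) => // e.
rewrite e in h; suff : l <= 0 by rewrite leNgt l0.
apply: (path_length_le (in_strip_refl q) (lexx 0)) h; first exact/ltW/rho_gt0.
by rewrite chord2pp mul0r sn0 expr0n/= mulr0 oppr0.
Qed.

(** The law of cosines of the model plane, with squared half chords in place of
cosines so that it includes the case K = 0. *)
Lemma chord2_cosines p y z u v a c : tangent (cover K p) u -> tangent (cover K p) v ->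
  mform u u = - 1 -> mform v v = - 1 ->
  cover K y = cs K a *: cover K p + sn K a *: u ->
  cover K z = cs K c *: cover K p + sn K c *: v ->
  chord2 y z = - (4 * sn K ((c - a) / 2) ^+ 2) - 2 * (sn K a * sn K c) * (1 + mform u v).
Proof.
move=> tu tv u1 v1 ey ez.
rewrite /chord2 ey ez !mform_lin (mformC _ u) (mformC _ v) (mformC v u) u1 v1.
have hc : cs K (c - a) = 1 + 2 * K * sn K ((c - a) / 2) ^+ 2 by exact: cs_half.
have hs : sn K (c - a) ^+ 2 = 4 * (sn K ((c - a) / 2) ^+ 2 * (1 + K * sn K ((c - a) / 2) ^+ 2)).
  by rewrite -cs2_sn2 sn_half; ring.
have [K0|K0] := eqVneq K 0.
  have c1 e : cs K e = 1 by rewrite /cs K0 eqxx.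
  have Ka e : K * e = 0 by rewrite K0 mul0r.
  have sE e : sn K e = e by rewrite /sn K0 eqxx.
  by rewrite !c1 !sE; field.
rewrite tu// tv// mform_cover//.
move: hc; rewrite csD csN snN => hc.
have {}hc : sn K ((c - a) / 2) ^+ 2 = (cs K c * cs K a - K * sn K c * sn K a - 1) / (2 * K).
  rewrite -[cs K c * _ - _](_ : cs K c * cs K a + K * sn K c * - sn K a = _); last by ring.
  by rewrite hc; field; exact: K0.
rewrite hc.
transitivity ((cs K c ^+ 2 + cs K a ^+ 2) / K - 2 * cs K a * cs K c / K - sn K c ^+ 2
   - sn K a ^+ 2 - 2 * sn K a * sn K c * mform u v); first by field; exact: K0.
by rewrite !cs2_sn2; field; exact: K0.
Qed.

(** The hyperbolic cosine of the angle opposite to the side of length b. *)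
Definition angle_cosh a b c : R :=
  1 + 2 * (sn K ((c - a) / 2) ^+ 2 - sn K (b / 2) ^+ 2) / (sn K a * sn K c).

Lemma angle_cosh_ge1 a b c : 0 < a -> 0 <= b -> a + b <= c -> c <= rho K ->
  1 <= angle_cosh a b c.
Proof.
move=> a0 b0 abc cK; rewrite lerDl; apply: divr_ge0.
  rewrite mulr_ge0// subr_ge0 lerXn2r ?nnegrE ?sn_ge0 ?sn_le//; lra.
by rewrite mulr_ge0// sn_ge0//; lra.
Qed.

Definition time_sign d : R := if d is Future then 1 else -1.

Definition directed {T U : Type} d (r : T -> T -> U) (p q : T) : U :=
  match d with Future => r p q | Past => r q p end.

(** The reverse Cauchy-Schwarz inequality of the plane, for vectors with null
coordinates (A, B) and (C, D); unit vectors satisfy A B = C D = 1 / w^2. *)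
Lemma null_products (w A B C D uu vv uv : R) : 0 < w ->
  uu = - (w ^+ 2 / 2 * (A * B + B * A)) -> vv = - (w ^+ 2 / 2 * (C * D + D * C)) ->
  uv = - (w ^+ 2 / 2 * (A * D + B * C)) -> uu = - 1 -> vv = - 1 ->
  (uv < 0 -> 0 < A + B -> 0 < C + D) /\ (0 < (A + B) * (C + D) -> uv <= - 1).
Proof.
move=> w0 -> -> -> h1 h2.
have {w0} w0 : 0 < w ^+ 2 by rewrite exprn_gt0.
move: (w ^+ 2) w0 h1 h2 => {}w w0 h1 h2.
have AB : w * (A * B) = 1 by lra.
have CD : w * (C * D) = 1 by lra.
have AB0 : 0 < A * B by rewrite -(pmulr_rgt0 _ w0) AB.
have CD0 : 0 < C * D by rewrite -(pmulr_rgt0 _ w0) CD.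
have sgn (x y : R) : 0 < x * y -> 0 < x + y -> 0 < x /\ 0 < y.
  by move=> h h'; split; nra.
have sgn' (x y : R) : 0 < x * y -> x + y <= 0 -> x < 0 /\ y < 0.
  by move=> h h'; split; nra.
split=> [h h3|h].
  have [A0 B0] := sgn _ _ AB0 h3.
  rewrite ltNge; apply/negP => /(sgn' _ _ CD0)[C0 D0].
  move: h; rewrite oppr_lt0 pmulr_rgt0; last by rewrite divr_gt0.
  have : A * D < 0 by rewrite pmulr_rlt0.
  have : B * C < 0 by rewrite pmulr_rlt0.
  lra.
have AD0 : 0 < A * D /\ 0 < B * C.
  have [h3|h3] := ltP 0 (A + B).
    have [A0 B0] := sgn _ _ AB0 h3.
    have h4 : 0 < C + D by rewrite -(pmulr_rgt0 _ h3).
    have [C0 D0] := sgn _ _ CD0 h4.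
    by rewrite !mulr_gt0.
  have [A0 B0] := sgn' _ _ AB0 h3.
  have h4 : C + D <= 0 by nra.
  have [C0 D0] := sgn' _ _ CD0 h4.
  by rewrite !nmulr_rgt0.
move: AD0 => [AD0 BC0].
have ef : (w * (A * D)) * (w * (B * C)) = 1.
  by transitivity ((w * (A * B)) * (w * (C * D))); [ring|rewrite AB CD mulr1].
have e0 : 0 < w * (A * D) by rewrite mulr_gt0.
have f0 : 0 < w * (B * C) by rewrite mulr_gt0.
have -> : w / 2 * (A * D + B * C) = (w * (A * D) + w * (B * C)) / 2 by field.
move: (w * (A * D)) (w * (B * C)) ef e0 f0 => E F ef e0 f0.
have : 4 <= (E + F) ^+ 2 by have := sqr_ge0 (E - F); rewrite sqrrB sqrrD; lra.
rewrite lerN2 => h4; nra.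
Qed.

(** The conformal factors at the common base point agree, which leaves a
statement on null coordinates. *)
Lemma same_direction s s' u v : C1_curve s -> C1_curve s' -> s 0 = s' 0 ->
  velocity K s 0 = u -> velocity K s' 0 = v -> mform u u = - 1 -> mform v v = - 1 ->
  (mform u v < 0 -> 0 < dpcoord s 0 + dvcoord s 0 -> 0 < dpcoord s' 0 + dvcoord s' 0) /\
  (0 < (dpcoord s 0 + dvcoord s 0) * (dpcoord s' 0 + dvcoord s' 0) -> mform u v <= - 1).
Proof.
move=> c c' e <- <-; have h := mform_velocity c' c' (erefl (s' 0)).
have e' := congr1 conformal_factor e; rewrite -[conformal_factor (s' 0)]e' in h.
exact: (null_products (conformal_factor_gt0 (s 0)) (mform_velocity c c (erefl (s 0))) h
  (mform_velocity c c' e)).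
Qed.

(** A priori the length L of the geodesic is at most the time separation a. So L
is small enough for [model_tau_chord], which gives L = a. *)
Lemma model_side d p q u a : directed d (model_tau K) p q = a%:E -> 0 < a -> a <= rho K ->
  unit_initial_velocity p q u ->
  exists s, [/\ model_geodesic K s, s 0 = p, s a = q, velocity K s 0 = u &
    [/\ directed d null_le p q, in_strip p q & 0 < time_sign d * (dpcoord s 0 + dvcoord s 0)]].
Proof.
move=> tau_a a0 aK [u1 [s [L [L0 gs s0 sL uE]]]].
have v1 : mform (velocity K s 0) (velocity K s 0) = - 1 by rewrite -uE.
have tau0 : (0 < directed d (model_tau K) p q)%E by rewrite tau_a lte_fin.
have z : 0 <= (0 : R) <= L by rewrite lexx ltW.
have [La oL dir] : [/\ L <= a, directed d null_le p q &
    0 < time_sign d * (dpcoord s 0 + dvcoord s 0)].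
  have := unit_geodesic_path gs v1 (ltW L0); rewrite s0 sL.
  case: d tau_a tau0 => /= tau_a /tau_gt0_time pq [[h D]|[h D]].
  - rewrite -lee_fin -tau_a path_le_tau//; split; [by []|exact: path_null_le h|].
    by rewrite ?mul1r ?mulN1r ?oppr_gt0; exact: D.
  - by case: (path_time h) => [e|]; [rewrite e ltxx in pq|rewrite ltNge (ltW pq)].
  - by case: (path_time h) => [e|]; [rewrite e ltxx in pq|rewrite ltNge (ltW pq)].
  - rewrite -lee_fin -tau_a path_le_tau//; split; [by []|exact: path_null_le h|].
    by rewrite ?mul1r ?mulN1r ?oppr_gt0; exact: D.
have LK := le_trans La aK.
have [] := unit_geodesic_in_strip gs v1 (ltW L0) LK; rewrite s0 sL => ch n.
have aL : a = L.
  case: d tau_a oL {tau0 dir} => /= tau_a oL.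
    by have [_ + _] := model_tau_chord oL n (ltW L0) LK ch; rewrite tau_a => -[].
  rewrite chord2C in ch.
  by have [_ + _] := model_tau_chord oL (in_strip_sym n) (ltW L0) LK ch; rewrite tau_a => -[].
by exists s; rewrite aL.
Qed.

Lemma sn_half_inv (Q c : R) : 0 <= c -> 0 <= Q -> Q <= sn K (c / 2) ^+ 2 ->
  exists2 b, 0 <= b <= c & sn K (b / 2) ^+ 2 = Q.
Proof.
move=> c0 Q0 Qc.
have [||b] := @IVT R (fun b => sn K (b / 2) ^+ 2) 0 c Q c0.
- have d (x : R) : is_derive x 1 (fun b => sn K (b / 2) ^+ 2) (sn K (x / 2) * cs K (x / 2)).
    have := is_derive_sn K (x / 2) => ?.
    by apply: trigger_derive; rewrite /GRing.scale/=; field.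
  exact/continuous_subspaceT/(continuous_is_derive d).
- by rewrite mul0r sn0 expr0n/= ge_min Q0/= le_max Qc orbT.
- by rewrite in_itv/=; exists b.
Qed.

Lemma in_strip_subd d x y z : directed d null_le x y -> directed d null_le y z -> in_strip x z ->
  in_strip x y /\ in_strip y z.
Proof.
case: d => /= h1 h2; first exact: in_strip_sub.
by move=> /in_strip_sym/(in_strip_sub h2 h1)[n1 n2]; split; exact: in_strip_sym.
Qed.

(** The law of cosines computes the chord of the third side from the angle, and
this chord is that of a time separation b' <= c - a; necessarily b' = b. *)
Lemma triangle_angle d x y z u v a b c :
  directed d (model_tau K) x y = a%:E -> directed d (model_tau K) y z = b%:E ->
  directed d (model_tau K) x z = c%:E -> directed d (model_caus K) y z ->
  0 < a -> 0 <= b -> a + b <= c -> c <= rho K ->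
  unit_initial_velocity x y u -> unit_initial_velocity x z v ->
  - mform u v = angle_cosh a b c.
Proof.
move=> ta tb tc yz a0 b0 abc cK xu xv.
have aK : a <= rho K by lra.
have c0 : 0 < c by lra.
have [s [gs s0 sa su [oxy nxy ds]]] := model_side ta a0 aK xu.
have [s' [gs' s'0 s'c s'v [oxz nxz ds']]] := model_side tc c0 cK xv.
have oyz : directed d null_le y z by case: d yz {ta tb tc oxy ds oxz ds'} => /= -[l /path_null_le].
have [_ nyz] := in_strip_subd oxy oyz nxz.
have u1 := xu.1; have v1 := xv.1.
have uv : mform u v <= - 1.
  have ss : s 0 = s' 0 by rewrite s0 s'0.
  have [_ +] := same_direction gs.1 gs'.1 ss su s'v u1 v1; apply.
  have := mulr_gt0 ds ds'; rewrite mulrACA.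
  have -> : time_sign d * time_sign d = 1 by case: (d) => /=; ring.
  by rewrite mul1r.
have tu : tangent (cover K x) u by move=> K0; rewrite -su -s0 velocity_tangent//; exact: gs.1.
have tv : tangent (cover K x) v by move=> K0; rewrite -s'v -s'0 velocity_tangent//; exact: gs'.1.
have cy : cover K y = cs K a *: cover K x + sn K a *: u.
  by rewrite -sa (unit_geodesicE gs) ?su// s0.
have cz : cover K z = cs K c *: cover K x + sn K c *: v.
  by rewrite -s'c (unit_geodesicE gs') ?s'v// s'0.
have ch := chord2_cosines tu tv u1 v1 cy cz.
have sa0 : 0 < sn K a by rewrite sn_gt0.
have sc0 : 0 < sn K c by rewrite sn_gt0.
have sac : 0 < sn K a * sn K c by rewrite mulr_gt0.
have chle : chord2 y z <= 0.
  case: d oyz {ta tb tc oxy oxz yz ds ds'} => /= o; first exact: chord2_le0.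
  by rewrite chord2C chord2_le0//; exact: in_strip_sym.
have [|||b' /andP[b'0 b'c] b'E] := @sn_half_inv (- chord2 y z / 4) (c - a).
- by lra.
- by lra.
- rewrite ch ler_pdivrMr//; move: (mform u v) uv => m uv; nra.
have ch' : chord2 y z = - (4 * sn K (b' / 2) ^+ 2) by rewrite b'E; field.
have b'K : b' <= rho K by lra.
have bb' : b = b'.
  case: d tb oyz {ta tc oxy oxz yz ds ds'} => /= tb oyz.
    by have [_ + _] := model_tau_chord oyz nyz b'0 b'K ch'; rewrite tb => -[].
  rewrite chord2C in ch'.
  by have [_ + _] := model_tau_chord oyz (in_strip_sym nyz) b'0 b'K ch'; rewrite tb => -[].
rewrite /angle_cosh bb' b'E ch; field.
by rewrite !gt_eqF.
Qed.

(** The base point of all comparison triangles to be constructed is the origin of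
the plane, where an orthonormal frame can be written down. *)
Lemma origin_frame : exists e f : V3,
  [/\ tangent (cover K (0, 0)) e, tangent (cover K (0, 0)) f,
      mform e e = - 1, mform f f = 1 & mform e f = 0].
Proof.
have [K0|K0|K0] := ltgtP K 0.
- exists (vec 0 1 0), (vec 0 0 1); have eN : eps = -1 by rewrite /eps K0.
  have KN : K == 0 = false by rewrite lt_eqF.
  have h0 : hyp (0, 0) = 0 by rewrite /hyp K0.
  have a0 : ang (0, 0) = 0 by rewrite /ang K0.
  split; try move=> _; rewrite mformE !comp0_vec !comp1_vec !comp2_vec eN KN;
    rewrite ?cover_comp0 ?cover_comp1 ?cover_comp2 ?KN ?h0 ?a0 ?sin0 /sinh ?oppr0; ring.
- exists (vec 0 0 1), (vec 0 1 0).
  have eN : eps = 1 by rewrite /eps ltNge (ltW K0).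
  have KN : K == 0 = false by rewrite gt_eqF.
  have h0 : hyp (0, 0) = 0 by rewrite /hyp ltNge (ltW K0).
  have a0 : ang (0, 0) = 0 by rewrite /ang ltNge (ltW K0).
  split; try move=> _; rewrite mformE !comp0_vec !comp1_vec !comp2_vec eN KN;
    rewrite ?cover_comp0 ?cover_comp1 ?cover_comp2 ?KN ?h0 ?a0 ?sin0 /sinh ?oppr0; ring.
- exists (vec 0 0 1), (vec 1 0 0).
  have eN : eps = 1 by rewrite /eps K0 ltxx.
  split; try (by move=> /negP; case; apply/eqP);
    rewrite mformE !comp0_vec !comp1_vec !comp2_vec eN if_same; ring.
Qed.

(** In a frame u, f at the origin with u in the required time direction, the
second velocity is C u + S f with C^2 - S^2 = 1. *)
Lemma geodesic_pair d (C : R) : 1 <= C -> exists x u v s s',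
  [/\ tangent (cover K x) u, tangent (cover K x) v, mform u u = - 1, mform v v = - 1 &
    mform u v = - C] /\
  [/\ [/\ model_geodesic K s, s 0 = x & velocity K s 0 = u],
       [/\ model_geodesic K s', s' 0 = x & velocity K s' 0 = v],
       0 < time_sign d * (dpcoord s 0 + dvcoord s 0) &
       0 < time_sign d * (dpcoord s' 0 + dvcoord s' 0)].
Proof.
move=> C1; have [e [f [te tf ee ff ef]]] := origin_frame.
pose x : R * R := (0, 0); rewrite -/x in te tf.
pose S := Num.sqrt (C ^+ 2 - 1).
have S2 : S ^+ 2 = C ^+ 2 - 1 by rewrite sqr_sqrtr//; nra.
have [s0 [gs0 s00 v00 _]] := unit_geodesic_exists te ee.
have ne : mform (- e) (- e) = - 1 by rewrite mformNl mformNr opprK.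
have tne : tangent (cover K x) (- e) by move=> K0; rewrite mformNl te// oppr0.
have [s1 [gs1 s10 v10 _]] := unit_geodesic_exists tne ne.
(* one of e and - e has the required time direction *)
have [u [s [tu uu uf [gs sx su] ds]]] : exists u s, [/\ tangent (cover K x) u,
    mform u u = - 1, mform u f = 0, [/\ model_geodesic K s, s 0 = x & velocity K s 0 = u] &
    0 < time_sign d * (dpcoord s 0 + dvcoord s 0)].
  have unit s u : model_geodesic K s -> velocity K s 0 = u -> mform u u = - 1 ->
      dpcoord s 0 + dvcoord s 0 != 0.
    move=> gs su uu; have v1 : mform (velocity K s 0) (velocity K s 0) = - 1 by rewrite su.
    have z : 0 <= (0 : R) <= 0 by rewrite lexx.
    have [[_ /(_ 0 z)]|[_ /(_ 0 z)]] := unit_geodesic_path gs v1 (lexx 0).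
      by move=> h; rewrite gt_eqF.
    by move=> h; rewrite lt_eqF.
  have opp : (dpcoord s0 0 + dvcoord s0 0) * (dpcoord s1 0 + dvcoord s1 0) < 0.
    rewrite lt_neqAle mulf_neq0 ?(unit _ _ gs0 v00 ee) ?(unit _ _ gs1 v10 ne)//=.
    rewrite leNgt; apply/negP => h.
    have ss : s0 0 = s1 0 by rewrite s00 s10.
    have [_ /(_ h)] := same_direction gs0.1 gs1.1 ss v00 v10 ee ne.
    by rewrite mformNr ee opprK; lra.
  have nf : mform (- e) f = 0 by rewrite mformNl ef oppr0.
  have [h|h] := ltP 0 (time_sign d * (dpcoord s0 0 + dvcoord s0 0)).
    by exists e, s0.
  exists (- e), s1; split=> //; case: d h => /=; rewrite ?mul1r ?mulN1r => h; last first.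
    by rewrite oppr_gt0; rewrite oppr_le0 in h; nra.
  by nra.
pose v := C *: u + S *: f.
have vv : mform v v = - 1.
  rewrite /v mform_line mformZl mformZr mformZl uu uf ff.
  by rewrite S2; ring.
have uv : mform u v = - C by rewrite /v mformDr !mformZr uu uf; ring.
have tv : tangent (cover K x) v.
  by move=> K0; rewrite /v mformDl !mformZl tu// tf// !mulr0 addr0.
have [s' [gs' s'x s'v _]] := unit_geodesic_exists tv vv.
exists x, u, v, s, s'; split; split => //.
have ss : s 0 = s' 0 by rewrite sx s'x.
have u1 : mform (velocity K s' 0) (velocity K s' 0) = - 1 by rewrite s'v.
have neg : mform u v < 0 by rewrite uv oppr_lt0; lra.
case: d ds => /=; rewrite ?mul1r ?mulN1r => ds.
  by have [/(_ neg ds)] := same_direction gs.1 gs'.1 ss su s'v uu vv.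
rewrite oppr_gt0 ltNge; apply/negP; rewrite le_eqVlt => /orP[/eqP/esym z|h].
  have z0 : 0 <= (0 : R) <= 0 by rewrite lexx.
  by have [[_ /(_ 0 z0)]|[_ /(_ 0 z0)]] := unit_geodesic_path gs' u1 (lexx 0); rewrite z ltxx.
have neg' : mform v u < 0 by rewrite mformC.
have [/(_ neg' h)] := same_direction gs'.1 gs.1 (esym ss) s'v su vv uu.
by rewrite oppr_gt0 in ds; rewrite ltNge (ltW ds).
Qed.

(** * Comparison triangles *)

Lemma directed_tau_chord d p q T : directed d null_le p q -> in_strip p q ->
  0 <= T -> T <= rho K -> chord2 p q = - (4 * sn K (T / 2) ^+ 2) ->
  [/\ directed d (fun p q => causal_path K p q T) p q, directed d (model_caus K) p q,
      directed d (model_tau K) p q = T%:E & directed d (model_tau K) q p = 0%E].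
Proof.
case: d => /= o n T0 TK ch.
  by have [] := model_tau_chord o n T0 TK ch; split => //; exact: chord_path.
move/in_strip_sym in n; rewrite chord2C in ch.
by have [] := model_tau_chord o n T0 TK ch; split => //; exact: chord_path.
Qed.

Lemma geodesic_side d s T : model_geodesic K s ->
  mform (velocity K s 0) (velocity K s 0) = - 1 ->
  0 < time_sign d * (dpcoord s 0 + dvcoord s 0) ->
  0 <= T -> T <= rho K -> directed d null_le (s 0) (s T).
Proof.
move=> gs v1 + T0 TK; have z : 0 <= (0 : R) <= T by rewrite lexx.
case: d => /=; rewrite ?mul1r ?mulN1r ?oppr_gt0 => D;
  have [[h /(_ 0 z) D']|[h /(_ 0 z) D']] := unit_geodesic_path gs v1 T0.
- exact: path_null_le h.
- by have := lt_trans D D'; rewrite ltxx.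
- by have := lt_trans D D'; rewrite ltxx.
- exact: path_null_le h.
Qed.

Lemma in_strip_not_far d x y z : directed d null_le x y -> directed d null_le x z ->
  in_strip x y -> in_strip x z -> K != 0 ->
  `|pcoord z - pcoord y| < 2 * pi /\ `|vcoord z - vcoord y| < 2 * pi.
Proof.
move=> oy oz ny nz K0; have [+ +] := in_strip_lt ny K0; have [+ +] := in_strip_lt nz K0.
by case: d oy oz => /= -[? ?] [? ?]; rewrite !ltr_norml => /andP[? ?] /andP[? ?]
  /andP[? ?] /andP[? ?]; split; apply/andP; split; lra.
Qed.

(** Two geodesics of lengths a and c are chosen whose angle is that of the law of
cosines. The chord of their end points is then right; it remains to see that
these end points are ordered in the required way. *)
Lemma triangle_exists d a b c : 0 < a -> 0 <= b -> a + b <= c -> c <= rho K ->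
  exists x y z u v,
  [/\ @unit_initial_velocity _ K x y u, @unit_initial_velocity _ K x z v & a = c -> y = z] /\
  [/\ [/\ directed d (model_caus K) x y, directed d (model_tau K) x y = a%:E &
          directed d (model_tau K) y x = 0%E],
      [/\ directed d (model_caus K) y z, directed d (model_tau K) y z = b%:E &
          directed d (model_tau K) z y = 0%E] &
      [/\ directed d (model_caus K) x z, directed d (model_tau K) x z = c%:E &
          directed d (model_tau K) z x = 0%E]].
Proof.
move=> a0 b0 abc cK.
have aK : a <= rho K by lra.
have bK : b <= rho K by lra.
have c0 : 0 < c by lra.
have acb : a = c -> b = 0 by move=> ac; lra.
have acl : a <= c by lra.
have ccb : c <= c + b by lra.
have [x [u [v [s [s' [[tu tv uu vv uv] [[gs sx su] [gs' s'x s'v] ds ds']]]]]]] :=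
  geodesic_pair d (angle_cosh_ge1 a0 b0 abc cK).
have v1 : mform (velocity K s 0) (velocity K s 0) = - 1 by rewrite su.
have v1' : mform (velocity K s' 0) (velocity K s' 0) = - 1 by rewrite s'v.
have oy := geodesic_side gs v1 ds (ltW a0) aK.
have oz := geodesic_side gs' v1' ds' (ltW c0) cK.
have [chy ny] := unit_geodesic_in_strip gs v1 (ltW a0) aK.
have [chz nz] := unit_geodesic_in_strip gs' v1' (ltW c0) cK.
rewrite sx in oy chy ny; rewrite s'x in oz chz nz.
have [py cy ty ty'] := directed_tau_chord oy ny (ltW a0) aK chy.
have [pz cz tz tz'] := directed_tau_chord oz nz (ltW c0) cK chz.
have iu : unit_initial_velocity x (s a) u by split=> //; exists s, a.
have iv : unit_initial_velocity x (s' c) v by split=> //; exists s', c.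
have [ac|ac] := eqVneq a c.
  have b00 := acb ac.
  exists x, (s a), (s a), u, u; split; first by split.
  have o : directed d null_le (s a) (s a) by case: (d); exact: null_le_refl.
  have [|_ cyy tyy tyy'] := directed_tau_chord o (in_strip_refl (s a)) (lexx 0) (ltW (rho_gt0 K)).
    by rewrite chord2pp mul0r sn0 expr0n/= mulr0 oppr0.
  by split; rewrite -?ac ?b00.
have {}ac : a < c by rewrite lt_neqAle ac.
exists x, (s a), (s' c), u, v; split.
  by split => // e; rewrite e ltxx in ac.
have sa0 : 0 < sn K a by rewrite sn_gt0.
have sc0 : 0 < sn K c by rewrite sn_gt0.
have ch : chord2 (s a) (s' c) = - (4 * sn K (b / 2) ^+ 2).
  have ey : cover K (s a) = cs K a *: cover K x + sn K a *: u.
    by rewrite (unit_geodesicE gs v1) su sx.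
  have ez : cover K (s' c) = cs K c *: cover K x + sn K c *: v.
    by rewrite (unit_geodesicE gs' v1') s'v s'x.
  rewrite (chord2_cosines tu tv uu vv ey ez) uv /angle_cosh; field.
  by rewrite !gt_eqF.
have far := in_strip_not_far oy oz ny nz.
have ch0 : chord2 (s a) (s' c) <= 0 by rewrite ch oppr_le0 mulr_ge0// sqr_ge0.
have [oyz|ozy] : directed d null_le (s a) (s' c) \/ directed d null_le (s' c) (s a).
  have := chord2_le0_null_le far ch0.
  by case: (d) => /= -[]; [left|right|right|left].
  have [_ n] := in_strip_subd oy oyz nz.
  have [_ cyz tyz tyz'] := directed_tau_chord oyz n b0 bK ch.
  by split.
(* otherwise the side from x to y would be longer than that to z *)
exfalso; have [_ n] := in_strip_subd oz ozy ny.
rewrite chord2C in ch.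
have [pzy _ _ _] := directed_tau_chord ozy n b0 bK ch.
suff : (c%:E <= a%:E)%E by rewrite lee_fin leNgt ac.
rewrite -ty; apply: (@le_trans _ _ (c + b)%:E); first by rewrite lee_fin.
case: (d) pz pzy => /= pz pzy; apply: path_le_tau; first exact: path_trans pz pzy.
by rewrite addrC; exact: path_trans pzy pz.
Qed.

Variable X : lorentzPreLength R.

Lemma same_relationP d (p q : X) (p' q' : R * R) :
  same_relation K p q p' q' <->
  [/\ directed d (@caus R X) p q -> directed d (model_caus K) p' q',
      directed d (@caus R X) q p -> directed d (model_caus K) q' p',
      directed d (model_tau K) p' q' = directed d (@tau R X) p q &
      directed d (model_tau K) q' p' = directed d (@tau R X) q p].
Proof. by case: d; split => -[] *; split. Qed.

Lemma comparison_angleC (x y z : X) : comparison_angle K x y z = comparison_angle K x z y.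
Proof.
rewrite /comparison_angle; congr xget; apply/funext => th; apply/propext.
suff H (y' z' : X) : is_comparison_angle K x y' z' th -> is_comparison_angle K x z' y' th.
  by split; exact: H.
move=> [p [q [r [u [v [[h1 h2 h3] hu hv e]]]]]].
exists p, r, q, v, u; split => //; last by rewrite mformC.
by split => //; case: h2 => *; split.
Qed.

Lemma chain_reverse_triangle d (x y z : X) : directed d (@caus R X) x y ->
  directed d (@caus R X) y z ->
  (directed d (@tau R X) x y + directed d (@tau R X) y z <= directed d (@tau R X) x z)%E.
Proof.
case: d => /= xy yz; first exact: tau_reverse_triangle.
by rewrite addeC; exact: tau_reverse_triangle.
Qed.

Lemma directed_tau_ge0 d (x y : X) : (0 <= directed d (@tau R X) x y)%E.
Proof. by case: d; exact: tau_ge0. Qed.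

Lemma directed_tau_gt0 d (x y : X) :
  (0 < directed d (@tau R X) x y)%E <-> directed d (@chron R X) x y.
Proof. by case: d; exact: tau_gt0. Qed.

Lemma directed_chron_caus d (x y : X) :
  directed d (@chron R X) x y -> directed d (@caus R X) x y.
Proof. by case: d; exact: chron_caus. Qed.

(** A loop of positive length at y could be appended to the chain from x to y and
would contradict the reverse triangle inequality. *)
Lemma no_loop d (x y : X) (t : R) : directed d (@tau R X) x y = t%:E ->
  directed d (@caus R X) x y -> directed d (@tau R X) y y = 0%E.
Proof.
move=> e c; have cyy : directed d (@caus R X) y y by case: (d); exact: caus_refl.
have := chain_reverse_triangle c cyy; rewrite e.
have := directed_tau_ge0 d y y; case: (directed d _ y y) => [r| |]//=.
by rewrite lee_fin -EFinD lee_fin => r0 h; congr EFin; lra.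
Qed.

Lemma no_loop_start d (x y : X) (t : R) : directed d (@tau R X) x y = t%:E ->
  directed d (@caus R X) x y -> directed d (@tau R X) x x = 0%E.
Proof.
move=> e c; have cxx : directed d (@caus R X) x x by case: (d); exact: caus_refl.
have := chain_reverse_triangle cxx c; rewrite e.
have := directed_tau_ge0 d x x; case: (directed d _ x x) => [r| |]//=.
by rewrite lee_fin -EFinD lee_fin => r0 h; congr EFin; lra.
Qed.

Lemma no_return d (x y : X) : directed d (@tau R X) x x = 0%E ->
  directed d (@chron R X) x y -> ~ directed d (@caus R X) y x.
Proof.
move=> xx /[dup] /directed_tau_gt0 h /directed_chron_caus c c'.
have := chain_reverse_triangle c c'; rewrite xx.
have := directed_tau_ge0 d y x => h'.
by rewrite leNgt lte_paddr.
Qed.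

(** Finite time separations exclude causal loops, so all relations among the three
points are known and the triangle of [triangle_exists] is a comparison
triangle; [triangle_angle] shows that every other one has the same angle. *)
Lemma comparison_angleE d (x y z : X) a b c : directed d (@chron R X) x y ->
  directed d (@chron R X) x z -> directed d (@caus R X) y z ->
  directed d (@tau R X) x y = a%:E -> directed d (@tau R X) y z = b%:E ->
  directed d (@tau R X) x z = c%:E -> c <= rho K ->
  [/\ 0 < a, 0 <= b, a + b <= c & comparison_angle K x y z = arcosh (angle_cosh a b c)].
Proof.
move=> xy xz yz ta tb tc cK.
have cxy := directed_chron_caus xy; have cxz := directed_chron_caus xz.
have a0 : 0 < a by have := (directed_tau_gt0 d x y).2 xy; rewrite ta lte_fin.
have b0 : 0 <= b by have := directed_tau_ge0 d y z; rewrite tb lee_fin.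
have abc : a + b <= c.
  by have := chain_reverse_triangle cxy yz; rewrite ta tb tc -EFinD lee_fin.
have xx := no_loop_start ta cxy; have zz := no_loop tc cxz.
have tau0 (p q : X) : ~ directed d (@chron R X) p q -> directed d (@tau R X) p q = 0%E.
  move=> h; apply/eqP; rewrite eq_le directed_tau_ge0 andbT leNgt.
  by apply/negP => /directed_tau_gt0.
have nyx : ~ directed d (@caus R X) y x by exact: no_return.
have nzx : ~ directed d (@caus R X) z x by exact: no_return.
have tyx : directed d (@tau R X) y x = 0%E by apply: tau0 => /directed_chron_caus.
have tzx : directed d (@tau R X) z x = 0%E by apply: tau0 => /directed_chron_caus.
have tzy : directed d (@tau R X) z y = 0%E.
  by apply: tau0 => h; exact: (no_return zz h).
split => //; apply: xget_unique.
  have [x' [y' [z' [u [v [[iu iv ac] [[h1 h2 h3] [h4 h5 h6] [h7 h8 h9]]]]]]]] :=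
    triangle_exists d a0 b0 abc cK.
  exists x', y', z', u, v; split => //.
    split; apply/(same_relationP d); split; rewrite ?h2 ?h3 ?h5 ?h6 ?h8 ?h9//.
      by move=> zy; have := chain_reverse_triangle cxz zy; rewrite tc tzy ta adde0 lee_fin => ca;
        rewrite ac; [case: (d); exists 0; exact: causal_path_refl|lra].
  have e := triangle_angle h2 h5 h8 h4 a0 b0 abc cK iu iv.
  by rewrite -normrN e ger0_norm// (le_trans ler01)// angle_cosh_ge1.
move=> th [x' [y' [z' [u [v [[r1 r2 r3] iu iv ->]]]]]].
have [_ _ h2 _] := (same_relationP d _ _ _ _).1 r1.
have [h4 _ h5 _] := (same_relationP d _ _ _ _).1 r2.
have [_ _ h8 _] := (same_relationP d _ _ _ _).1 r3.
rewrite ta in h2; rewrite tb in h5; rewrite tc in h8.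
have e := triangle_angle h2 h5 h8 (h4 yz) a0 b0 abc cK iu iv.
by rewrite -normrN e ger0_norm// (le_trans ler01)// angle_cosh_ge1.
Qed.

End model_plane.

(** * The law of cosines on a small scale *)

Section small_angles.
Variable R : realType.
Implicit Types (K a b c e x : R).

Lemma sn_ratio K e : 0 < e -> exists2 d, 0 < d &
  forall x, 0 <= x -> x < d -> sn K x <= (1 + e) * x /\ x <= (1 + e) * sn K x.
Proof.
move=> e0; pose e1 := Num.min (e / 2) (1 / 2).
have e10 : 0 < e1 by rewrite lt_min !divr_gt0.
have e1e : e1 <= e / 2 by rewrite ge_min lexx.
have e1h : e1 <= 1 / 2 by rewrite ge_min lexx orbT.
have [d d0 h] := sn_near K e10; exists d => // x x0 xd.
have /andP[h1 h2] := h x x0 xd.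
by split; [nra|have : 0 <= sn K x by nra]; nra.
Qed.

(** A product, unlike a difference of squares, is controlled by relative errors. *)
Lemma angle_coshE K a b c : angle_cosh K a b c =
  1 + 2 * (sn K ((c - a + b) / 2) * sn K ((c - a - b) / 2)) / (sn K a * sn K c).
Proof.
rewrite /angle_cosh -sn_mul; congr (1 + 2 * (sn K _ * sn K _) / _); lra.
Qed.

Lemma angle_cosh_ratio K e : 0 < e -> exists2 d, 0 < d & forall a b c,
  0 < a -> 0 <= b -> a + b <= c -> c < d ->
  let q := 2 * ((c - a + b) / 2 * ((c - a - b) / 2)) / (a * c) in
  [/\ 0 <= q, angle_cosh K a b c - 1 <= (1 + e) ^+ 4 * q &
      q <= (1 + e) ^+ 4 * (angle_cosh K a b c - 1)].
Proof.
move=> e0; have [d d0 h] := sn_ratio K e0.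
exists (Num.min d (rho K)) => [|a b c a0 b0 abc]; first by rewrite lt_min d0 rho_gt0.
rewrite lt_min => /andP[cd cr] q; rewrite angle_coshE addrAC subrr add0r.
rewrite /q {q}; set m := (c - a + b) / 2; set n := (c - a - b) / 2.
have c0 : 0 < c by lra.
have m0 : 0 <= m by rewrite divr_ge0//; lra.
have n0 : 0 <= n by rewrite divr_ge0//; lra.
have mc : m <= c by rewrite ler_pdivrMr//; lra.
have nc : n <= c by rewrite ler_pdivrMr//; lra.
have ac : a <= c by lra.
have [m1 m2] := h m m0 (le_lt_trans mc cd).
have [n1 n2] := h n n0 (le_lt_trans nc cd).
have [a1 a2] := h a (ltW a0) (le_lt_trans ac cd).
have [c1 c2] := h c (ltW c0) cd.
have sm := sn_ge0 m0 (le_trans mc (ltW cr)).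
have sn_ := sn_ge0 n0 (le_trans nc (ltW cr)).
have sa := sn_gt0 a0 (le_trans ac (ltW cr)).
have sc := sn_gt0 c0 (ltW cr).
have e1 : 0 <= 1 + e by lra.
have mul (x y x' y' : R) : 0 <= x -> 0 <= y -> x <= (1 + e) * x' -> y <= (1 + e) * y' ->
    x * y <= (1 + e) ^+ 2 * (x' * y').
  by move=> x0 y0 hx hy; rewrite (le_trans (ler_pM x0 y0 hx hy))// expr2 mulrACA.
have div (x y x' y' : R) : 0 < y -> 0 < y' -> 0 <= x' -> x <= (1 + e) ^+ 2 * x' ->
    y' <= (1 + e) ^+ 2 * y -> 2 * x / y <= (1 + e) ^+ 4 * (2 * x' / y').
  move=> y0 y'0 x0 hx hy; rewrite ler_pdivrMr// mulrA mulrAC ler_pdivlMr//.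
  have := ler_wpM2r (ltW y'0) hx.
  have f0 : 0 <= (1 + e) ^+ 2 * x' by rewrite mulr_ge0 ?exprn_ge0.
  have := ler_wpM2l f0 hy.
  have -> : (1 + e) ^+ 4 = (1 + e) ^+ 2 * (1 + e) ^+ 2 by ring.
  move: ((1 + e) ^+ 2) => f; lra.
have ac0 : 0 < a * c by rewrite mulr_gt0.
have sac0 : 0 < sn K a * sn K c by rewrite mulr_gt0.
have mn0 : 0 <= m * n by rewrite mulr_ge0.
have smn0 : 0 <= sn K m * sn K n by rewrite mulr_ge0.
split.
- by rewrite divr_ge0 ?(ltW ac0)// mulr_ge0.
- by apply: div => //; apply: mul => //; exact: ltW.
- by apply: div => //; apply: mul => //; exact: ltW.
Qed.

(** Both hyperbolic cosines exceed 1 by almost the same quantity q, up to factors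
close to 1. Since arcosh turns products into at most sums, this bounds the
difference of the angles, even where these are large. *)
Lemma small_angle_le K K' e : 0 < e -> exists2 d, 0 < d & forall a b c,
  0 < a -> 0 <= b -> a + b <= c -> c < d ->
  arcosh (angle_cosh K a b c) <= arcosh (angle_cosh K' a b c) + e.
Proof.
move=> e0; have [h h0 he] := arcosh_small e0.
(* (1 + f)^8 <= 1 + 255 f for f <= 1 *)
pose f := Num.min 1 (h / 255).
have f0 : 0 < f by rewrite lt_min ltr01 divr_gt0.
have f1 : f <= 1 by rewrite ge_min lexx.
have fh : f <= h / 255 by rewrite ge_min lexx orbT.
have f8 : (1 + f) ^+ 4 * (1 + f) ^+ 4 <= 1 + h.
  have f2 : (1 + f) ^+ 2 <= 1 + 3 * f by nra.
  have f4 : (1 + f) ^+ 4 <= 1 + 15 * f.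
    have : 0 <= (1 + f) ^+ 2 by rewrite exprn_ge0// addr_ge0// ltW.
    have -> : (1 + f) ^+ 4 = ((1 + f) ^+ 2) ^+ 2 by ring.
    by move: f2; move: (_ ^+ 2) => w; nra.
  have : 0 <= (1 + f) ^+ 4 by rewrite exprn_ge0// addr_ge0// ltW.
  by move: f4; move: (_ ^+ 4) => w; nra.
have [d d0 hd] := angle_cosh_ratio K f0.
have [d' d'0 hd'] := angle_cosh_ratio K' f0.
exists (Num.min (Num.min d d') (Num.min (rho K) (rho K'))).
  by rewrite !lt_min d0 d'0 !rho_gt0.
move=> a b c a0 b0 abc; rewrite !lt_min => /andP[/andP[cd cd'] /andP[cr cr']].
have [q0 h1 _] := hd a b c a0 b0 abc cd.
have [_ _ h2] := hd' a b c a0 b0 abc cd'.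
have g1 := angle_cosh_ge1 a0 b0 abc (ltW cr).
have g1' := angle_cosh_ge1 a0 b0 abc (ltW cr').
have w0 : 0 <= (1 + f) ^+ 4 by rewrite exprn_ge0// addr_ge0// ltW.
have h1' : 1 <= 1 + h by lra.
apply: (@le_trans _ _ (arcosh ((1 + h) * angle_cosh K' a b c))).
  apply: arcosh_le => //; move: q0 h1 h2 f8 w0 g1 g1'.
  move: (2 * _ / _) (_ ^+ 4) (angle_cosh K a b c) (angle_cosh K' a b c).
  move=> q w x y q0 h1 h2 f8 w0 x1 y1.
  have := ler_wpM2l w0 h2; have : 0 <= y - 1 by lra.
  by nra.
by rewrite (le_trans (arcoshM h1' g1'))// addrC lerD2l.
Qed.

Lemma continuous_arcosh x : 1 <= x -> {for x, continuous (@arcosh R)}.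
Proof.
move=> x1; apply: (continuous_comp (f := fun x => x + Num.sqrt (x ^+ 2 - 1))).
  apply: continuousD => //; apply: (continuous_comp (f := fun x => x ^+ 2 - 1)).
    apply: continuousB; [exact: exprn_continuous|exact: cst_continuous].
  exact: sqrt_continuous.
by apply: continuous_ln; rewrite ltr_pwDl ?sqrtr_ge0//; lra.
Qed.

(** Arcosh is continuous on the closed half-line, hence also at degenerate
triangles. *)
Lemma cvg_angle K a b c (fb fc : R -> R) (F : set_system R) : ProperFilter F ->
  0 < a -> 0 <= b -> a + b <= c -> c <= rho K ->
  fb @ F --> b -> fc @ F --> c ->
  arcosh (angle_cosh K a (fb h) (fc h)) @[h --> F] --> arcosh (angle_cosh K a b c).
Proof.
move=> FF a0 b0 abc cr hb hc.
apply: (@continuous_cvg _ _ _ F _ (fun h => angle_cosh K a (fb h) (fc h)) (@arcosh R)).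
  by apply: continuous_arcosh; exact: angle_cosh_ge1.
have cs_ (g : R -> R) (l : R) : g @ F --> l -> sn K (g h) @[h --> F] --> sn K l.
  by move=> gl; apply: continuous_cvg => //; exact: continuous_sn.
have sq (g : R -> R) (l : R) : g @ F --> l -> sn K (g h / 2) ^+ 2 @[h --> F] --> sn K (l / 2) ^+ 2.
  move=> gl; apply: (@continuous_cvg _ _ _ F _ (fun h => sn K (g h / 2)) (fun x => x ^+ 2)); first exact: exprn_continuous.
  by apply: cs_; apply: cvgMl; exact: gl.
apply: cvgD; first exact: cvg_cst.
apply: cvgM.
  apply: cvgMr; apply: cvgB; apply: sq => //.
  by apply: cvgB => //; exact: cvg_cst.
apply: cvgV.
  by rewrite mulf_neq0// gt_eqF// sn_gt0//; lra.
by apply: cvgM; [exact: cvg_cst|exact: cs_].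
Qed.

End small_angles.

(** * Segments of distance realizers *)

Section realizers.
Variables (R : realType) (X : lorentzPreLength R).
Implicit Types (g : R -> X) (a b c : R) (s : seq R) (p q x y z : X) (U : set X).

Fixpoint chain_tau g a s : \bar R :=
  if s is t :: s' then (tau (g a) (g t) + chain_tau g t s')%E else 0%E.

Lemma tau_lengthE a b g : tau_length a b g = ereal_inf (chain_tau g a @` itv_partition a b).
Proof.
rewrite /tau_length; congr ereal_inf; apply: eq_imagel => s _.
elim: s a => [|t s IH] a /=; first by rewrite big_ord0.
by rewrite big_ord_recl; congr (_ + _)%E; exact: IH.
Qed.

Lemma chain_tau_rcons g a s c :
  chain_tau g a (rcons s c) = (chain_tau g a s + tau (g (last a s)) (g c))%E.
Proof. elim: s a => [|t s IH] a /=; first by rewrite adde0 add0e.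
by rewrite IH addeA. Qed.

Lemma tau_length_le a b g : a < b -> (tau_length a b g <= tau (g a) (g b))%E.
Proof.
move=> ab; rewrite tau_lengthE; apply: ereal_inf_lbound.
by exists [:: b]; [exact: itv_partition1|rewrite /= adde0].
Qed.

Lemma fin_addeK (u v w : \bar R) : (0 <= w)%E -> (w < +oo)%E -> (u + w <= v + w)%E -> (u <= v)%E.
Proof. by case: w => [w| |]// _ _; rewrite leeD2rE. Qed.

Lemma causal_curve_sub g a b c e : a <= c -> e <= b -> nonconstant `[c, e] g ->
  causal_curve Future `[a, b] g -> causal_curve Future `[c, e] g.
Proof.
move=> ac eb nc [lip _ cau].
have sub t : `[c, e]%classic t -> `[a, b]%classic t.
  by rewrite /= !in_itv/= => /andP[ct te]; rewrite (le_trans ac)// (le_trans te).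
split => //.
- move=> t /sub /lip [V Vt [C h]]; exists V => //; exists C => u v [Vu /sub u1] [Vv /sub v1].
  exact: h.
- by move=> u v /sub u1 /sub v1; exact: cau.
Qed.

(** If an initial segment were shorter than the time separation of its end points, so
would be the whole curve, by the reverse triangle inequality. *)
Lemma realizer_initial g a b c : future_realizer a b g -> (tau (g a) (g b) < +oo)%E ->
  a < c -> c <= b -> nonconstant `[a, c] g -> future_realizer a c g.
Proof.
move=> [ab cau len] fin ac cb nc; split => //; first exact: (causal_curve_sub _ _ nc cau).
apply/eqP; rewrite eq_le tau_length_le//= tau_lengthE.
apply: le_ereal_inf_tmp => _ [s [ps /eqP ls] <-].
have [cb'|cb'] := eqVneq c b.
  rewrite cb' -len tau_lengthE; apply: ereal_inf_lbound; exists s => //.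
  by split => //; rewrite ls cb'.
have {cb}cb : c < b by rewrite lt_neqAle cb'.
have [_ _ r] := cau.
have I t : a <= t -> t <= b -> `[a, b]%classic t by rewrite /= in_itv/= => -> ->.
have ac' : caus (g a) (g c) by apply: r => //; apply: I => //; exact: ltW.
have cb'' : caus (g c) (g b) by apply: r => //; apply: I => //; exact: ltW.
have tri := tau_reverse_triangle ac' cb''.
apply: (@fin_addeK _ _ (tau (g c) (g b))); first exact: tau_ge0.
  by rewrite (le_lt_trans _ fin)// (le_trans _ tri)// leeDr ?tau_ge0.
rewrite (le_trans tri)// -len tau_lengthE.
have -> : (chain_tau g a s + tau (g c) (g b))%E = chain_tau g a (rcons s b).
  by rewrite chain_tau_rcons ls.
apply: ereal_inf_lbound; exists (rcons s b) => //.
by split; rewrite ?rcons_path ?last_rcons// ps ls.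
Qed.

Lemma realizer_final g a b c : future_realizer a b g -> (tau (g a) (g b) < +oo)%E ->
  a <= c -> c < b -> nonconstant `[c, b] g -> future_realizer c b g.
Proof.
move=> [ab cau len] fin ac cb nc; split => //; first exact: (causal_curve_sub _ _ nc cau).
apply/eqP; rewrite eq_le tau_length_le//= tau_lengthE.
apply: le_ereal_inf_tmp => _ [s [ps /eqP ls] <-].
have [ca|ca] := eqVneq a c.
  by rewrite -ca -len tau_lengthE; apply: ereal_inf_lbound; exists s => //; rewrite ca; split => //; rewrite ls.
have {ac}ac : a < c by rewrite lt_neqAle ca.
have [_ _ r] := cau.
have I t : a <= t -> t <= b -> `[a, b]%classic t by rewrite /= in_itv/= => -> ->.
have ac' : caus (g a) (g c) by apply: r => //; apply: I => //; exact: ltW.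
have cb'' : caus (g c) (g b) by apply: r => //; apply: I => //; exact: ltW.
have tri := tau_reverse_triangle ac' cb''.
apply: (@fin_addeK _ _ (tau (g a) (g c))); first exact: tau_ge0.
  by rewrite (le_lt_trans _ fin)// (le_trans _ tri)// leeDl ?tau_ge0.
rewrite addeC (le_trans tri)// addeC -len tau_lengthE.
apply: ereal_inf_lbound; exists (c :: s) => //.
by split => /=; rewrite ?ac ?ps ?ls.
Qed.

(** Curves are total functions, of which only the values on the interval matter;
this is their continuity. *)
Lemma lipschitz_near (I : set R) g t (W : set X) : locally_lipschitz I g -> I t ->
  nbhs (g t) W -> \forall u \near t, I u -> W (g u).
Proof.
move=> lip It /nbhs_ballP[e /= e0 eW].
have [V Vt [C h]] := lip t It.
have C0 : 0 < `|C| + 1 by rewrite ltr_wpDl.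
near=> u => Iu; apply: eW; rewrite ballEmdist /=.
have Vu : V u by near: u.
have Vt' : V t by exact: nbhs_singleton.
apply: le_lt_trans (h t u (conj Vt' It) (conj Vu Iu)) _.
have : `|t - u| < e / (`|C| + 1) by near: u; apply: cvgr_dist_lt; rewrite ?divr_gt0.
rewrite ltr_pdivlMr//; have := ler_norm C; have := normr_ge0 (t - u); nra.
Unshelve. all: by end_near.
Qed.

(** A causal curve in a space with locally finite time separation has finite
length, because it is covered by finitely many of the neighbourhoods. *)
Lemma causal_curve_finite g a b : a < b ->
  (forall p, exists2 U : set X, nbhs p U & forall x y, U x -> U y -> (tau x y < +oo)%E) ->
  locally_lipschitz `[a, b] g -> (tau_length a b g < +oo)%E.
Proof.
move=> ab fin lip.
pose P t := t = a \/ exists2 s, itv_partition a t s & (chain_tau g a s < +oo)%E.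
pose S := [set t | a <= t <= b /\ P t].
have step t u : P t -> t < u -> (tau (g t) (g u) < +oo)%E -> P u.
  move=> [->|[s [ps /eqP ls] hs]] tu h; right.
    by exists [:: u]; [exact: itv_partition1|rewrite /= adde0].
  exists (rcons s u); first by split; rewrite ?rcons_path ?last_rcons// ps ls.
  by rewrite chain_tau_rcons ls lte_add_pinfty.
have Sa : S a by split; [rewrite lexx ltW|left].
have ubS : ubound S b by move=> t [/andP[]].
have supS : has_sup S by split; [exists a|exists b].
(* the length is finite up to m; if m < b, a neighbourhood of g m extends this *)
set m := sup S.
have mb : m <= b by apply: ge_sup => //; exists a.
have am : a <= m by apply: ub_le_sup => //; exists b.
have [U Um hU] := fin (g m).
have Im : `[a, b]%classic m by rewrite /= in_itv/= am.
have /nbhs_ballP[e /= e0 he] := lipschitz_near lip Im Um.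
have {}he u : `|m - u| < e -> a <= u <= b -> U (g u).
  by move=> h1 h2; apply: he => //; rewrite /= in_itv.
have [t [tab Pt] mt] := sup_adherent e0 supS.
have tm : t <= m by apply: ub_le_sup => //; exists b.
have Ut : U (g t) by apply: he => //; rewrite ger0_norm ?subr_ge0//; move: mt; rewrite -/m; lra.
have ext u : t <= u -> u <= b -> u < m + e -> P u.
  move=> tu ub ue; have [<-//|ne] := eqVneq t u.
  apply: (step t) => //; first by rewrite lt_neqAle ne.
  apply: hU => //; apply: he; last by rewrite ub andbT; case/andP: tab => ? _; lra.
  by rewrite ltr_norml; apply/andP; split; move: mt; rewrite -/m; lra.
have mE : m = b.
  apply/eqP; rewrite eq_le mb/=; rewrite leNgt; apply/negP => ltmb.
  pose u := Num.min b (m + e / 2).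
  have um : m < u by rewrite lt_min ltmb/=; lra.
  have ub : u <= b by rewrite ge_min lexx.
  have ue : u <= m + e / 2 by rewrite ge_min lexx orbT.
  have : S u by split; [apply/andP; split; lra|apply: ext; lra].
  by move/(ub_le_sup (ex_intro _ b ubS)); rewrite -/m; lra.
have [ba|[s ps hs]] : P b by apply: ext; rewrite -?mE//; lra.
  by rewrite ba ltxx in ab.
by rewrite tau_lengthE (le_lt_trans _ hs)//; apply: ereal_inf_lbound; exists s.
Qed.

End realizers.

(** * Initial pieces of timelike geodesics *)

Section short_geodesics.
Variables (R : realType) (X : lorentzPreLength R).
Implicit Types (g : R -> X) (a b c s t e m : R) (p q x y z : X) (U W : set X) (d : time_dir).

Lemma tau_diag x : (tau x x < +oo)%E -> tau x x = 0%E.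
Proof.
have := tau_reverse_triangle (caus_refl x) (caus_refl x); have := tau_ge0 x x.
by case: (tau x x) => // r; rewrite -EFinD !lee_fin => ? ? _; congr EFin; lra.
Qed.

Lemma chron_irrefl x : (tau x x < +oo)%E -> ~ chron x x.
Proof. by move=> /tau_diag xx /tau_gt0; rewrite xx ltxx. Qed.

Definition directed_side d (S : set X) := directed d (fun p q => side p q S).

(** Near 0 a geodesic is a realizer on some interval [0, e]. Cutting that interval
gives the sides; in the past case the curve is reversed and the final segment is
kept. *)
Lemma geodesic_initial_sides d g b : 0 < b -> timelike_geodesic d 0 b g ->
  (forall p, exists2 U : set X, nbhs p U & forall x y, U x -> U y -> (tau x y < +oo)%E) ->
  exists2 e, 0 < e <= b & forall s, 0 < s -> s <= e -> directed_side d (g @` `[0, s]) (g 0) (g s).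
Proof.
move=> b0 [[_ geo] [_ _ chr]] fin.
have I0 : `[0, b]%classic (0 : R) by rewrite /= in_itv/= lexx ltW.
have [c [e [sub /nbhs_singleton/(_ I0) Ic rea]]] := geo 0 I0.
have /andP[c0 _] : c <= 0 <= e by move: Ic; rewrite /= in_itv.
have ce : c < e by case: (d) rea => -[].
have c00 : c = 0.
  apply/eqP; rewrite eq_le c0/=.
  have /sub : `[c, e]%classic c by rewrite /= in_itv/= lexx ltW.
  by rewrite /= in_itv/= => /andP[].
rewrite {c Ic c0}c00 in sub rea ce.
have eb : e <= b.
  have /sub : `[0, e]%classic e by rewrite /= in_itv/= lexx ltW.
  by rewrite /= in_itv/= => /andP[].
exists e => [|s s0 se]; first by rewrite ce.
have Is t : 0 <= t -> t <= e -> `[0, b]%classic t.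
  by rewrite /= in_itv/= => -> te; rewrite (le_trans te).
have neq : g 0 <> g s.
  have [U U0 hU] := fin (g 0); have h0 := chron_irrefl (hU _ _ (nbhs_singleton U0) (nbhs_singleton U0)).
  move=> e0; apply: h0; rewrite {2}e0.
  by have := chr 0 s I0 (Is s (ltW s0) se) s0; case: (d) => /=; rewrite -?e0.
have Tfin (h : R -> X) : future_realizer 0 e h -> (tau (h 0%R) (h e) < +oo)%E.
  by move=> [_ [lip _ _] <-]; exact: causal_curve_finite.
case: d rea chr {geo} => /= rea chr; have := Tfin _ rea => tf.
  exists 0, s, g; split => //; apply: (realizer_initial rea) => //.
  by exists 0, s; split => //; rewrite /= in_itv/= lexx ltW.
pose h t := g (0 + e - t).
have h1 : h (e - s) = g s by rewrite /h; congr g; lra.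
have h2 : h e = g 0 by rewrite /h; congr g; lra.
exists (e - s), e, h; split => //.
  apply: (realizer_final rea) => //; first lra.
    by rewrite ltrBlDr ltrDl.
  exists (e - s), e; split; rewrite /= ?in_itv/= ?lexx ?andbT ?gerBl ?(ltW s0)//.
  by rewrite -/(h _) -/(h e) h1 h2 => /esym.
apply/seteqP; split => [_ [t /= + <-]|_ [t /= + <-]]; rewrite in_itv/= => /andP[t0 ts].
  by exists (e - t); rewrite /= ?in_itv/=; [apply/andP; split; lra|rewrite /h; congr g; lra].
by exists (e - t); rewrite /= ?in_itv/=; [apply/andP; split; lra|rewrite /h; congr g; lra].
Qed.

(** What is used of a timelike geodesic once it is cut off so close to its starting
point x that it stays in W and that all its initial segments are sides. *)
Definition short_geodesic d W x e g : Prop :=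
  [/\ g 0 = x, forall s t, 0 <= s -> s < t -> t <= e -> directed d (@chron R X) (g s) (g t),
      forall s, 0 <= s -> s <= e -> W (g s),
      forall s, 0 < s -> s <= e -> directed_side d (g @` `[0, s]) x (g s) &
      forall s, 0 <= s -> s < e -> g u @[u --> s^'+] --> g s].

Lemma short_geodesicW d W x e e' g : e' <= e -> short_geodesic d W x e g ->
  short_geodesic d W x e' g.
Proof.
move=> ee [h0 h1 h2 h3 h4]; split => //.
- by move=> s t s0 st te; apply: h1 => //; exact: le_trans te ee.
- by move=> s s0 se; apply: h2 => //; exact: le_trans se ee.
- by move=> s s0 se; apply: h3 => //; exact: le_trans se ee.
- by move=> s s0 se; apply: h4 => //; exact: lt_le_trans se ee.
Qed.

Lemma short_geodesic_exists d W x g b : 0 < b -> timelike_geodesic d 0 b g ->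
  (forall p, exists2 U : set X, nbhs p U & forall x y, U x -> U y -> (tau x y < +oo)%E) ->
  g 0 = x -> nbhs x W -> exists2 e, 0 < e <= b & short_geodesic d W x e g.
Proof.
move=> b0 geo fin g0 Wx; have [e /andP[e0 eb] sides] := geodesic_initial_sides b0 geo fin.
have [_ [lip _ chr]] := geo.
have I s : 0 <= s -> s <= b -> `[0, b]%classic s by rewrite /= in_itv/= => -> ->.
have I0 := I 0 (lexx 0) (ltW b0).
rewrite -g0 in Wx *.
have /nbhs_ballP[m /= m0 hm] := lipschitz_near lip I0 Wx.
pose f := Num.min e (m / 2).
have fe : f <= e by rewrite ge_min lexx.
have fm : f <= m / 2 by rewrite ge_min lexx orbT.
have f0 : 0 < f by rewrite lt_min e0 divr_gt0.
exists f; first by rewrite f0; lra.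
split => //.
- move=> s t s0 st tf; have := chr s t (I s s0 _) (I t _ _) st.
  by case: (d) => /=; apply; lra.
- move=> s s0 sf; apply: hm; last by apply: I => //; lra.
  by rewrite /ball/= sub0r normrN ger0_norm//; lra.
- by move=> s s0 sf; apply: sides => //; lra.
- move=> s s0 sf V Vs.
  have sb : s <= b by lra.
  have cts := lipschitz_near lip (I s s0 sb) Vs.
  apply: (_ : \forall u \near s^'+, V (g u)); near=> u.
  have su : s < u by near: u; exact: nbhs_right_gt.
  have ub : u < b by near: u; apply: nbhs_right_lt; lra.
  have Iu : `[0, b]%classic u by apply: I; lra.
  by move: Iu; near: u; apply: filterS cts => v hv _.
Unshelve. all: by end_near.
Qed.

End short_geodesics.

(** * Comparison angles in small neighbourhoods *)

Section neighbourhoods.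
Variables (R : realType) (X : lorentzPreLength R).
Implicit Types (a b c s t e m K : R) (p q x y z : X) (U W S : set X) (d : time_dir).

Definition tau_lt m W := forall p q, W p -> W q -> (tau p q < m%:E)%E.

Lemma tau_cvg U p q : open U -> {within U `*` U, continuous (fun xy : X * X => tau xy.1 xy.2)} ->
  U p -> U q -> tau xy.1 xy.2 @[xy --> (p, q)] --> tau p q.
Proof.
move=> oU /subspace_continuousP cU Up Uq; have := cU (p, q) (conj Up Uq).
rewrite within_interior//; exists (U, U) => //=.
by split; exact: open_nbhs_nbhs.
Qed.

Lemma tau_lt_near U x m : open U -> U x ->
  {within U `*` U, continuous (fun xy : X * X => tau xy.1 xy.2)} ->
  (tau x x < +oo)%E -> 0 < m -> exists2 W : set X, nbhs x W & W `<=` U /\ tau_lt m W.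
Proof.
move=> oU Ux cU /tau_diag xx m0.
have : \forall xy \near (x, x), (tau xy.1 xy.2 < m%:E)%E.
  have := tau_cvg oU cU Ux Ux; rewrite xx => h.
  have : nbhs (0%E : \bar R) [set y | (y < m%:E)%E].
    by apply: open_nbhs_nbhs; split; [exact: open_ereal_lt_ereal|rewrite /= lte_fin].
  by move/h.
case=> -[A B] /= [Ax Bx] h; exists (U `&` (A `&` B)).
  by apply: filterI; [exact: open_nbhs_nbhs|exact: filterI].
by split => [p []//|p q [_ [Ap _]] [_ [_ Bq]]]; exact: (h (p, q)).
Qed.

Lemma tau_fin m W p q : tau_lt m W -> W p -> W q -> exists2 t, tau p q = t%:E & 0 <= t < m.
Proof.
move=> h Wp Wq; have := h p q Wp Wq; have := tau_ge0 p q.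
by case: (tau p q) => // t; rewrite lee_fin lte_fin => t0 tm; exists t => //; apply/andP.
Qed.

Lemma directed_tau_fin d m W p q : tau_lt m W -> W p -> W q ->
  exists2 t, directed d (@tau R X) p q = t%:E & 0 <= t < m.
Proof. by move=> h Wp Wq; case: d => /=; exact: tau_fin h _ _. Qed.

Lemma sep_lt m W p q : tau_lt m W -> W p -> W q -> (sep p q < m%:E)%E.
Proof. by move=> h Wp Wq; rewrite /sep gt_max !h. Qed.

Lemma sepC p q : sep p q = sep q p.
Proof. by rewrite /sep maxC. Qed.

Lemma max3_lt (u v w l : \bar R) : (maxe u (maxe v w) < l)%E <-> [/\ (u < l)%E, (v < l)%E & (w < l)%E].
Proof. by rewrite !gt_max; split => [/and3P//|[-> -> ->]]. Qed.

Lemma rho_le_diameter K : ((rho K)%:E <= model_diameter K)%E.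
Proof.
rewrite /model_diameter; case: ltP => [K0|_]; last exact: leey.
have k0 : 0 < kappa K by apply: kappa_gt0; rewrite lt_eqF.
have -> : Num.sqrt (- K) = kappa K by rewrite /kappa ltr0_norm.
rewrite lee_fin ler_pdivlMr//.
have := @kappa_rho _ K (rho K); rewrite (ger0_norm (ltW (rho_gt0 K))) => /(_ (lexx _)).
have := pihalf_ge1 R; have := ler_norm (kappa K * rho K); lra.
Qed.

Lemma size_boundsW K W x y z : tau_lt (rho K) W -> W x -> W y -> W z -> size_bounds K x y z.
Proof.
move=> h Wx Wy Wz; apply: lt_le_trans (rho_le_diameter K).
by apply/max3_lt; split; exact: sep_lt h _ _.
Qed.

Lemma directed_caus_related d p q : causally_related p q ->
  directed d (@caus R X) p q \/ directed d (@caus R X) q p.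
Proof. by case: d => -[]; [left|right|right|left]. Qed.

Lemma directed_related_caus d p q : directed d (@caus R X) p q -> causally_related p q.
Proof. by case: d; [left|right]. Qed.

Lemma causally_relatedC p q : causally_related p q -> causally_related q p.
Proof. by case; [right|left]. Qed.

Lemma pairwise_causal_finiteW d m W x y z : tau_lt m W -> W x -> W y -> W z ->
  directed d (@chron R X) x y -> directed d (@chron R X) x z -> causally_related y z ->
  pairwise_causal_finite x y z.
Proof.
move=> h Wx Wy Wz xy xz yz; split.
  by split => //; apply: directed_related_caus; apply: directed_chron_caus; eassumption.
by split; apply: (lt_trans (sep_lt h _ _)) => //; rewrite ltry.
Qed.

Lemma has_comparison_angleW d K W x y z : tau_lt (rho K) W -> W x -> W y -> W z ->
  directed d (@chron R X) x y -> directed d (@chron R X) x z -> causally_related y z ->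
  has_comparison_angle K x y z.
Proof.
move=> h Wx Wy Wz xy xz yz; split; first exact: (pairwise_causal_finiteW h Wx Wy Wz xy xz yz).
- exact: size_boundsW h _ _ _.
- by case: d xy {xz}; [left|right].
- by case: d xz {xy}; [left|right].
Qed.

(** The pair y, z is ordered in one of two ways, and the angle is symmetric in them;
one formula holds for all curvatures that permit lengths up to m. *)
Lemma comparison_anglesE d m W x y z : tau_lt m W -> W x -> W y -> W z ->
  directed d (@chron R X) x y -> directed d (@chron R X) x z -> causally_related y z ->
  exists a b c, [/\ 0 < a, 0 <= b, a + b <= c & c < m] /\
    forall K, m <= rho K -> comparison_angle K x y z = arcosh (angle_cosh K a b c).
Proof.
move=> h Wx.
suff H y' z' : W y' -> W z' -> directed d (@chron R X) x y' -> directed d (@chron R X) x z' ->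
    directed d (@caus R X) y' z' ->
    exists a b c, [/\ 0 < a, 0 <= b, a + b <= c & c < m] /\
    forall K, m <= rho K -> comparison_angle K x y' z' = arcosh (angle_cosh K a b c).
  move=> Wy Wz xy xz /(directed_caus_related d)[yz|zy]; first exact: H.
  have [a [b [c [h1 h2]]]] := H z y Wz Wy xz xy zy.
  by exists a, b, c; split => // K mK; rewrite comparison_angleC h2.
move=> Wy Wz xy xz yz.
have [a ta _] := directed_tau_fin d h Wx Wy.
have [b tb _] := directed_tau_fin d h Wy Wz.
have [c tc /andP[_ cm]] := directed_tau_fin d h Wx Wz.
exists a, b, c; split; last first.
  by move=> K mK; have [] := comparison_angleE xy xz yz ta tb tc (ltW (lt_le_trans cm mK)).
have a0 : 0 < a by have := (directed_tau_gt0 d x y').2 xy; rewrite ta lte_fin.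
have b0 : 0 <= b by have := directed_tau_ge0 d y' z'; rewrite tb lee_fin.
split => //.
by have := chain_reverse_triangle (directed_chron_caus xy) yz; rewrite ta tb tc -EFinD lee_fin.
Qed.

Lemma comparison_angle_le K K' e : 0 < e -> exists2 m, 0 < m & forall d W x y z,
  tau_lt m W -> W x -> W y -> W z ->
  directed d (@chron R X) x y -> directed d (@chron R X) x z -> causally_related y z ->
  comparison_angle K x y z <= comparison_angle K' x y z + e.
Proof.
move=> e0; have [m m0 hm] := small_angle_le K K' e0.
pose n := Num.min m (Num.min (rho K) (rho K')).
have nm : n <= m by rewrite ge_min lexx.
have nK : n <= rho K by rewrite !ge_min lexx orbT.
have nK' : n <= rho K' by rewrite !ge_min lexx !orbT.
exists n => [|d W x y z h Wx Wy Wz xy xz yz]; first by rewrite !lt_min m0 !rho_gt0.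
have [a [b [c [[a0 b0 abc cn] E]]]] := comparison_anglesE h Wx Wy Wz xy xz yz.
by rewrite !E//; apply: hm => //; lra.
Qed.

Lemma directed_chron_side d U p q : strictly_timelike_geodesically_connected U ->
  U p -> U q -> directed d (@chron R X) p q ->
  exists2 S, S `<=` U & directed_side d S p q.
Proof.
move=> [_ conn].
have side_in u v : U u -> U v -> chron u v -> exists2 S, S `<=` U & side u v S.
  move=> Uu Uv uv; have [[a [b [g [h1 h2 h3 h4 h5]]]] _] := conn _ _ Uu Uv uv.
  by exists (g @` `[a, b]) => //; exists a, b, g.
by case: d => /= Up Uq pq; exact: side_in.
Qed.

(** Both monotonicity conditions as seen from the common end point x of the two
sides along which the points move. *)
Lemma monotonicity_directed d r K U x y z Sxy Sxz y' z' :
  monotonicity_condition d r K U -> strictly_timelike_geodesically_connected U ->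
  (forall p q, U p -> U q -> (tau p q < +oo)%E) ->
  U x -> U y -> U z -> directed d (@chron R X) x y -> directed d (@chron R X) y z ->
  directed_side d Sxy x y -> directed_side d Sxz x z -> Sxy `<=` U -> Sxz `<=` U ->
  size_bounds K x y z -> Sxy y' -> Sxz z' -> y' <> x -> z' <> x -> causally_related z' y' ->
  r (comparison_angle K x y' z') (comparison_angle K x y z).
Proof.
move=> mono conn fin Ux Uy Uz xy yz sxy sxz Uxy Uxz sz y'S z'S y'x z'x c.
have [Syz Uyz syz] := directed_chron_side conn Uy Uz yz.
case: d mono xy yz sxy sxz syz => /= mono xy yz sxy sxz syz.
  by apply: (mono x y z Sxy Syz Sxz _ sz) => //; split => //; split; exact: fin.
rewrite comparison_angleC [comparison_angle K x y z]comparison_angleC.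
apply: (mono z y x Syz Sxy Sxz) => //; first by split => //; split; exact: fin.
move: sz => /max3_lt[h1 h2 h3].
by apply/max3_lt; rewrite (sepC z y) (sepC y x) (sepC z x).
Qed.

End neighbourhoods.

(** * Monotonicity of angles along two geodesics *)

Section upper_angles.
Variables (R : realType) (X : lorentzPreLength R).
Implicit Types (a b c s t e m K : R) (p q x y z : X) (U W S : set X) (d : time_dir)
  (r : rel R) (f g : R -> X).

(** This is the push-up property, a consequence of the reverse triangle inequality. *)
Lemma directed_push_up d p q z : directed d (@caus R X) p q -> directed d (@chron R X) q z ->
  directed d (@chron R X) p z.
Proof.
move=> pq qz; apply/directed_tau_gt0.
have := chain_reverse_triangle pq (directed_chron_caus qz); apply: lt_le_trans.
by rewrite lte_paddl ?directed_tau_ge0//; exact/directed_tau_gt0.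
Qed.

Lemma directed_tau_cvg d U p g t (F : set_system R) : ProperFilter F -> open U ->
  {within U `*` U, continuous (fun xy : X * X => tau xy.1 xy.2)} ->
  U p -> U (g t) -> g @ F --> g t ->
  directed d (@tau R X) p (g u) @[u --> F] --> directed d (@tau R X) p (g t).
Proof.
move=> FF oU cU Up Ut gt; case: d => /=.
  apply: (cvg_comp2 _ _ (tau_cvg oU cU Up Ut)); [exact: cvg_cst|exact: gt].
by apply: (cvg_comp2 _ _ (tau_cvg oU cU Ut Up)); [exact: gt|exact: cvg_cst].
Qed.

(** For a null related pair the triangle of the monotonicity condition does not
exist; moving the later point a little further along its geodesic makes the
relation timelike, and the angle depends continuously on that point. *)
Lemma angle_monotone_ordered d r K U W x e f g s t s' t' :
  (forall v, closed [set w | r v w]) -> monotonicity_condition d r K U ->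
  strictly_timelike_geodesically_connected U ->
  (forall p q, U p -> U q -> (tau p q < +oo)%E) ->
  {within U `*` U, continuous (fun xy : X * X => tau xy.1 xy.2)} ->
  W `<=` U -> tau_lt (rho K) W ->
  short_geodesic d W x e f -> short_geodesic d W x e g ->
  0 < s' -> s' <= s -> s < e -> 0 < t' -> t' <= t -> t < e ->
  directed d (@caus R X) (f s) (g t) -> causally_related (f s') (g t') ->
  r (comparison_angle K x (f s') (g t')) (comparison_angle K x (f s) (g t)).
Proof.
move=> cr mono conn fin cU WU hW [f0 fc fW fs fr] [g0 gc gW gs gr] s'0 ss se t'0 tt te fg fg'.
have s0 : 0 < s by lra.
have t0 : 0 < t by lra.
have oU := conn.1.
have Wx : W x by rewrite -f0; apply: fW; lra.
have Wf u : 0 <= u -> u < e -> W (f u) by move=> u0 ue; apply: fW => //; exact: ltW.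
have Wg u : 0 <= u -> u < e -> W (g u) by move=> u0 ue; apply: gW => //; exact: ltW.
have xf u : 0 < u -> u < e -> directed d (@chron R X) x (f u).
  by move=> u0 ue; rewrite -f0; apply: fc => //; exact: ltW.
have xg u : 0 < u -> u < e -> directed d (@chron R X) x (g u).
  by move=> u0 ue; rewrite -g0; apply: gc => //; exact: ltW.
have irr p q : W p -> directed d (@chron R X) p q -> q <> p.
  move=> Wp + qp; rewrite qp => pp; apply: (@chron_irrefl _ _ p); first by apply: fin; exact: WU.
  by case: (d) pp.
have [a ta _] := directed_tau_fin d hW Wx (Wf s (ltW s0) se).
have [b tb _] := directed_tau_fin d hW (Wf s (ltW s0) se) (Wg t (ltW t0) te).
have [c tc /andP[_ cK]] := directed_tau_fin d hW Wx (Wg t (ltW t0) te).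
have [a0 b0 abc ->] := comparison_angleE (xf s s0 se) (xg t t0 te) fg ta tb tc (ltW cK).
pose fb u := fine (directed d (@tau R X) (f s) (g u)).
pose fc' u := fine (directed d (@tau R X) x (g u)).
have ct p : U p -> directed d (@tau R X) p (g u) @[u --> t^'+] --> directed d (@tau R X) p (g t).
  have Ut : U (g t) by apply/WU/Wg => //; exact: ltW.
  by move=> Up; exact: (@directed_tau_cvg d U p g t _ _ oU cU Up Ut (gr t (ltW t0) te)).
have lim : arcosh (angle_cosh K a (fb u) (fc' u)) @[u --> t^'+] -->
    arcosh (angle_cosh K a b c).
  apply: cvg_angle => //; first exact: ltW.
    by apply: fine_cvg; rewrite -tb; apply/ct/WU/Wf => //; exact: ltW.
  by apply: fine_cvg; rewrite -tc; exact/ct/WU.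
apply: (closed_cvg (fun w => r (comparison_angle K x (f s') (g t')) w) (cr _) _ _ lim).
near=> u.
have tu : t < u by near: u; exact: nbhs_right_gt.
have ue : u < e by near: u; exact: nbhs_right_lt.
have u0 : 0 < u by lra.
have fgu : directed d (@chron R X) (f s) (g u).
  by apply: directed_push_up fg _; apply: gc => //; lra.
have Wfs := Wf s (ltW s0) se; have Wgu := Wg u (ltW u0) ue.
have [c' tc' /andP[_ cK']] := directed_tau_fin d hW Wx Wgu.
have [b' tb' _] := directed_tau_fin d hW Wfs Wgu.
have [_ _ _ E] := comparison_angleE (xf s s0 se) (xg u u0 ue) (directed_chron_caus fgu)
  ta tb' tc' (ltW cK').
rewrite /fb /fc' tb' tc' /= -E.
apply: (monotonicity_directed mono conn fin _ _ _ (xf s s0 se) fgu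
  (fs s s0 (ltW se)) (gs u u0 (ltW ue))).
- exact: WU.
- exact: WU.
- exact: WU.
- by move=> _ [v /= + <-]; rewrite in_itv/= => /andP[v0 vs]; apply/WU/Wf => //; lra.
- by move=> _ [v /= + <-]; rewrite in_itv/= => /andP[v0 vs]; apply/WU/Wg => //; lra.
- exact: size_boundsW hW _ _ _.
- by exists s' => //; rewrite /= in_itv/= (ltW s'0).
- by exists t' => //; rewrite /= in_itv/= (ltW t'0); lra.
- by apply: irr => //; apply: xf => //; lra.
- by apply: irr => //; apply: xg => //; lra.
- exact: causally_relatedC.
Unshelve. all: by end_near.
Qed.

Lemma angle_monotone d r K U W x e f g s t s' t' :
  (forall v, closed [set w | r v w]) -> monotonicity_condition d r K U ->
  strictly_timelike_geodesically_connected U ->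
  (forall p q, U p -> U q -> (tau p q < +oo)%E) ->
  {within U `*` U, continuous (fun xy : X * X => tau xy.1 xy.2)} ->
  W `<=` U -> tau_lt (rho K) W ->
  short_geodesic d W x e f -> short_geodesic d W x e g ->
  0 < s' -> s' <= s -> s < e -> 0 < t' -> t' <= t -> t < e ->
  causally_related (f s) (g t) -> causally_related (f s') (g t') ->
  r (comparison_angle K x (f s') (g t')) (comparison_angle K x (f s) (g t)).
Proof.
move=> cr mono conn fin cU WU hW sf sg s'0 ss se t'0 tt te /(directed_caus_related d)[fg|gf] fg'.
  exact: (angle_monotone_ordered cr mono conn fin cU WU hW sf sg).
rewrite comparison_angleC [comparison_angle K x (f s) _]comparison_angleC.
apply: (angle_monotone_ordered cr mono conn fin cU WU hW sg sf) => //.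
exact: causally_relatedC.
Qed.

(** By lower semicontinuity of the time separation, a fixed point of g, which is
timelike related to x, is so to all points of f that are sufficiently close
to x. *)
Lemma related_pairs d W x e f g : 0 < e ->
  short_geodesic d W x e f -> short_geodesic d W x e g ->
  exists s t, [/\ 0 < s < e, 0 < t < e & causally_related (f s) (g t)].
Proof.
move=> e0 [f0 _ _ _ fr] [g0 gc _ _ _].
have h2 : 0 < e / 2 by lra.
have xg : directed d (@chron R X) x (g (e / 2)) by rewrite -g0; apply: gc; lra.
have [V Vx hV] : exists2 V : set X, nbhs x V &
    forall p, V p -> directed d (@chron R X) p (g (e / 2)).
  case: (d) xg => /= /tau_gt0 xg.
    have [V [[A B] /= [Ax Bg] AB] hV] := @tau_lsc R X (x, g (e / 2)) 0 xg.
    exists A => // p Ap; apply/tau_gt0; apply: (hV (p, _)); apply: AB; split => //.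
    exact: nbhs_singleton.
  have [V [[A B] /= [Ax Bg] AB] hV] := @tau_lsc R X (g (e / 2), x) 0 xg.
  exists B => // p Bp; apply/tau_gt0; apply: (hV (_, p)); apply: AB; split => //.
  exact: nbhs_singleton.
have : \forall s \near (0 : R)^'+, V (f s).
  by have := fr 0 (lexx 0) e0; rewrite f0; apply.
move=> near_V; near (0 : R)^'+ => s.
exists s, (e / 2); split.
- by apply/andP; split; near: s; [exact: nbhs_right_gt|exact: nbhs_right_lt].
- by rewrite h2/=; lra.
- apply: (@directed_related_caus _ _ d); apply: directed_chron_caus; apply: hV.
  by near: s.
Unshelve. all: by end_near.
Qed.

End upper_angles.

(** * Comparison angles and the upper angle *)

Section limits.
Variables (R : realType) (X : lorentzPreLength R).
Implicit Types (b e m v K : R) (x y : X) (U W : set X) (d : time_dir) (r : rel R) (f g : R -> X).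

Lemma comparison_angles_near d x b f g K K' e : 0 < b ->
  (forall p : X, exists2 U : set X, nbhs p U & forall x y, U x -> U y -> (tau x y < +oo)%E) ->
  (forall m, 0 < m -> exists2 W : set X, nbhs x W & tau_lt m W) ->
  timelike_geodesic d 0 b f -> timelike_geodesic d 0 b g -> f 0 = x -> g 0 = x -> 0 < e ->
  exists2 m, 0 < m & forall s t, 0 < s < m -> 0 < t < m -> causally_related (f s) (g t) ->
  comparison_angle K x (f s) (g t) <= comparison_angle K' x (f s) (g t) + e.
Proof.
move=> b0 fin small gf gg f0 g0 e0.
have [n n0 hn] := comparison_angle_le X K K' e0.
have [W Wx hW] := small n n0.
have [k /andP[k0 _] [kf0 kf1 kf2 _ _]] := short_geodesic_exists b0 gf fin f0 Wx.
have [l /andP[l0 _] [lg0 lg1 lg2 _ _]] := short_geodesic_exists b0 gg fin g0 Wx.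
exists (Num.min k l) => [|s t]; first by rewrite lt_min k0.
rewrite !lt_min => /and3P[s0 sk _] /and3P[t0 _ tl] fg.
apply: (hn d W) => //.
- exact: nbhs_singleton.
- by apply: kf2; exact: ltW.
- by apply: lg2; exact: ltW.
- by rewrite -kf0; apply: kf1 => //; exact: ltW.
- by rewrite -lg0; apply: lg1 => //; exact: ltW.
Qed.

(** Every set of the filter contains a related pair, by [related_pairs], so that the
supremum over it is at least v up to an arbitrary error. *)
Lemma le_upper_angle d W x m e f g v : 0 < e -> tau_lt m W ->
  short_geodesic d W x e f -> short_geodesic d W x e g ->
  (forall h, 0 < h -> exists2 n, 0 < n & forall s t, 0 < s < n -> 0 < t < n ->
    causally_related (f s) (g t) -> v <= comparison_angle 0 x (f s) (g t) + h) ->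
  (v%:E <= upper_angle x f g)%E.
Proof.
move=> e0 hW sf sg hv; rewrite /upper_angle limf_esupE; apply: le_ereal_inf_tmp.
move=> _ [V [[A B] /= [A0 B0] AB] <-].
have [a /= a0 hA] := A0; have [b /= b0 hB] := B0.
apply/lee_addgt0Pr => h h0; have [n n0 hn] := hv h h0.
pose k := Num.min (Num.min a b) (Num.min n e).
have k0 : 0 < k by rewrite !lt_min a0 b0 n0.
have ke : k <= e by rewrite !ge_min lexx !orbT.
have [s [t [sk tk fg]]] := related_pairs k0 (short_geodesicW ke sf) (short_geodesicW ke sg).
move: (sk) (tk); rewrite !lt_min => /andP[s0 /andP[/andP[sa _] /andP[sn_ se]]].
move=> /andP[t0 /andP[/andP[_ tb] /andP[tn te]]].
apply: (@le_trans _ _ (comparison_angle 0 x (f s) (g t) + h)%:E).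
  by rewrite lee_fin; apply: hn => //; apply/andP.
rewrite EFinD; apply: leeD2r; apply: ereal_sup_ubound; exists (s, t) => //.
apply: (AB (s, t)) => /=.
  split; [apply: hA|apply: hB] => //=; by rewrite sub0r normrN gtr0_norm.
have [f0 fc fW _ _] := sf; have [g0 gc gW _ _] := sg.
apply: (pairwise_causal_finiteW (d := d) hW) => //.
- by rewrite -f0; apply: fW => //; exact: ltW.
- by apply: fW; exact: ltW.
- by apply: gW; exact: ltW.
- by rewrite -{1}f0; apply: fc => //; exact: ltW.
- by rewrite -{1}g0; apply: gc => //; exact: ltW.
Qed.

(** The related pairs close to (0, 0) form a set of the filter. *)
Lemma upper_angle_le x f g v :
  (forall h, 0 < h -> exists2 n, 0 < n & forall s t, 0 < s < n -> 0 < t < n ->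
    causally_related (f s) (g t) -> comparison_angle 0 x (f s) (g t) <= v + h) ->
  (upper_angle x f g <= v%:E)%E.
Proof.
move=> hv; apply/lee_addgt0Pr => h h0; have [n n0 hn] := hv h h0.
rewrite /upper_angle limf_esupE; apply: ge_ereal_inf.
pose V := [set st : R * R | causally_related (f st.1) (g st.2) /\ 0 < st.1 < n /\ 0 < st.2 < n].
exists (ereal_sup [set (comparison_angle 0 x (f st.1) (g st.2))%:E | st in V]).
  exists V => //; exists ([set s : R | 0 < s < n], [set s : R | 0 < s < n]).
    by split => /=; near=> s; apply/andP; split; near: s;
      [exact: nbhs_right_gt|exact: nbhs_right_lt|exact: nbhs_right_gt|exact: nbhs_right_lt].
  by move=> [s t] /= [s0 t0] [[_ fg _] _].
apply: ge_ereal_sup => _ [[s t] /= [fg [s0 t0]] <-].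
by rewrite -EFinD lee_fin; exact: hn.
Unshelve. all: by end_near.
Qed.

Lemma monotonicity_locally_finite d r K (p : X) : monotonicity_comparison X d r K ->
  exists2 U : set X, nbhs p U & forall x y, U x -> U y -> (tau x y < +oo)%E.
Proof. by move=> /(_ p)[U [Up [fin _] _ _]]; exists U. Qed.

Lemma monotonicity_tau_lt d r K x m : monotonicity_comparison X d r K -> 0 < m ->
  exists2 W : set X, nbhs x W & tau_lt m W.
Proof.
move=> /(_ x)[U [/nbhs_singleton Ux [fin cU] [oU _] _]] m0.
by have [W Wx [_ hW]] := tau_lt_near oU Ux cU (fin x x Ux Ux) m0; exists W.
Qed.

Lemma angle_monotone_near d r K x b f g : (forall v, closed [set w | r v w]) ->
  monotonicity_comparison X d r K -> 0 < b ->
  timelike_geodesic d 0 b f -> timelike_geodesic d 0 b g -> f 0 = x -> g 0 = x ->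
  exists e W, [/\ 0 < e, tau_lt (rho K) W,
    short_geodesic d W x e f, short_geodesic d W x e g &
    forall s t s' t', 0 < s' -> s' <= s -> s < e -> 0 < t' -> t' <= t -> t < e ->
    causally_related (f s) (g t) -> causally_related (f s') (g t') ->
    r (comparison_angle K x (f s') (g t')) (comparison_angle K x (f s) (g t))].
Proof.
move=> cr mono b0 gf gg f0 g0.
have fin p := monotonicity_locally_finite p mono.
have [U [/nbhs_singleton Ux [finU cU] conn monoU]] := mono x.
have [W Wx [WU hW]] := tau_lt_near conn.1 Ux cU (finU x x Ux Ux) (rho_gt0 K).
have [k /andP[k0 _] sf] := short_geodesic_exists b0 gf fin f0 Wx.
have [l /andP[l0 _] sg] := short_geodesic_exists b0 gg fin g0 Wx.
have sf' : short_geodesic d W x (Num.min k l) f.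
  by apply: short_geodesicW sf; rewrite ge_min lexx.
have sg' : short_geodesic d W x (Num.min k l) g.
  by apply: short_geodesicW sg; rewrite ge_min lexx orbT.
exists (Num.min k l), W; split => // [|s t s' t']; first by rewrite lt_min k0.
exact: (angle_monotone cr monoU conn finU cU WU hW sf' sg').
Qed.

Lemma short_has_comparison_angle d K W x e f g s t : tau_lt (rho K) W ->
  short_geodesic d W x e f -> short_geodesic d W x e g -> 0 < s < e -> 0 < t < e ->
  causally_related (f s) (g t) -> has_comparison_angle K x (f s) (g t).
Proof.
move=> hW [f0 fc fW _ _] [g0 gc gW _ _] /andP[s0 se] /andP[t0 te] fg.
apply: (has_comparison_angleW (d := d) hW) => //.
- by rewrite -f0; apply: fW => //; rewrite ltW// (lt_trans s0).
- by apply: fW; exact: ltW.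
- by apply: gW; exact: ltW.
- by rewrite -{1}f0; apply: fc => //; exact: ltW.
- by rewrite -{1}g0; apply: gc => //; exact: ltW.
Qed.

End limits.

Theorem corollary3p8 (R : realType) (X : lorentzPreLength R) (K : R) (d : time_dir) :
  (monotonicity_from_below X d K ->
    forall (x : X) (B : R) (alpha beta : R -> X), 0 < B ->
      timelike_geodesic d 0 B alpha -> timelike_geodesic d 0 B beta ->
      alpha 0 = x -> beta 0 = x ->
      exists2 e : R, 0 < e & forall s t : R,
        0 < s <= B -> 0 < t <= B -> s < e -> t < e ->
        causally_related (alpha s) (beta t) ->
        has_comparison_angle K x (alpha s) (beta t) /\
        ((comparison_angle K x (alpha s) (beta t))%:E
           <= upper_angle x alpha beta)%E)
  /\
  (monotonicity_from_above X d K ->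
    forall (x : X) (B : R) (alpha beta : R -> X), 0 < B ->
      timelike_geodesic d 0 B alpha -> timelike_geodesic d 0 B beta ->
      alpha 0 = x -> beta 0 = x ->
      exists2 e : R, 0 < e & forall s t : R,
        0 < s <= B -> 0 < t <= B -> s < e -> t < e ->
        causally_related (alpha s) (beta t) ->
        has_comparison_angle K x (alpha s) (beta t) /\
        (upper_angle x alpha beta
           <= (comparison_angle K x (alpha s) (beta t))%:E)%E).
Proof.
split=> mono x B f g B0 gf gg f0 g0.
- have [e [W [e0 hW sf sg inc]]] := angle_monotone_near (@closed_le R) mono B0 gf gg f0 g0.
  exists e => // s t /andP[s0 _] /andP[t0 _] se te fg; split.
    by apply: (short_has_comparison_angle hW sf sg) => //; apply/andP.
  apply: (le_upper_angle e0 hW sf sg) => h h0.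
  have [n n0 hn] := comparison_angles_near K 0 B0 (fun p => monotonicity_locally_finite p mono)
    (fun m => monotonicity_tau_lt x mono (m := m)) gf gg f0 g0 h0.
  exists (Num.min n (Num.min s t)) => [|s' t']; first by rewrite !lt_min n0 s0.
  rewrite !lt_min => /and4P[s'0 s'n s's _] /and4P[t'0 t'n _ t't] fg'.
  apply: le_trans (inc _ _ _ _ s'0 (ltW s's) se t'0 (ltW t't) te fg fg') _.
  by apply: hn => //; apply/andP.
- have [e [W [e0 hW sf sg inc]]] := angle_monotone_near (@closed_ge R) mono B0 gf gg f0 g0.
  exists e => // s t /andP[s0 _] /andP[t0 _] se te fg; split.
    by apply: (short_has_comparison_angle hW sf sg) => //; apply/andP.
  apply: upper_angle_le => h h0.
  have [n n0 hn] := comparison_angles_near 0 K B0 (fun p => monotonicity_locally_finite p mono)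
    (fun m => monotonicity_tau_lt x mono (m := m)) gf gg f0 g0 h0.
  exists (Num.min n (Num.min s t)) => [|s' t']; first by rewrite !lt_min n0 s0.
  rewrite !lt_min => /and4P[s'0 s'n s's _] /and4P[t'0 t'n _ t't] fg'.
  apply: le_trans (hn s' t' _ _ fg') _; [exact/andP|exact/andP|].
  by rewrite lerD2r; exact: (inc s t s' t' s'0 (ltW s's) se t'0 (ltW t't) te fg fg').
Qed.
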